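(* Let $X$ be a finite psybracket, let $K$ be an oriented pseudoknot diagram or an oriented singular knot diagram, and let $\mathcal{C}(K,X)$ be the set of $X$-colorings of $K$. Then the number of $X$-colorings $$\Phi_X^{\mathbb{Z}}(K)=|\mathcal{C}(K,X)|$$ is an integer-valued invariant of pseudoknots and singular knots; that is, if two oriented pseudoknot diagrams $K,K'$ are related by a finite sequence of planar isotopies and pseudoknot Reidemeister moves, or two oriented singular knot diagrams $K,K'$ are related by a finite sequence of planar isotopies and singular knot Reidemeister moves, then $\Phi_X^{\mathbb{Z}}(K)=\Phi_X^{\mathbb{Z}}(K')$.
   Context: **Psybrackets.** Let $X$ be a set. A psybracket structure on $X$ consists of two maps $\langle\,,\,,\rangle_c,\ \langle\,,\,,\rangle_p : X\times X\times X\to X$ such that: (i) For all $a,b,c\in X$ there exist unique $x,y,z,u,v\in X$ such that $\langle a,b,x\rangle_c=c$; $\langle a,y,b\rangle_c=c$; $\langle z,a,b\rangle_c=c$; $\langle u,b,c\rangle_p=b$; $\langle a,b,v\rangle_p=b$. (ii) For all $a,b,c\in X$: $\langle a,\langle a,b,c\rangle_c,c\rangle_p=\langle a,\langle a,b,c\rangle_p,c\rangle_c$. (iii) For all $a,b,c,d\in X$: $\langle\langle a,b,c\rangle_c,c,d\rangle_c=\langle\langle a,b,\langle b,c,d\rangle_c\rangle_c,\langle b,c,d\rangle_c,d\rangle_c$, $\langle\langle a,b,c\rangle_c,c,d\rangle_c=\langle\langle a,b,\langle b,c,d\rangle_p\rangle_c,\langle b,c,d\rangle_p,d\rangle_c$,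 $\langle\langle a,b,c\rangle_p,c,d\rangle_c=\langle\langle a,b,\langle b,c,d\rangle_c\rangle_c,\langle b,c,d\rangle_c,d\rangle_p$, $\langle a,b,\langle b,c,d\rangle_c\rangle_c=\langle a,\langle a,b,c\rangle_c,\langle\langle a,b,c\rangle_c,c,d\rangle_c\rangle_c$, $\langle a,b,\langle b,c,d\rangle_c\rangle_c=\langle a,\langle a,b,c\rangle_p,\langle\langle a,b,c\rangle_p,c,d\rangle_c\rangle_c$, $\langle a,b,\langle b,c,d\rangle_p\rangle_c=\langle a,\langle a,b,c\rangle_c,\langle\langle a,b,c\rangle_c,c,d\rangle_c\rangle_p$. **Diagrams and moves.** An oriented pseudoknot diagram is an oriented knot or link diagram whose double points are of three kinds: positive classical crossings, negative classical crossings, and precrossings (transverse double points with no over/under information). An oriented singular knot diagram is the same, with precrossings called singular crossings (4-valent rigid vertices where two strands cross transversely); singular crossings are identified with precrossings. The pseudoknot Reidemeister moves are the oriented versions of: the classical Reidemeister moves I, II, III; the moves PI and PI$'$, which introduce or remove a kink (one-crossing curl, of either type) whose crossing is a precrossing; the move PII, which slides a classical crossing through an adjacent precrossing with which it bounds a bigon, to the opposite side of the precrossing, keeping its sign (for two parallel strands: ''classical crossing followed by precrossing'' is replaced by ''precrossing followed by classical crossing''); and the moves PIII and PIII$'$, in which a strand passing over (respectively under) both strands of a precrossing is moved across that precrossing. The singular knot Reidemeister moves are the same list with PI and PI$'$ omitted. A pseudoknot (respectively singular knot) is an equivalence class of pseudoknot (respectively singular knot) diagrams under the equivalence relation generated by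 planar isotopy and the pseudoknot (respectively singular knot) Reidemeister moves. **Colorings.** An $X$-coloring (psybracket coloring) of a diagram $D$ is an assignment of an element of $X$ to each region of the complement of $D$ in the plane such that the following holds at every crossing. Rotate the picture so that both strands at the crossing are directed downward; let $a$ be the color of the left region, $b$ the color of the top region (between the two incoming edges), $c$ the color of the right region, and $d$ the color of the bottom region (between the two outgoing edges). Then - at a positive classical crossing, $d=\langle a,b,c\rangle_c$; - at a negative classical crossing, $b=\langle a,d,c\rangle_c$; - at a precrossing or singular crossing, $d=\langle a,b,c\rangle_p$. Crossing signs are the usual ones: a crossing is positive if (direction of over-strand, direction of under-strand) is a positively oriented basis of the plane. The number $\Phi_X^{\mathbb{Z}}(K)$ is called the psybracket counting invariant. *)

(* Defs.v *)
From Stdlib Require Import Relation_Operators.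
From mathcomp Require Import all_boot all_order all_algebra finmap.
From mathcomp Require Import all_classical all_reals all_analysis.

Set Implicit Arguments.
Unset Strict Implicit.
Unset Printing Implicit Defensive.

Import Order.TTheory GRing.Theory Num.Theory numFieldNormedType.Exports.

Local Open Scope classical_set_scope.
Local Open Scope ring_scope.

Record psybracket (X : Type) := Psybracket {
  cbr : X -> X -> X -> X;
  pbr : X -> X -> X -> X;
  cbr_solve3 : forall a b c, exists! x, cbr a b x = c;
  cbr_solve2 : forall a b c, exists! y, cbr a y b = c;
  cbr_solve1 : forall a b c, exists! z, cbr z a b = c;
  pbr_solve1 : forall b c, exists! u, pbr u b c = b;
  pbr_solve3 : forall a b, exists! v, pbr a b v = b;
  pbr_cbrC : forall a b c, pbr a (cbr a b c) c = cbr a (pbr a b c) c;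
  cbr_ccc : forall a b c d,
    cbr (cbr a b c) c d = cbr (cbr a b (cbr b c d)) (cbr b c d) d;
  cbr_ccp : forall a b c d,
    cbr (cbr a b c) c d = cbr (cbr a b (pbr b c d)) (pbr b c d) d;
  cbr_cpc : forall a b c d,
    cbr (pbr a b c) c d = pbr (cbr a b (cbr b c d)) (cbr b c d) d;
  cbr_ccc' : forall a b c d,
    cbr a b (cbr b c d) = cbr a (cbr a b c) (cbr (cbr a b c) c d);
  cbr_ccp' : forall a b c d,
    cbr a b (cbr b c d) = cbr a (pbr a b c) (cbr (pbr a b c) c d);
  cbr_cpc' : forall a b c d,
    cbr a b (pbr b c d) = pbr a (cbr a b c) (cbr (cbr a b c) c d)
}.

(* Positive classical, negative classical, and precrossing or singular
   crossing. Which strand of a classical crossing is over is recovered from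
   the sign and the orientation; see [passes_over]. *)
Variant crossing_kind := Pos | Neg | Pre.

Section Diagrams.
Variable R : realType.

(* The pair (p, q) is the straight edge oriented from p to q. *)
Local Notation point := (R * R)%type.
Local Notation edge := (point * point)%type.

Definition dir (e : edge) : point := e.2 - e.1.

Definition det (u v : point) : R := u.1 * v.2 - u.2 * v.1.

Definition segment (e : edge) : set point :=
  [set x | exists2 t : R, 0 <= t <= 1 & x = e.1 + t *: dir e].

Definition open_segment (e : edge) : set point :=
  [set x | exists2 t : R, 0 < t < 1 & x = e.1 + t *: dir e].

Definition endpoint (e : edge) : set point := [set e.1; e.2].

(* An oriented polygonal link diagram in general position. The first two
   conditions say that every vertex is the head of exactly one edge and the
   tail of exactly one edge, so that the edges form disjoint oriented closed
   polygons. Distinct edges meet only at common vertices or transversally at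
   interior points, and there are no triple points. *)
Definition generic (E : seq edge) : Prop :=
  [/\ uniq (unzip1 E),
      perm_eq (unzip1 E) (unzip2 E),
      forall e, e \in E -> e.1 != e.2,
      forall e f x, e \in E -> f \in E -> e != f ->
        segment e x -> segment f x ->
        endpoint e x /\ endpoint f x \/
        [/\ open_segment e x, open_segment f x & det (dir e) (dir f) != 0]
    & forall e f g x, e \in E -> f \in E -> g \in E ->
        open_segment e x -> open_segment f x -> open_segment g x ->
        [|| e == f, f == g | e == g] ].

(* Only the values of [kind] at double points are meaningful. *)
Record diagram := Diagram {
  edges : seq edge;
  kind : point -> crossing_kind;
  edges_generic : generic edges
}.

Definition support (K : diagram) : set point :=
  [set x | exists2 e, e \in edges K & segment e x].

(* The two strands at a double point are listed so that their directions form
   a positively oriented basis. *)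
Definition crossing (K : diagram) (e f : edge) (x : point) : Prop :=
  [/\ e \in edges K, f \in edges K, open_segment e x, open_segment f x
    & 0 < det (dir e) (dir f)].

Definition double_point (K : diagram) (x : point) : Prop :=
  exists e f, crossing K e f x.

Definition region (K : diagram) : Type :=
  {r : set point | exists2 x, (~` support K) x &
                              r = connected_component (~` support K) x}.

(* The region seen from x when looking a short distance in the direction w. *)
Definition sector (K : diagram) (x w : point) (r : region K) : Prop :=
  \forall t \near 0^'+, sval r (x + t *: w).

Section Colorings.
Variables (X : Type) (B : psybracket X).

Definition crossing_rule (k : crossing_kind) (a b c d : X) : Prop :=
  match k with
  | Pos => d = cbr B a b c
  | Neg => b = cbr B a d c
  | Pre => d = pbr B a b c
  end.

(* If u, v are the directions of the two strands and 0 < det u v, then, once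
   the picture is rotated so that both strands go downward, u goes from the
   upper right to the lower left and v from the upper left to the lower right.
   Hence u + v points to the bottom region, - (u + v) to the top region,
   u - v to the left region and v - u to the right region. *)
Definition coloring (K : diagram) (col : region K -> X) : Prop :=
  forall e f x, crossing K e f x ->
  exists l t r b : region K,
    [/\ sector x (dir e - dir f) l,
        sector x (- (dir e + dir f)) t,
        sector x (dir f - dir e) r,
        sector x (dir e + dir f) b
      & crossing_rule (kind K x) (col l) (col t) (col r) (col b)].

Definition colorings (K : diagram) : set (region K -> X) :=
  [set col | @coloring K col].

End Colorings.

Definition counting_invariant (X : finType) (B : psybracket X) (K : diagram) :
  nat := #|` fset_set (@colorings X B K)|%fset.

Definition homeomorphism (h : point -> point) : Prop :=
  exists g : point -> point,
    [/\ cancel h g, cancel g h, continuous h & continuous g].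

Definition triangle (p : point * point * point) : set point :=
  let: (a, b, c) := p in
  [set x | exists s t : R,
     [/\ 0 <= s, 0 <= t, s + t <= 1 & x = a + s *: (b - a) + t *: (c - a)]].

Definition affine_positive_on (h : point -> point)
    (p : point * point * point) : Prop :=
  let: (a, b, c) := p in
  [/\ 0 < det (b - a) (c - a),
      0 < det (h b - h a) (h c - h a)
    & forall s t : R, 0 <= s -> 0 <= t -> s + t <= 1 ->
        h (a + s *: (b - a) + t *: (c - a)) =
        h a + s *: (h b - h a) + t *: (h c - h a)].

(* Piecewise linear maps that preserve the orientation of the plane. *)
Definition pl_positive (h : point -> point) : Prop :=
  forall x : point, exists2 s : seq (point * point * point),
    forall p, p \in s -> affine_positive_on h p &
    \forall y \near x, exists2 p, p \in s & triangle p y.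

Definition before (e : edge) (x y : point) : Prop :=
  exists s t : R,
    [/\ 0 <= s, s < t, t <= 1, x = e.1 + s *: dir e & y = e.1 + t *: dir e].

(* h maps K onto K' as oriented curves with marked double points; the edges
   themselves need not correspond, so vertices may be inserted or removed. *)
Definition carries (h : point -> point) (K K' : diagram) : Prop :=
  [/\ h @` support K = support K',
      forall e e' x y, e \in edges K -> e' \in edges K' -> before e x y ->
        h @` segment (x, y) `<=` segment e' -> before e' (h x) (h y),
      forall x, double_point K x <-> double_point K' (h x)
    & forall x, double_point K x -> kind K' (h x) = kind K x].

(* Ambient isotopy of the plane, in the piecewise linear category. That each
   [H t] preserves orientation is no extra restriction, since it is joined to
   the identity by homeomorphisms. *)
Definition planar_isotopic (K K' : diagram) : Prop :=
  exists H : R -> point -> point,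
    [/\ {within `[0, 1] `*` setT,
           continuous (fun tx : R * point => H tx.1 tx.2)},
        forall t : R, 0 <= t <= 1 -> homeomorphism (H t) /\ pl_positive (H t),
        H 0 = id
      & carries (H 1) K K'].

(* Every move takes place in the square [-2, 2] x [-2, 2]: since planar
   isotopies are ambient, the disc supporting a move can always be carried to
   this position. *)
Definition square : set point := [set x | `|x.1| <= 2 /\ `|x.2| <= 2].

(* K and K' consist of S, respectively S', inside the square and coincide
   outside. The exterior edges reach the square only at end vertices of the
   strands of S. *)
Definition replaces (S S' : seq edge) (K K' : diagram) : Prop :=
  exists ext : seq edge,
    [/\ perm_eq (edges K) (ext ++ S),
        perm_eq (edges K') (ext ++ S'),
        forall e x, e \in ext -> segment e x -> square x ->
          x \in unzip1 S ++ unzip2 S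
      & forall x, double_point K x -> ~ square x -> kind K' x = kind K x].

(* The polygonal arc with vertices p, traversed forwards or backwards. *)
Definition strand (o : bool) (p : seq point) : seq edge :=
  let q := if o then p else rev p in zip q (behead q).

(* A classical crossing is positive when the directions of the over-strand and
   of the under-strand form, in this order, a positive basis. *)
Definition passes_over (K : diagram) (S T : seq edge) : Prop :=
  forall e f x, e \in S -> f \in T -> open_segment e x -> open_segment f x ->
    kind K x = if 0 < det (dir e) (dir f) then Pos else Neg.

Definition straight_arc : seq point := [:: (-2, 0); (2, 0)].
Definition kink_arc : seq point :=
  [:: (-2, 0); (1, 3 / 2); (-1, 3 / 2); (2, 0)].

(* Adding a kink, whose crossing is (0, 1). The two orientations give the two
   kinks up to rotation. *)
Definition add_kink (P : crossing_kind -> Prop) (K K' : diagram) : Prop :=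
  exists o : bool,
    replaces (strand o straight_arc) (strand o kink_arc) K K' /\
    P (kind K' (0, 1)).

Definition move_RI : diagram -> diagram -> Prop := add_kink (fun k => k <> Pre).
Definition move_PI : diagram -> diagram -> Prop := add_kink (fun k => k = Pre).

(* [bent_arc] crosses [vertical_arc] at (0, -1) and (0, 1). *)
Definition vertical_arc : seq point := [:: (0, -2); (0, 2)].
Definition parallel_arc : seq point := [:: (1, -2); (1, 2)].
Definition bent_arc : seq point := [:: (1, -2); (-1, 0); (1, 2)].

Definition move_RII (K K' : diagram) : Prop :=
  exists o1 o2 : bool,
    let s := strand o1 vertical_arc in
    let t := strand o2 bent_arc in
    replaces (s ++ strand o2 parallel_arc) (s ++ t) K K' /\
    (passes_over K' s t \/ passes_over K' t s).

(* Sliding a crossing through the other vertex of a bigon does not change the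
   underlying curves; it exchanges the kinds of the two vertices. *)
Definition move_PII (K K' : diagram) : Prop :=
  exists o1 o2 : bool,
    let S := strand o1 vertical_arc ++ strand o2 bent_arc in
    [/\ replaces S S K K',
        kind K (0, -1) <> Pre, kind K (0, 1) = Pre,
        kind K' (0, -1) = Pre & kind K' (0, 1) = kind K (0, -1)].

(* The two diagonals cross at the origin, below or above which the third
   strand passes. *)
Definition diagonal_arc : seq point := [:: (-1, -2); (1, 2)].
Definition antidiagonal_arc : seq point := [:: (1, -2); (-1, 2)].
Definition low_arc : seq point := [:: (-2, 0); (0, - (4 / 3)); (2, 0)].
Definition high_arc : seq point := [:: (-2, 0); (0, 4 / 3); (2, 0)].

Definition slide_strand (P : crossing_kind -> Prop) (K K' : diagram) : Prop :=
  exists o1 o2 o3 : bool,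
    let D := strand o1 diagonal_arc ++ strand o2 antidiagonal_arc in
    let m := strand o3 low_arc in
    let m' := strand o3 high_arc in
    [/\ replaces (D ++ m) (D ++ m') K K',
        P (kind K (0, 0)), kind K' (0, 0) = kind K (0, 0)
      & passes_over K m D /\ passes_over K' m' D \/
        passes_over K D m /\ passes_over K' D m'].

(* Every classical third move slides its top strand across a crossing of the
   other two. *)
Definition move_RIII : diagram -> diagram -> Prop :=
  slide_strand (fun k => k <> Pre).
Definition move_PIII : diagram -> diagram -> Prop :=
  slide_strand (fun k => k = Pre).

Definition singular_move (K K' : diagram) : Prop :=
  [\/ move_RI K K', move_RII K K' | move_RIII K K'] \/
  (move_PII K K' \/ move_PIII K K').

Definition pseudoknot_move (K K' : diagram) : Prop :=
  singular_move K K' \/ move_PI K K'.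

Definition singular_equivalent : diagram -> diagram -> Prop :=
  clos_refl_sym_trans _
    (fun K K' => planar_isotopic K K' \/ singular_move K K').

Definition pseudoknot_equivalent : diagram -> diagram -> Prop :=
  clos_refl_sym_trans _
    (fun K K' => planar_isotopic K K' \/ pseudoknot_move K K').

End Diagrams.

Arguments colorings {R X} B K _.

(* Main.v *)
Require Import Defs.
From Stdlib Require Import Relation_Operators.
From mathcomp Require Import all_boot all_order all_algebra finmap.
From mathcomp Require Import all_classical all_reals all_analysis.
From mathcomp Require Import ring lra.
(* So that [support] is the support of a diagram. *)
Import Defs.

Set Implicit Arguments.
Unset Strict Implicit.
Unset Printing Implicit Defensive.
Import Order.TTheory GRing.Theory Num.Theory numFieldNormedType.Exports.
Local Open Scope classical_set_scope.
Local Open Scope ring_scope.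

(** The regions of a diagram only matter through the functions that they carry:
    coloring the regions of K by X is the same as giving a function from the
    plane to [option X] that is undefined exactly on the diagram and locally
    constant elsewhere ([face_coloring], [paint]). Colorings of two different
    diagrams then live in one type, and a move or an isotopy gives a bijection
    between them once the one determines the other ([colorings_card],
    [functional_bijection_card]).

    There are finitely many colorings because a coloring is determined by its
    values at one point for each pattern of sides with respect to the lines
    through the edges: two points that lie on the same sides of all these lines
    are joined by a segment that misses the diagram ([same_sides]).

    A planar isotopy ends with a piecewise linear homeomorphism h that preserves
    the orientation, and composition with h carries colorings to colorings. What
    needs proof is that h respects the four sectors at a double point
    ([crossing_image]): close to the double point h is linear along rays, so it
    sends half-strands to half-strands, and the preserved orientation keeps them
    in the same cyclic order. Hence the sectors correspond, each with its role of
    left, top, right or bottom.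

    A move replaces one picture in the square by another. Each picture is
    encoded as a tangle: its arcs, its faces, and the four faces around each of
    its double points. A coloring restricts to a labeling of the faces, subject
    to one equation per double point ([tangle_ruleP]), and a labeling can be put
    back if it agrees with the coloring on the faces that leave the area
    where the two pictures differ ([recolor]). Thus a move preserves the number of
    colorings as soon as the labels of the outer faces determine, and allow, the
    labels of the inner ones ([local_move]). This leaves algebra:
    - the face inside a kink has exactly one possible color, by the unique
      solvability axioms ([kink_color]);
    - the two crossings of a bigon created by the second Reidemeister move impose the same
      condition on the two sides ([oriented_rule_mirror]);
    - the six axioms of self-distributive type say that a strand can pass over or
      under a double point in one particular orientation. Unique solvability
      turns this into the statements for all orientations and signs ([slides],
      [slides_reverse], [slides_flip]);
    - exchanging a classical crossing with a precrossing is the commutation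
      axiom of the two brackets when the strands are parallel. When they are
      antiparallel it follows from the parallel case together with passages of a
      strand over and under double points ([antiparallel_twist]). *)

(** * Passing a strand across a double point *)

Section Algebra.
Variables (X : Type) (B : psybracket X).
Local Notation cb := (cbr B).
Local Notation pb := (pbr B).

Lemma cbr_inj1 b c : injective (fun a => cb a b c).
Proof.
move=> x y exy; have [z [_ uz]] := cbr_solve1 B b c (cb x b c).
by rewrite -(uz x erefl) -(uz y (esym exy)).
Qed.

Lemma cbr_inj2 a c : injective (fun b => cb a b c).
Proof.
move=> x y exy; have [z [_ uz]] := cbr_solve2 B a c (cb a x c).
by rewrite -(uz x erefl) -(uz y (esym exy)).
Qed.

Lemma cbr_inj3 a b : injective (cb a b).
Proof.
move=> x y exy; have [z [_ uz]] := cbr_solve3 B a b (cb a b x).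
by rewrite -(uz x erefl) -(uz y (esym exy)).
Qed.

Definition rel4 := X -> X -> X -> X -> Prop.

(** A strand moves across a crossing of two others, whose left, top, right and
    bottom regions satisfy [W]. The new colors of these four regions are
    related to the old ones by [E x y x' y'] whenever [x] and [y] are
    separated by a half-strand with [x] to its right. *)
Definition slides (E W : rel4) := forall l t r b l' t' r' b',
  W l t r b -> E l t l' t' -> E t r t' r' -> E l b l' b' ->
  E b r b' r' /\ W l' t' r' b'.

(** In both edges the half-strand and the moving strand cross positively; in
    the first the moving strand is over, in the second it is under. *)
Definition over_edge : rel4 := fun x y x' y' => x' = cb x y y'.
Definition under_edge : rel4 := fun x y x' y' => y = cb x x' y'.
(** The other orientation of the moving strand, hence also the other sign of
    its crossings. *)
Definition reverse (E : rel4) : rel4 := fun x y x' y' => E x' y' x y.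
(** Exchanging top and bottom, as between the rules of a positive and a
    negative crossing. *)
Definition flip4 (W : rel4) : rel4 := fun l t r b => W l b r t.
Definition graph (w : X -> X -> X -> X) : rel4 := fun l t r b => b = w l t r.

(** Any three of the four colors around a classical crossing determine the
    fourth. The record is closed under [reverse], which exchanges the old and
    the new colors. *)
Record quasigroup (E : rel4) := Quasigroup {
  qsolve1 : forall y x' y', exists x, E x y x' y';
  qsolve2 : forall x x' y', exists y, E x y x' y';
  qsolve3 : forall x y y', exists x', E x y x' y';
  qsolve4 : forall x y x', exists y', E x y x' y';
  quniq1 : forall x1 x2 y x' y', E x1 y x' y' -> E x2 y x' y' -> x1 = x2;
  quniq2 : forall x y1 y2 x' y', E x y1 x' y' -> E x y2 x' y' -> y1 = y2;
  quniq3 : forall x y x1 x2 y', E x y x1 y' -> E x y x2 y' -> x1 = x2;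
  quniq4 : forall x y x' y1 y2, E x y x' y1 -> E x y x' y2 -> y1 = y2 }.

Lemma over_quasigroup : quasigroup over_edge.
Proof.
rewrite /over_edge; split=> [y x' y'|x x' y'|x y y'|x y x'|||x y x1 x2 y' -> ->|] //.
- by have [x [ex _]] := cbr_solve1 B y y' x'; exists x.
- by have [x0 [ex _]] := cbr_solve2 B x y' x'; exists x0.
- by exists (cb x y y').
- by have [x0 [ex _]] := cbr_solve3 B x y x'; exists x0.
- by move=> x1 x2 y x' y' -> /cbr_inj1.
- by move=> x y1 y2 x' y' -> /cbr_inj2.
- by move=> x y x' y1 y2 -> /cbr_inj3.
Qed.

Lemma under_quasigroup : quasigroup under_edge.
Proof.
rewrite /under_edge; split=> [y x' y'|x x' y'|x y y'|x y x'||x y1 y2 x' y' -> ->||] //.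
- by have [x [ex _]] := cbr_solve1 B x' y' y; exists x.
- by exists (cb x x' y').
- by have [x0 [ex _]] := cbr_solve2 B x y' y; exists x0.
- by have [x0 [ex _]] := cbr_solve3 B x x' y; exists x0.
- by move=> x1 x2 y x' y' -> /cbr_inj1.
- by move=> x y x1 x2 y' -> /cbr_inj2.
- by move=> x y x' y1 y2 -> /cbr_inj3.
Qed.

Lemma reverse_quasigroup E : quasigroup E -> quasigroup (reverse E).
Proof.
case=> *; split; rewrite /reverse; eauto.
Qed.

(** The first hypothesis is the equation at the crossing of the moving strand
    with the fourth half-strand, the second the one at the double point; [w]
    stands for either bracket. *)
Lemma over_slides w :
  (forall a b c d, cb (w a b c) c d = w (cb a b (cb b c d)) (cb b c d) d) ->
  (forall a b c d, cb a b (cb b c d) = cb a (w a b c) (cb (w a b c) c d)) ->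
  slides over_edge (graph w).
Proof.
rewrite /slides /over_edge /graph => w1 w2 l t r b l' t' r' b' -> elt etr elb.
have eb : b' = cb (w l t r) r r'.
  by apply: (@cbr_inj3 l (w l t r)); rewrite -elb -w2 -etr -elt.
by split=> //; rewrite eb w1 -etr -elt.
Qed.

Lemma under_slides w :
  (forall a b c d, cb (cb a b c) c d = cb (cb a b (w b c d)) (w b c d) d) ->
  (forall a b c d,
     cb a b (w b c d) = w a (cb a b c) (cb (cb a b c) c d)) ->
  slides under_edge (graph w).
Proof.
rewrite /slides /under_edge /graph => w1 w2 l t r b l' t' r' b' ew elt etr elb.
have eb : b' = w l' t' r'.
  by apply: (@cbr_inj3 l l'); rewrite -elb w2 -elt -etr.
by split=> //; rewrite /under_edge (_ : cb b b' r' = cb (cb l l' b') b' r') -?elb// elb eb -w1 -elt.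
Qed.

(** Complete the colors [l'], [t'] and [r'] by the bottom color that [w]
    prescribes, and pass forward. This ends at the colors [l], [t], [r] and
    [b], because [w] determines the bottom from the other three; uniqueness
    then identifies the two bottom colors before the passage. *)
Lemma slides_reverse E w :
  quasigroup E -> slides E (graph w) -> slides (reverse E) (graph w).
Proof.
move=> qE sE l t r b l' t' r' b'; rewrite /reverse => ew elt etr elb.
have [b0 eb0] := qsolve4 qE l' (w l' t' r') l.
have [e0 w0] := sE _ _ _ _ _ _ _ _ (erefl : graph w l' t' r' _) elt etr eb0.
have eb : b0 = b by rewrite ew.
rewrite {}eb in eb0 e0 *.
by have eb' := quniq2 qE eb0 elb; rewrite eb' in e0 *.
Qed.

(** The passages along the top and along the bottom of the double point must
    give the right region the same color, by uniqueness. *)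
Lemma slides_flip E W : quasigroup E -> slides E W -> slides E (flip4 W).
Proof.
rewrite /slides /flip4 => qE sE l t r b l' t' r' b' w elt etr elb.
have [r1 er1] := qsolve4 qE b r b'.
have [e0 w0] := sE _ _ _ _ _ _ _ _ w elb er1 elt.
by have e1 := quniq4 qE e0 etr; rewrite -e1.
Qed.

(** The four ways in which the moving strand can start, according to the
    region between it and the crossing. *)
Section SlidesFrom.
Variables (E W : rel4).
Hypotheses (qE : quasigroup E) (sE : slides E W).

Lemma slides_left l t r b l' t' b' : W l t r b -> E l t l' t' -> E l b l' b' ->
  exists r', [/\ E t r t' r', E b r b' r' & W l' t' r' b'].
Proof.
move=> w elt elb; have [r' er'] := qsolve4 qE t r t'.
by exists r'; have [] := sE w elt er' elb.
Qed.

Lemma slides_bottom l t r b l' b' r' : W l t r b -> E l b l' b' -> E b r b' r' ->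
  exists t', [/\ E l t l' t', E t r t' r' & W l' t' r' b'].
Proof.
move=> w elb ebr; have [t' et'] := qsolve4 qE l t l'.
have [r1 er1] := qsolve4 qE t r t'.
have [e0 w0] := sE w et' er1 elb.
by have e1 := quniq4 qE e0 ebr; rewrite e1 in w0 er1; exists t'.
Qed.

Lemma slides_right l t r b t' b' r' : W l t r b -> E t r t' r' -> E b r b' r' ->
  exists l', [/\ E l t l' t', E l b l' b' & W l' t' r' b'].
Proof.
move=> w etr ebr; have [l' el'] := qsolve3 qE l t t'.
have [b1 eb1] := qsolve4 qE l b l'.
have [e0 w0] := sE w el' etr eb1.
by have e1 := quniq3 qE e0 ebr; rewrite e1 in w0 eb1; exists l'.
Qed.

End SlidesFrom.

Lemma slides_top E W l t r b l' t' r' : quasigroup E -> slides E W ->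
  W l t r b -> E l t l' t' -> E t r t' r' ->
  exists b', [/\ E l b l' b', E b r b' r' & W l' t' r' b'].
Proof.
move=> qE /(slides_flip qE) sE; exact: (@slides_bottom E (flip4 W)).
Qed.

Lemma cbr_over_slides : slides over_edge (graph cb).
Proof. by apply: over_slides => *; [apply: cbr_ccc|apply: cbr_ccc']. Qed.

Lemma cbr_under_slides : slides under_edge (graph cb).
Proof. by apply: under_slides => *; [apply: cbr_ccc|apply: cbr_ccc']. Qed.

Lemma pbr_over_slides : slides over_edge (graph pb).
Proof. by apply: over_slides => *; [apply: cbr_cpc|apply: cbr_ccp']. Qed.

Lemma pbr_under_slides : slides under_edge (graph pb).
Proof. by apply: under_slides => *; [apply: cbr_ccp|apply: cbr_cpc']. Qed.

(** A positive crossing of the two strands, both going downward, can be moved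
    from above the double point to below it. *)
Definition twistable (W : rel4) := forall l t r b,
  W l t r b -> W l (cb l t r) r (cb l b r).

Lemma twistable_flip W : twistable W -> twistable (flip4 W).
Proof. by move=> tw l t r b; apply: tw. Qed.

Lemma pbr_twistable : twistable (graph pb).
Proof. by move=> l t r b ->; rewrite /graph pbr_cbrC. Qed.

(** A crossing of antiparallel strands is not covered by [twistable]. Pass one
    strand over the classical crossing [er], then one under the double point
    twisted by [tw], and finally one over the double point, in the reversed
    direction. The double point at the end of these passages has the four
    colors of the conclusion. *)
Lemma antiparallel_twist W l t r b l' r' : twistable W ->
  slides under_edge W -> slides (reverse over_edge) W ->
  W l t r b -> t = cb l' b r -> b = cb l t r' -> W l' b r' t.
Proof.
move=> tw sU sO w el er.
have qO := over_quasigroup; have qU := under_quasigroup.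
set z := cb l b r.
have [q eq] := qsolve4 qO l t z.
have [s [e1 e2 w1]] := slides_left qO cbr_over_slides
  (er : graph cb l t r' b) eq (erefl z : over_edge l b z r).
have [r0 [f1 f2 w2]] := slides_bottom qU sU (tw _ _ _ _ w)
  (eq : under_edge l z t q) (w1 : under_edge z r q s).
have er0 : r0 = r by apply: (@cbr_inj3 l t); exact/esym/f1.
rewrite {}er0 in f1 f2 w2.
have [l0 [g1 g2 w3]] := slides_right (reverse_quasigroup qO) sO w2
  (e2 : reverse over_edge r s b r') (e1 : reverse over_edge q s t r').
have el0 : l0 = l' by apply: (@cbr_inj1 b r); rewrite -el; exact/esym/g1.
by rewrite -el0.
Qed.

End Algebra.

(** * Locally constant functions and segments *)

Section LocallyConstant.
(** The set where [phi] takes a given value and its complement are both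
    relatively open in [C]. *)
Lemma locally_constant_connected (T : topologicalType) (Y : Type) (C : set T)
    (phi : T -> Y) :
  connected C -> (forall x, C x -> \forall y \near x, phi y = phi x) ->
  forall x y, C x -> C y -> phi x = phi y.
Proof.
move=> cC lc x y Cx Cy.
have openl (P : set Y) : C `&` [set z | P (phi z)] =
    C `&` [set z | \forall u \near z, P (phi u)].
  apply/seteqP; split=> z [Cz Pz]; split=> //=; last exact: nbhs_singleton Pz.
  by near=> u; rewrite (_ : phi u = phi z) //; near: u; exact: lc.
have := cC (C `&` [set z | phi z = phi x]).
move=> /(_ (ex_intro _ x (conj Cx erefl))) H.
suff : (C `&` [set z | phi z = phi x]) y by case.
rewrite H //.
- exists [set z | \forall u \near z, phi u = phi x].
    by rewrite openE => z /near_join.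
  exact: (openl (fun v => v = phi x)).
- exists (~` [set z | \forall u \near z, phi u <> phi x]).
    apply: open_closedC.
    by rewrite openE => z /near_join.
  have e := openl (fun v => v <> phi x).
  apply/seteqP; split=> z [Cz Pz]; split=> //=.
    by move/nbhs_singleton.
  apply: contrapT => Pz'; apply: Pz.
  by have : (C `&` [set z | phi z <> phi x]) z by []; rewrite e => -[].
Unshelve. all: by end_near. Qed.

End LocallyConstant.

Section Segments.
Variable R : realType.
Local Notation point := (R * R)%type.
Local Notation edge := (point * point)%type.
Implicit Types (e f g : edge) (x y z : point).

Lemma fstD x y : (x + y).1 = x.1 + y.1. Proof. by []. Qed.
Lemma sndD x y : (x + y).2 = x.2 + y.2. Proof. by []. Qed.
Lemma fstN x : (- x).1 = - x.1. Proof. by []. Qed.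
Lemma sndN x : (- x).2 = - x.2. Proof. by []. Qed.
Lemma fstZ (t : R) x : (t *: x).1 = t * x.1. Proof. by []. Qed.
Lemma sndZ (t : R) x : (t *: x).2 = t * x.2. Proof. by []. Qed.
Definition coordE := (fstD, sndD, fstN, sndN, fstZ, sndZ).

Lemma point_eq x y : x.1 = y.1 -> x.2 = y.2 -> x = y.
Proof. by case: x y => [? ?] [? ?] /= -> ->. Qed.

Lemma segmentE e : segment e = (fun t : R => e.1 + t *: dir e) @` `[0, 1].
Proof.
apply/seteqP; split=> x /= [t].
  by move=> t01 ->; exists t; rewrite //= in_itv.
by rewrite in_itv /= => t01 <-; exists t.
Qed.

Lemma line_continuous x y : continuous (fun t : R => x + t *: y).
Proof.
move=> t; apply: cvgD; first exact: cvg_cst.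
by apply: cvgZr_tmp; exact: cvg_id.
Qed.

Lemma segment_connected e : connected (segment e).
Proof.
rewrite segmentE; apply: connected_continuous_connected.
  exact: segment_connected.
exact/continuous_subspaceT/line_continuous.
Qed.

Lemma segment_closed e : closed (segment e).
Proof.
apply: compact_closed; first exact: norm_hausdorff.
rewrite segmentE; apply: continuous_compact; last exact: segment_compact.
exact/continuous_subspaceT/line_continuous.
Qed.

Lemma segment_sym x y z : segment (x, y) z -> segment (y, x) z.
Proof.
move=> [t /andP[t0 t1] ->]; exists (1 - t); first by apply/andP; split; lra.
by apply: point_eq; rewrite /dir !coordE /=; ring.
Qed.

Lemma segment_src e : segment e e.1.
Proof. by exists 0; rewrite ?lexx ?ler01// scale0r addr0. Qed.

Lemma segment_tgt e : segment e e.2.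
Proof. by exists 1; rewrite ?lexx ?ler01// scale1r /dir addrC subrK. Qed.

Lemma open_segmentW e : open_segment e `<=` segment e.
Proof. by move=> x [t /andP[t0 t1] ->]; exists t; rewrite // !ltW. Qed.

Lemma segment_sub e x y : segment e x -> segment e y ->
  segment (x, y) `<=` segment e.
Proof.
move=> [a /andP[a0 a1] ->] [b /andP[b0 b1] ->] z [t /andP[t0 t1] ->].
exists (a + t * (b - a)); first by apply/andP; split; nra.
by apply: point_eq; rewrite /dir !coordE /=; ring.
Qed.

Lemma ball_segment x y z (r : R) : ball x r y -> ball x r z ->
  segment (y, z) `<=` ball x r.
Proof.
rewrite -!ball_normE /ball_ /= => yr zr u [t /andP[t0 t1] ->].
have e : x - (y + t *: dir (y, z)) = (1 - t) *: (x - y) + t *: (x - z).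
  by apply: point_eq; rewrite /dir !coordE /=; ring.
rewrite /= e; apply: le_lt_trans (ler_normD _ _) _; rewrite !normrZ.
rewrite (ger0_norm t0) (@ger0_norm _ (1 - t)); last by lra.
have [->|tp] := eqVneq t 0; first by rewrite subr0 mul1r mul0r addr0.
have tb : t * `|x - z| < t * r by rewrite ltr_pM2l// lt_neqAle eq_sym tp.
have ta : (1 - t) * `|x - y| <= (1 - t) * r.
  by apply: ler_wpM2l; [lra|exact: ltW].
by lra.
Qed.

Lemma near_ray x w (U : set point) : nbhs x U -> \forall t \near 0^'+, U (x + t *: w).
Proof.
move=> xU; have c : (fun t : R => x + t *: w) @ 0 --> x.
  by have := @line_continuous x w 0; rewrite /continuous_at scale0r addr0.
exact: (cvg_at_right_filter c).
Qed.

(** There are finitely many edges and each of them is closed. *)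
Lemma near_edges (S : seq edge) x :
  \forall y \near x, forall g, g \in S -> segment g y -> segment g x.
Proof.
elim: S => [|g S IH]; first by apply: filterE => y g; rewrite in_nil.
have [gx|ngx] := pselect (segment g x).
  by apply: filterS IH => y IH h; rewrite inE => /predU1P[-> //|]; exact: IH.
have : nbhs x (~` segment g).
  by apply: open_nbhs_nbhs; split=> //; exact/closed_openC/segment_closed.
apply: filterS2 IH => y IH gy h; rewrite inE => /predU1P[->|]; last exact: IH.
by move=> /gy.
Qed.

End Segments.

(** * Colorings as functions on the plane *)

Section FaceColorings.
Variable R : realType.
Local Notation point := (R * R)%type.
Local Notation edge := (point * point)%type.
Implicit Types (e f g : edge) (x y z w : point) (K : diagram R).

(** Colorings of the regions, seen as partial functions on the plane. *)
Definition face_coloring (Y : Type) K (phi : point -> option Y) : Prop :=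
  (forall x, phi x = None <-> support K x) /\
  (forall x, ~ support K x -> \forall y \near x, phi y = phi x).

(** The color that one sees from [x] in the direction [w]. *)
Definition germ (Y : Type) (phi : point -> option Y) x w (a : Y) : Prop :=
  \forall t \near 0^'+, phi (x + t *: w) = Some a.

Lemma near_support K x :
  ~ support K x -> \forall y \near x, ~ support K y.
Proof.
move=> nx; apply: filterS (near_edges (edges K) x) => y ny [e eK ey].
by apply: nx; exists e => //; exact: ny.
Qed.

(** A third edge through [x] would make a triple point or have a vertex on the
    interior of an edge, and no other edge comes near. *)
Lemma near_crossing K e f x : crossing K e f x ->
  \forall y \near x, forall g, g \in edges K -> segment g y -> g = e \/ g = f.
Proof.
move=> [eK fK ex fx dpos]; apply: filterS (near_edges (edges K) x) => y ny g gK gy.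
have gx := ny g gK gy.
have [_ _ nz trans triple] := edges_generic K.
have ef : e != f.
  by apply/eqP => ef; move: dpos; rewrite ef /det mulrC subrr ltxx.
have [->|ge] := eqVneq g e; [by left|right].
have [[gv ev]|[gox _ _]] := trans _ _ _ gK eK ge gx (open_segmentW ex).
  have [t /andP[t0 t1] xe] := ex.
  have : dir e != 0.
    by rewrite /dir subr_eq0 eq_sym; exact: nz.
  move: ev => [] ev; rewrite ev in xe.
    move: xe => /eqP; rewrite -[X in X == _]addr0 eq_sym (inj_eq (addrI _)).
    by rewrite scaler_eq0 (gt_eqF t0) /= => /eqP->; rewrite eqxx.
  have : (1 - t) *: dir e = 0.
    rewrite scalerBl scale1r {1}/dir {1}xe; apply: point_eq; rewrite !coordE /=; ring.
  by move=> /eqP; rewrite scaler_eq0 subr_eq0 (gt_eqF t1) /= => /eqP->; rewrite eqxx.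
by have /or3P[/eqP|/eqP|/eqP] := triple g e f x gK eK fK gox ex fx => [/eqP|/eqP|//];
  rewrite ?(negbTE ge) ?(negbTE ef).
Qed.

Section Colored.
Variables (Y : Type) (K : diagram R) (phi : point -> option Y).
Hypothesis face : face_coloring K phi.

Lemma face_coloring_connected (C : set point) x y : connected C ->
  (forall z, C z -> ~ support K z) -> C x -> C y -> phi x = phi y.
Proof.
move=> cC nC; apply: locally_constant_connected => // z /nC; exact: face.2.
Qed.

Lemma face_coloring_Some x : ~ support K x -> exists a, phi x = Some a.
Proof.
move=> nx; case e: (phi x) => [a|]; first by exists a.
by exfalso; apply: nx; apply/face.1.
Qed.

Lemma det_segment u x y z (t : R) : det u (y + t *: dir (y, z) - x) =
  (1 - t) * det u (y - x) + t * det u (z - x).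
Proof. by rewrite /det /dir !coordE /=; ring. Qed.

Lemma det_on_segment e x y : segment e x -> segment e y -> det (dir e) (y - x) = 0.
Proof. by move=> [a _ ->] [b _ ->]; rewrite /det !coordE; ring. Qed.

(** Two points near [x] on the same side of both strands are joined by a
    segment that stays on these sides, so it meets neither strand. *)
Lemma quadrants e f x : crossing K e f x -> exists2 U : set point, nbhs x U &
  forall y z, U y -> U z ->
    0 < det (dir e) (y - x) * det (dir e) (z - x) ->
    0 < det (dir f) (y - x) * det (dir f) (z - x) ->
  phi y = phi z /\ ~ support K y.
Proof.
move=> cr; have [eK fK ex fx dpos] := cr.
have [r /= r0 rU] := (iffLR (nbhs_ballP _ _)) (near_crossing cr).
exists (ball x r); first exact: nbhsx_ballx.
move=> y z Uy Uz sy sz.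
have pos u (t : R) : 0 <= t <= 1 -> 0 < det u (y - x) * det u (z - x) ->
    det u (y + t *: dir (y, z) - x) <> 0.
  rewrite det_segment => /andP[t0 t1] p; set a := det _ _ in p *; set b := det _ _ in p *.
  move=> q.
  have : 0 < ((1 - t) * a + t * b) * a + ((1 - t) * a + t * b) * b;
    last by rewrite q !mul0r addr0 ltxx.
  have a2 : 0 < a ^+ 2 by rewrite exprn_even_gt0 //=; apply/eqP => a0; rewrite a0 mul0r ltxx in p.
  have b2 : 0 < b ^+ 2 by rewrite exprn_even_gt0 //=; apply/eqP => b0; rewrite b0 mulr0 ltxx in p.
  have : 0 <= (1 - t) * a ^+ 2 by apply: mulr_ge0; [lra|exact: ltW].
  have : 0 <= t * b ^+ 2 by apply: mulr_ge0; [lra|exact: ltW].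
  nra.
have H u : segment (y, z) u -> ~ support K u.
  move=> yzu [g gK gu].
  have := rU u (ball_segment Uy Uz yzu) g gK gu.
  move: yzu => [t t01 ut] [eg|eg]; subst g.
    by apply: (pos (dir e) t) => //; rewrite -ut; apply: det_on_segment gu; exact: open_segmentW.
  by apply: (pos (dir f) t) => //; rewrite -ut; apply: det_on_segment gu; exact: open_segmentW.
split; last exact/H/(segment_src (y, z)).
apply: (face_coloring_connected (@segment_connected _ (y, z))) => //.
  exact: (segment_src (y, z)).
exact: (segment_tgt (y, z)).
Qed.

Lemma germ_unique x w a b : germ phi x w a -> germ phi x w b -> a = b.
Proof.
move=> ga gb.
by have [t [-> []]] := @filter_ex _ _ _ _ (filterI ga gb).
Qed.

Lemma det_ray u x w (t : R) : det u (x + t *: w - x) = t * det u w.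
Proof. by rewrite /det !coordE; ring. Qed.

Lemma germ_exists e f x w : crossing K e f x ->
  det (dir e) w != 0 -> det (dir f) w != 0 -> exists a, germ phi x w a.
Proof.
move=> cr we wf; have [U xU HU] := quadrants cr.
have ray := near_ray w xU.
have pos0 : \forall t \near (0 : R)^'+, 0 < t by exact: nbhs_right_gt.
have [t0 [Ut0 t0p]] := @filter_ex _ _ _ _ (filterI ray pos0).
have sq u (t : R) : 0 < t -> det u w != 0 ->
    0 < det u (x + t *: w - x) * det u (x + t0 *: w - x).
  move=> tp uw; rewrite !det_ray mulrACA; apply: mulr_gt0; first exact: mulr_gt0.
  by rewrite -expr2 exprn_even_gt0.
have [a ea] : exists a, phi (x + t0 *: w) = Some a.
  by apply: face_coloring_Some; have [] := HU _ _ Ut0 Ut0 (sq _ _ t0p we) (sq _ _ t0p wf).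
exists a; apply: filterS2 ray pos0 => t Ut tp; rewrite -ea.
by have [] := HU _ _ Ut Ut0 (sq _ _ tp we) (sq _ _ tp wf).
Qed.
End Colored.

Definition region_at K x (nx : ~ support K x) : region K :=
  exist _ _ (ex_intro2 _ _ x nx erefl).

Lemma region_atE K (r : region K) x (nx : ~ support K x) :
  sval r x -> r = region_at nx.
Proof.
case: r => r /= [z nz er] rx; apply: eq_exist; rewrite er.
by apply: same_connected_component; rewrite -er.
Qed.

Lemma region_not_support K (r : region K) x : sval r x -> ~ support K x.
Proof.
by case: r => r /= [z nz ->] /connected_component_sub.
Qed.

Lemma region_inhabited K (r : region K) : exists x, sval r x.
Proof.
by case: r => r /= [z nz ->]; exists z; exact: connected_component_refl.
Qed.

Definition paint (Y : Type) K (col : region K -> Y) x : option Y :=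
  match pselect (support K x) with
  | left _ => None
  | right nx => Some (col (region_at nx))
  end.

Lemma paint_region (Y : Type) K (col : region K -> Y) (r : region K) x :
  sval r x -> paint col x = Some (col r).
Proof.
move=> rx; rewrite /paint; case: pselect => [/(region_not_support rx)//|nx].
by rewrite (region_atE nx rx).
Qed.

Lemma paint_face (Y : Type) K (col : region K -> Y) : face_coloring K (paint col).
Proof.
split=> x; first by rewrite /paint; case: pselect.
move=> nx; have [d /= d0 dU] := (iffLR (nbhs_ballP _ _)) (near_support nx).
apply/nbhs_ballP; exists d => //= y xy.
have rx : sval (region_at nx) x by exact: connected_component_refl.
rewrite (paint_region col rx); apply: paint_region.
rewrite /=; apply: (@connected_component_max _ _ (segment (x, y))).
- exact: (segment_src (x, y)).
- by move=> z; move=> /(ball_segment (ballxx _ d0) xy)/dU.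
- exact: segment_connected.
- exact: (segment_tgt (x, y)).
Qed.

Lemma paint_sector (Y : Type) K (col : region K -> Y) x w (r : region K) :
  sector x w r -> germ (paint col) x w (col r).
Proof. by apply: filterS => t; exact: paint_region. Qed.

(** Coloring every region by itself turns germs of colors into sectors, which
    makes [germ_exists] produce the regions at a crossing. *)
Lemma paint_id_germ K x w (r : region K) : germ (paint id) x w r -> sector x w r.
Proof.
apply: filterS => t; rewrite /paint; case: pselect => // nx [<-].
exact: connected_component_refl.
Qed.

Lemma det_strands e f : 0 < det (dir e) (dir f) ->
  [/\ det (dir e) (dir e - dir f) != 0, det (dir f) (dir e - dir f) != 0,
      det (dir e) (dir e + dir f) != 0 & det (dir f) (dir e + dir f) != 0].
Proof.
move=> d; rewrite /det !coordE in d *.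
by split; apply/eqP; nra.
Qed.

Lemma detN u v : det u (- v) = - det u v :> R.
Proof. by rewrite /det !coordE; ring. Qed.

Definition crossing_germs (X : Type) (B : psybracket X) k
    (phi : point -> option X) x (u v : point) : Prop :=
  exists l t r b : X,
    [/\ germ phi x (u - v) l, germ phi x (- (u + v)) t,
        germ phi x (v - u) r, germ phi x (u + v) b & crossing_rule B k l t r b].

Definition plane_coloring (X : Type) (B : psybracket X) K
    (phi : point -> option X) : Prop :=
  face_coloring K phi /\
  forall e f x, crossing K e f x ->
    crossing_germs B (kind K x) phi x (dir e) (dir f).

Lemma coloring_paint (X : Type) (B : psybracket X) K (col : region K -> X) :
  coloring B col <-> plane_coloring B K (paint col).
Proof.
split=> [cc|[_ pc] e f x cr].
  split=> [|e f x cr]; first exact: paint_face.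
  have [l [t [r [b [sl st sr sb cR]]]]] := cc e f x cr.
  by exists (col l), (col t), (col r), (col b); split=> //; exact: paint_sector.
have [l [t [r [b [gl gt gr gb cR]]]]] := pc e f x cr.
have [d1 d2 d3 d4] : [/\ _, _, _ & _] := det_strands (let: And5 _ _ _ _ d := cr in d).
have gex := germ_exists (@paint_face _ K id) cr.
have [l' /paint_id_germ sl] := gex _ d1 d2.
have [b' /paint_id_germ sb] := gex _ d3 d4.
have [||t' /paint_id_germ st] := gex (- (dir e + dir f)); rewrite ?detN ?oppr_eq0//.
have [||r' /paint_id_germ sr] := gex (dir f - dir e);
  rewrite -?(opprB (dir e)) ?detN ?oppr_eq0//.
have gl' := paint_sector col sl; have gr' := paint_sector col sr.
have gt' := paint_sector col st; have gb' := paint_sector col sb.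
exists l', t', r', b'; split=> //; first by rewrite opprB.
by rewrite (germ_unique gl' gl) (germ_unique gr' gr) (germ_unique gt' gt)
  (germ_unique gb' gb).
Qed.

Lemma paint_inj (X : Type) K : injective (@paint X K).
Proof.
move=> c1 c2 e; apply/funext => r; have [x rx] := region_inhabited r.
by have := congr1 (fun h => h x) e; rewrite !(paint_region _ rx) => -[].
Qed.

Lemma paint_surj (X : Type) K (phi : point -> option X) :
  face_coloring K phi -> exists col, phi = @paint X K col.
Proof.
move=> fc.
have H (r : region K) : exists a, forall x, sval r x -> phi x = Some a.
  have [x rx] := region_inhabited r.
  have [a ea] := face_coloring_Some fc (region_not_support rx).
  exists a => y ry; rewrite -ea.
  apply: (face_coloring_connected fc (C := sval r)) => //.
    by case: (r) => r0 /= [z nz ->]; exact: component_connected.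
  by move=> z; exact: region_not_support.
exists (fun r => projT1 (cid (H r))); apply/funext => x.
rewrite /paint; case: pselect => [/fc.1//|nx]; case: cid => a /= ->//.
exact: connected_component_refl.
Qed.

Lemma colorings_card (X : Type) (B : psybracket X) K :
  (colorings B K #= [set phi | plane_coloring B K phi])%card.
Proof.
have -> : [set phi | plane_coloring B K phi] = @paint X K @` colorings B K.
  apply/seteqP; split=> phi /=.
    move=> pc; have [col e] := paint_surj pc.1.
    by exists col => //; apply/coloring_paint; rewrite -e.
  by move=> [col cc <-]; exact/coloring_paint.
rewrite card_eq_sym; apply: inj_card_eq => c1 c2 _ _; exact: paint_inj.
Qed.

End FaceColorings.

(** * Finiteness of the set of colorings *)

(** Bijections are only ever described by a relation: this coloring and that
    one agree where the diagrams do. *)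
Lemma functional_bijection_card (T U : Type) (A : set T) (C : set U) (r : T -> U -> Prop) :
  (forall x, A x -> exists2 y, C y & r x y) ->
  (forall y, C y -> exists2 x, A x & r x y) ->
  (forall x y1 y2, A x -> C y1 -> C y2 -> r x y1 -> r x y2 -> y1 = y2) ->
  (forall x1 x2 y, A x1 -> A x2 -> C y -> r x1 y -> r x2 y -> x1 = x2) ->
  (A #= C)%card.
Proof.
move=> tot sur fun_ inj.
have [[x0 Ax0]|nA] := pselect (exists x, A x); last first.
  have -> : A = set0 by apply/seteqP; split=> // x Ax; apply: nA; exists x.
  have -> : C = set0.
    by apply/seteqP; split=> // y /sur[x Ax _]; apply: nA; exists x.
  exact: card_eq00.
have [y0 _ _] := tot _ Ax0.
have [f fP] : exists f : T -> U, forall x, A x -> C (f x) /\ r x (f x).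
  have H x : exists y, A x -> C y /\ r x y.
    have [/tot[y Cy rxy]|nAx] := pselect (A x); first by exists y.
    by exists y0.
  by have [f fP] := choice H; exists f.
have <- : f @` A = C.
  apply/seteqP; split=> y; first by move=> [x Ax <-]; have [] := fP _ Ax.
  move=> Cy; have [x Ax rxy] := sur _ Cy; exists x => //.
  by have [Cf rf] := fP _ Ax; exact: (fun_ x).
rewrite card_eq_sym; apply: inj_card_eq => x1 x2; rewrite !inE => A1 A2 e.
have [C1 r1] := fP _ A1; have [C2 r2] := fP _ A2.
by apply: (inj _ _ (f x1)) => //; rewrite e.
Qed.

Section Finiteness.
Variable R : realType.
Local Notation point := (R * R)%type.
Local Notation edge := (point * point)%type.
Implicit Types (e f g : edge) (x y z w : point) (K : diagram R).

Lemma det_continuous u z : continuous (fun y : point => det u (y - z)).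
Proof.
move=> y; rewrite /det.
have c1 : (fun y : point => (y - z).1) @ y --> (y - z).1.
  by apply: cvgB; [exact: cvg_fst|exact: cvg_cst].
have c2 : (fun y : point => (y - z).2) @ y --> (y - z).2.
  by apply: cvgB; [exact: cvg_snd|exact: cvg_cst].
by apply: cvgB; apply: cvgM => //; exact: cvg_cst.
Qed.

Lemma near_det_neq0 u z y : det u (y - z) != 0 ->
  \forall y' \near y, det u (y' - z) != 0.
Proof.
move=> n; have := @det_continuous u z y.
move=> /cvgr_neq0; exact.
Qed.

(** Leave the lines one at a time along their normals, by steps small enough to
    stay off the lines already left. *)
Lemma generic_point (S : seq edge) x (U : set point) :
  (forall g, g \in S -> dir g != 0) -> nbhs x U ->
  exists y, U y /\ forall g, g \in S -> det (dir g) (y - g.1) != 0.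
Proof.
elim: S U => [|g S IH] U nz xU; first by exists x; split=> //; exact: nbhs_singleton.
have [||y [Uy Sy]] := IH (interior U).
- by move=> h hS; apply: nz; rewrite inE hS orbT.
- exact: nbhs_interior.
have nS : \forall y' \near y, forall h, h \in S -> det (dir h) (y' - h.1) != 0.
  elim: (S) Sy => [_|h S' IH' Sy]; first by apply: filterE.
  have := near_det_neq0 (Sy h (mem_head _ _)).
  have /IH' : forall h', h' \in S' -> det (dir h') (y - h'.1) != 0.
    by move=> h' h'S; apply: Sy; rewrite inE h'S orbT.
  by apply: filterS2 => y' H1 H2 h'; rewrite inE => /predU1P[->//|]; exact: H1.
(* If [y] lies on the line of [g], a small step along the normal [n] leaves it. *)
have [gy|] := eqVneq (det (dir g) (y - g.1)) 0; last first.
  move=> gy; exists y; split; first exact: nbhs_singleton Uy.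
  by move=> h; rewrite inE => /predU1P[->//|]; exact: Sy.
pose n : point := (- (dir g).2, (dir g).1).
have r1 := near_ray n Uy; have r2 := near_ray n nS.
have pos0 : \forall t \near (0 : R)^'+, 0 < t by exact: nbhs_right_gt.
have [t [[Ut St] tp]] := @filter_ex _ _ _ _ (filterI (filterI r1 r2) pos0).
exists (y + t *: n); split=> // h; rewrite inE => /predU1P[->|]; last exact: St.
have -> : det (dir g) (y + t *: n - g.1) =
    det (dir g) (y - g.1) + t * ((dir g).1 ^+ 2 + (dir g).2 ^+ 2).
  by rewrite /det /n !coordE /=; ring.
have : dir g != 0 by apply: nz; rewrite mem_head.
move=> dg; rewrite gy add0r; apply: mulf_neq0; first by rewrite gt_eqF.
rewrite paddr_eq0 ?sqr_ge0//.
rewrite !sqrf_eq0; apply: contra dg => /andP[/eqP a /eqP b].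
by apply/eqP; exact: point_eq.
Qed.

Lemma edge_dir_neq0 K g : g \in edges K -> dir g != 0.
Proof.
by have [_ _ nz _ _] := edges_generic K; move=> /nz; rewrite /dir subr_eq0 eq_sym.
Qed.

Definition sides K x : (size (edges K)).-tuple bool :=
  map_tuple (fun g => 0 < det (dir g) (x - g.1)) (in_tuple (edges K)).

Definition off_lines K x := forall g, g \in edges K -> det (dir g) (x - g.1) != 0.

(** The segment from [x] to [y] crosses none of the lines, so it misses the
    diagram. *)
Lemma same_sides (Y : Type) K (phi : point -> option Y) x y :
  face_coloring K phi -> off_lines K x -> off_lines K y ->
  sides K x = sides K y -> phi x = phi y.
Proof.
move=> fc ox oy /(congr1 val) /= /eq_in_map es.
apply: (face_coloring_connected fc (@segment_connected _ (x, y))).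
- move=> z [t /andP[t0 t1] ->] [g gK gz].
  have := es g gK; have := ox g gK; have := oy g gK.
  have := det_on_segment (segment_src g) gz; rewrite det_segment.
  move: (det _ (x - _)) (det _ (y - _)) => a b e; rewrite !neq_lt.
  move=> /orP[] b0 /orP[] a0; rewrite ?a0 ?b0 ?(lt_gtF a0) ?(lt_gtF b0)//; nra.
- exact: (segment_src (x, y)).
- exact: (segment_tgt (x, y)).
Qed.

(** A coloring is recovered from its values at one point for each realized
    pattern of sides: near every point off the diagram there are points off the
    lines. *)
Lemma finite_face_colorings (X : finType) K :
  finite_set [set phi : point -> option X | face_coloring K phi].
Proof.
pose n := size (edges K).
pose P (s : n.-tuple bool) x := off_lines K x /\ sides K x = s.
pose F (phi : point -> option X) : {ffun n.-tuple bool -> option X} :=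
  [ffun s => phi (xget (0, 0) (P s))].
set A := [set _ | _].
have injF : {in A &, injective F}.
  move=> p1 p2; rewrite !inE => f1 f2 eF; apply/funext => x.
  have [sx|nx] := pselect (support K x).
    by rewrite (iffRL (f1.1 x) sx) (iffRL (f2.1 x) sx).
  have [y [[/= y1 y2] oy]] := generic_point (@edge_dir_neq0 K)
    (filterI (f1.2 x nx) (f2.2 x nx)).
  have Py : P (sides K y) y by split.
  have [oz sz] := @xgetI _ (0, 0) _ _ Py.
  have := congr1 (fun f : {ffun _ -> _} => f (sides K y)) eF; rewrite !ffunE.
  by rewrite (same_sides f1 oz oy sz) (same_sides f2 oz oy sz) y1 y2.
have := inj_card_eq injF; move=> /eq_finite_set <-; exact: finite_finset.
Qed.

Lemma finite_colorings (X : finType) (B : psybracket X) K :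
  finite_set (colorings B K).
Proof.
rewrite (eq_finite_set (colorings_card B K)).
by apply: sub_finite_set (finite_face_colorings X K) => phi [].
Qed.

Lemma counting_invariant_card (X : finType) (B : psybracket X) K K' :
  ([set phi | plane_coloring B K phi] #= [set phi | plane_coloring B K' phi])%card ->
  counting_invariant B K = counting_invariant B K'.
Proof.
move=> h; rewrite /counting_invariant.
have [n cn] := iffLR (finite_setP _) (finite_colorings B K).
rewrite (card_fset_set cn); apply/esym/card_fset_set.
apply: card_eq_trans cn; apply: card_eq_trans (colorings_card B K') _.
by rewrite card_eq_sym; apply: card_eq_trans h; exact: colorings_card.
Qed.

End Finiteness.

(** * Tangles *)

Section Tangles.
Variable R : realType.
Local Notation point := (R * R)%type.
Local Notation edge := (point * point)%type.
Implicit Types (e f g : edge) (x y z w : point) (K : diagram R).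

Definition orient_edge (b : bool) e : edge := if b then e else (e.2, e.1).

Lemma dir_orient b e : dir (orient_edge b e) = if b then dir e else - dir e.
Proof. by case: b => //; rewrite /dir /= opprB. Qed.

Lemma segment_orient b e x : segment (orient_edge b e) x <-> segment e x.
Proof. by case: b => //; case: e => p q; split; exact: segment_sym. Qed.

Lemma open_segment_orient b e x : open_segment (orient_edge b e) x <-> open_segment e x.
Proof.
have H f : open_segment f x -> open_segment (f.2, f.1) x.
  move=> [t /andP[t0 t1] ->]; exists (1 - t); first by apply/andP; split; lra.
  by apply: point_eq; rewrite /dir !coordE /=; ring.
by case: b => //; case: e => p q; split=> /H.
Qed.

(** When the two arcs have directions u and v with 0 < det u v, the faces
    [east], [north], [west] and [south] are those seen in the directions u + v,
    v - u, - (u + v) and u - v, as if u pointed south-east and v north-east. *)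
Record node := Node {
  node_point : point;
  node_fst : nat * edge;
  node_snd : nat * edge;
  east : nat; north : nat; west : nat; south : nat }.

(** Every arc carries the number of its strand. The arcs have a reference
    direction; the orientation of the strands is given separately by a function
    on strand numbers, so that one tangle serves for all orientations. *)
Record tangle := Tangle {
  arcs : seq (nat * edge);
  faces : seq (set point);
  nodes : seq node }.

Definition face T i : set point := nth set0 (faces T) i.

Definition drawing T : set point := [set x | exists2 a, a \in arcs T & segment a.2 x].

Definition open_square : set point :=
  [set x | [/\ -2 < x.1, x.1 < 2, -2 < x.2 & x.2 < 2]].

(** The listed faces are the components of the complement of the arcs in the
    open square, and the listed nodes are the double points with the faces
    around them. *)
Record tangle_ok T : Prop := TangleOk {
  ok_arcs : forall a, a \in arcs T -> square a.2.1 /\ square a.2.2;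
  ok_open : forall i, open (face T i);
  ok_connected : forall i, connected (face T i);
  ok_inhabited : forall i, (i < size (faces T))%N -> exists x, face T i x;
  ok_pos : (0 < size (faces T))%N;
  ok_inside : forall i, face T i `<=` open_square;
  ok_off : forall i x, face T i x -> ~ drawing T x;
  ok_disjoint : forall i j x, face T i x -> face T j x -> i = j;
  ok_cover : forall x, open_square x -> drawing T x \/ exists i, face T i x;
  ok_nodes : forall a b x, a \in arcs T -> b \in arcs T ->
    open_segment a.2 x -> open_segment b.2 x -> 0 < det (dir a.2) (dir b.2) ->
    exists p q r s, List.In (Node x a b p q r s) (nodes T);
  ok_node : forall x a b p q r s, List.In (Node x a b p q r s) (nodes T) ->
    let u := dir a.2 in let v := dir b.2 in
    [/\ a \in arcs T, b \in arcs T, 0 < det u v &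
      [/\ open_segment a.2 x, open_segment b.2 x & square x]] /\
    [/\ \forall t \near 0^'+, face T p (x + t *: (u + v)),
        \forall t \near 0^'+, face T q (x + t *: (v - u)),
        \forall t \near 0^'+, face T r (x + t *: - (u + v)) &
        \forall t \near 0^'+, face T s (x + t *: (u - v))] }.

Definition orient (o : nat -> bool) T : seq edge :=
  [seq orient_edge (o a.1) a.2 | a <- arcs T].

(** [K] consists of [T], oriented by [o], inside the square. Edges outside may
    end on the boundary of the square at an end of an arc. *)
Record contains K o T : Prop := Contains {
  contains_drawing : forall x, square x -> (support K x <-> drawing T x);
  contains_edges : {subset orient o T <= edges K};
  contains_crossings : forall e f x, crossing K e f x -> square x ->
    e \in orient o T /\ f \in orient o T }.

Section NodeRule.
Variables (X : Type) (B : psybracket X).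

(** The crossing rule, read after turning the picture so that both strands go
    downward; [s] and [t] tell whether the first and the second strand run
    along their reference directions. Reversing both turns the four faces by
    half a turn, reversing one by a quarter turn. *)
Definition oriented_rule (s t : bool) k (p q r m : X) : Prop :=
  match s, t with
  | true, true => crossing_rule B k m r q p
  | false, true => crossing_rule B k p m r q
  | true, false => crossing_rule B k r q p m
  | false, false => crossing_rule B k q p m r
  end.

Definition node_rule (o : nat -> bool) (k : point -> crossing_kind) (c : nat -> X)
    (n : node) : Prop :=
  oriented_rule (o (node_fst n).1) (o (node_snd n).1) (k (node_point n))
    (c (east n)) (c (north n)) (c (west n)) (c (south n)).

Definition tangle_rule o k c T := forall n, List.In n (nodes T) -> node_rule o k c n.

Definition reads (phi : point -> option X) T (c : nat -> X) : Prop :=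
  forall i x, face T i x -> phi x = Some (c i).

Lemma face_bound T i x : face T i x -> (i < size (faces T))%N.
Proof. by rewrite /face ltnNge; apply: contraPN => /(nth_default set0)->. Qed.

Lemma reads_exists K o T phi : tangle_ok T -> contains K o T ->
  face_coloring K phi -> exists c, reads phi T c.
Proof.
move=> ok ct fc.
have off i x : face T i x -> ~ support K x.
  move=> fx; rewrite (contains_drawing ct); first exact: (ok_off ok fx).
  by have [? ? ? ?] := ok_inside ok fx; split; rewrite ler_norml; apply/andP; split; exact: ltW.
have [x0 f0] := ok_inhabited ok (ok_pos ok).
have [a0 _] := face_coloring_Some fc (off _ _ f0).
have H i : exists a, forall x, face T i x -> phi x = Some a.
  have [[x fx]|nx] := pselect (exists x, face T i x); last first.
    by exists a0 => x fx; exfalso; apply: nx; exists x.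
  have [a ea] := face_coloring_Some fc (off _ _ fx).
  exists a => y fy; rewrite -ea.
  apply: (face_coloring_connected fc (C := face T i)) => //.
    exact: (ok_connected ok).
  by move=> z; exact: off.
by have [c cP] := choice H; exists c.
Qed.

Definition germs4 phi x (u v : point) (p q r m : X) : Prop :=
  [/\ germ phi x (u + v) p, germ phi x (v - u) q,
      germ phi x (- (u + v)) r & germ phi x (u - v) m].

(** A quarter turn: the second strand and the reversed first one again form a
    positive pair. *)
Lemma germs4_rotate phi x u v p q r m :
  germs4 phi x u v p q r m -> germs4 phi x v (- u) q r m p.
Proof.
move=> [gp gq gr gm]; split; rewrite ?opprK//.
- by rewrite -opprD.
- by rewrite opprD opprK addrC.
- by rewrite addrC.
Qed.

Lemma germs4_crossing k phi x u v p q r m : germs4 phi x u v p q r m ->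
  crossing_germs B k phi x u v <-> crossing_rule B k m r q p.
Proof.
move=> [gp gq gr gm]; split=> [[l [t [r' [b [gl gt gr' gb]]]]]|cR].
  by rewrite (germ_unique gm gl) (germ_unique gr gt) (germ_unique gq gr')
    (germ_unique gp gb).
by exists m, r, q, p.
Qed.

(** Reversing exactly one of two strands changes the sign of the determinant,
    so the strands trade places. *)
Definition oriented_pair (o : nat -> bool) (a b : nat * edge) : edge * edge :=
  let e := orient_edge (o a.1) a.2 in let f := orient_edge (o b.1) b.2 in
  if o a.1 == o b.1 then (e, f) else (f, e).

Lemma oriented_pair_det o a b : 0 < det (dir a.2) (dir b.2) ->
  0 < det (dir (oriented_pair o a b).1) (dir (oriented_pair o a b).2).
Proof.
rewrite /oriented_pair; case: (o a.1); case: (o b.1);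
  rewrite /= ?dir_orient /det ?coordE; lra.
Qed.

Lemma oriented_germs o k phi x a b p q r m :
  germs4 phi x (dir a.2) (dir b.2) p q r m ->
  crossing_germs B k phi x (dir (oriented_pair o a b).1) (dir (oriented_pair o a b).2)
  <-> oriented_rule (o a.1) (o b.1) k p q r m.
Proof.
move=> g; have g1 := germs4_rotate g; have g2 := germs4_rotate g1.
have g3 := germs4_rotate g2.
rewrite /oriented_pair; case: (o a.1); case: (o b.1);
  rewrite /= ?(dir_orient false) ?opprK in g g1 g2 g3 *; exact: germs4_crossing.
Qed.

Lemma crossing_node K o T e f x : tangle_ok T -> contains K o T ->
  crossing K e f x -> square x ->
  exists a b p q r s, List.In (Node x a b p q r s) (nodes T) /\
    (e, f) = oriented_pair o a b.
Proof.
move=> ok ct cr sx; have [_ _ ex fx d] := cr.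
have [/mapP[a aT ea] /mapP[b bT eb]] := contains_crossings ct cr sx.
rewrite ea in ex d; rewrite eb in fx d.
move: ex fx => /open_segment_orient ax /open_segment_orient bx.
have [oab|nab] := eqVneq (o a.1) (o b.1).
  have d' : 0 < det (dir a.2) (dir b.2).
    by move: d; rewrite !dir_orient oab /det; case: (o b.1); rewrite ?coordE; lra.
  have [p [q [r [s ns]]]] := ok_nodes ok aT bT ax bx d'.
  by exists a, b, p, q, r, s; split=> //; rewrite /oriented_pair oab eqxx ea eb oab.
have d' : 0 < det (dir b.2) (dir a.2).
  move: d; rewrite !dir_orient /det; move: nab.
  by case: (o a.1); case: (o b.1) => //= _; rewrite ?coordE; lra.
have [p [q [r [s ns]]]] := ok_nodes ok bT aT bx ax d'.
exists b, a, p, q, r, s; split=> //; rewrite /oriented_pair ea eb.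
by rewrite eq_sym (negbTE nab).
Qed.

Lemma node_crossing K o T x a b p q r s : tangle_ok T -> contains K o T ->
  List.In (Node x a b p q r s) (nodes T) ->
  crossing K (oriented_pair o a b).1 (oriented_pair o a b).2 x.
Proof.
move=> ok ct ns; have [[aT bT d [ax bx sx]] _] := ok_node ok ns.
have aK : orient_edge (o a.1) a.2 \in edges K by apply: (contains_edges ct); exact: map_f.
have bK : orient_edge (o b.1) b.2 \in edges K by apply: (contains_edges ct); exact: map_f.
have := oriented_pair_det o d.
by rewrite /oriented_pair; case: eqP => _ /= d'; split=> //; exact/open_segment_orient.
Qed.

Lemma node_germs T phi c x a b p q r s : tangle_ok T -> reads phi T c ->
  List.In (Node x a b p q r s) (nodes T) ->
  germs4 phi x (dir a.2) (dir b.2) (c p) (c q) (c r) (c s).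
Proof.
move=> ok rd ns; have [_ [gp gq gr gs]] := ok_node ok ns.
by split; [apply: filterS gp|apply: filterS gq|apply: filterS gr|apply: filterS gs] => t /rd.
Qed.

(** Inside the square a coloring is a labeling of the faces that satisfies one
    equation per node. *)
Lemma tangle_ruleP K o T phi c (k : point -> crossing_kind) :
  tangle_ok T -> contains K o T -> reads phi T c ->
  (forall e f x, crossing K e f x -> square x ->
     crossing_germs B (k x) phi x (dir e) (dir f)) <-> tangle_rule o k c T.
Proof.
move=> ok ct rd; split=> [H [x a b p q r s] ns|H e f x cr sx].
  have g := node_germs ok rd ns; apply/(oriented_germs o _ g).
  apply: H; first exact: node_crossing ns.
  by have [[_ _ _ []]] := ok_node ok ns.
have [a [b [p [q [r [s [ns ef]]]]]]] := crossing_node ok ct cr sx.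
have g := node_germs ok rd ns.
have /(oriented_germs o _ g) := H _ ns; by rewrite -ef.
Qed.

End NodeRule.
End Tangles.

(** * Replacing one tangle by another *)

Section LocalMoves.
Variable R : realType.
Local Notation point := (R * R)%type.
Local Notation edge := (point * point)%type.
Implicit Types (e f g : edge) (x y z w : point) (K : diagram R).

Record same_outside K K' : Prop := SameOutside {
  outside_support : forall x, ~ square x -> (support K x <-> support K' x);
  outside_crossing : forall e f x, ~ square x ->
    (crossing K e f x <-> crossing K' e f x);
  outside_kind : forall x, ~ square x -> double_point K x -> kind K' x = kind K x }.

Lemma same_outside_sym K K' : same_outside K K' -> same_outside K' K.
Proof.
case=> s c k; split=> [x nx|e f x nx|x nx [e [f cr]]].
- by split=> /s; exact.
- by split=> /c; exact.
- by apply/esym/k => //; exists e, f; apply/c.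
Qed.

Lemma open_segment_endpoint e x : e.1 != e.2 -> open_segment e x -> ~ endpoint e x.
Proof.
move=> ne [t /andP[t0 t1] ->].
have nz : dir e != 0 by rewrite /dir subr_eq0 eq_sym.
move=> [] /eqP; rewrite -subr_eq0.
  by rewrite addrAC subrr add0r scaler_eq0 (gt_eqF t0) (negbTE nz).
have -> : e.1 + t *: dir e - e.2 = (t - 1) *: dir e.
  by apply: point_eq; rewrite /dir !coordE /=; ring.
by rewrite scaler_eq0 subr_eq0 (lt_eqF t1) (negbTE nz).
Qed.

Lemma square_segment e : square e.1 -> square e.2 -> segment e `<=` square (R := R).
Proof.
move=> [a1 a2] [b1 b2] x [t /andP[t0 t1] ->].
have H (a b : R) : `|a| <= 2 -> `|b| <= 2 -> `|a + t * (b - a)| <= 2.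
  by rewrite !ler_norml => /andP[? ?] /andP[? ?]; apply/andP; split; nra.
by split; exact: H.
Qed.

Section Exterior.
Variables (K : diagram R) (ext S : seq edge).
Hypothesis KE : perm_eq (edges K) (ext ++ S).
Hypothesis reach : forall e x, e \in ext -> segment e x -> square x ->
  x \in unzip1 S ++ unzip2 S.

Lemma edges_ext e : e \in edges K = (e \in ext) || (e \in S).
Proof. by rewrite (perm_mem KE) mem_cat. Qed.

Lemma ext_uniq : uniq (unzip1 ext ++ unzip1 S) /\ uniq (unzip2 ext ++ unzip2 S).
Proof.
have [u p _ _ _] := edges_generic K.
rewrite -!map_cat -(perm_uniq (perm_map _ KE)); split=> //.
by rewrite -(perm_uniq (perm_map snd KE)) -(perm_uniq p).
Qed.

Lemma ext_not_inner e : e \in ext -> e \in S -> False.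
Proof.
move=> ex eS; have [u _] := ext_uniq.
move: u; rewrite cat_uniq => /and3P[_ /hasPn/(_ e.1) H _].
by have := H (map_f fst eS); rewrite map_f.
Qed.

(** The point [x] is a vertex of an interior edge, and a common point of two
    edges which is a vertex of the one is a vertex of the other. *)
Lemma ext_endpoint e x : e \in ext -> segment e x -> square x -> endpoint e x.
Proof.
move=> ex gx sx; have [_ _ nz trans _] := edges_generic K.
have [s sS sv] : exists2 s, s \in S & endpoint s x.
  have := reach ex gx sx; rewrite mem_cat => /orP[] /mapP[s sS xs].
    by exists s => //; left.
  by exists s => //; right.
have eK : e \in edges K by rewrite edges_ext ex.
have sK : s \in edges K by rewrite edges_ext sS orbT.
have es : e != s by apply/eqP => es; apply: (ext_not_inner ex); rewrite es.
have sx' : segment s x.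
  by case: sv => ->; [exact: segment_src|exact: segment_tgt].
have [[]//|[_ so _]] := trans e s x eK sK es gx sx'.
by have := open_segment_endpoint (nz s sK) so.
Qed.

Lemma ext_crossing e x : e \in ext -> open_segment e x -> ~ square x.
Proof.
move=> ex ox sx; have [_ _ nz _ _] := edges_generic K.
have eK : e \in edges K by rewrite edges_ext ex.
apply: (open_segment_endpoint (nz e eK) ox).
exact: ext_endpoint (open_segmentW ox) sx.
Qed.

(** A vertex is the source of one edge and the target of one edge, so no exterior
    edge can end where two interior ones meet. *)
Lemma ext_inner_vertex e x : e \in ext -> segment e x -> square x ->
  x \in unzip1 S -> x \in unzip2 S -> False.
Proof.
move=> ex gx sx x1 x2; have [u1 u2] := ext_uniq.
have [ev|ev] := ext_endpoint ex gx sx.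
  move: u1; rewrite cat_uniq => /and3P[_ /hasPn/(_ x x1)/negP H _].
  by apply: H; rewrite ev /= map_f.
move: u2; rewrite cat_uniq => /and3P[_ /hasPn/(_ x x2)/negP H _].
by apply: H; rewrite ev /= map_f.
Qed.

End Exterior.

Lemma contains_interior K ext S o (T : tangle R) :
  perm_eq (edges K) (ext ++ S) -> S =i orient o T ->
  (forall e x, e \in ext -> segment e x -> square x -> drawing T x) ->
  (forall e x, e \in ext -> open_segment e x -> ~ square x) ->
  contains K o T.
Proof.
move=> KE ST ext_in ext_open.
have edgesE e : e \in edges K = (e \in ext) || (e \in orient o T).
  by rewrite (perm_mem KE) mem_cat ST.
split=> [x sx|e|e f x [eK fK ex fx _] sx].
- split=> [[e]|[a aT ax]].
    rewrite edgesE => /orP[ee|/mapP[a aT ->]] ex; first exact: ext_in ex sx.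
    by exists a => //; exact/(segment_orient (o a.1)).
  exists (orient_edge (o a.1) a.2); last exact/segment_orient.
  by rewrite edgesE; apply/orP; right; exact: map_f.
- by rewrite edgesE orbC => ->.
- move: eK fK; rewrite !edgesE.
  by case/orP=> [/ext_open/(_ ex)//|->]; case/orP=> [/ext_open/(_ fx)//|->].
Qed.

(** The two arcs belong to one strand, so the vertex lies inside this strand
    for either of its orientations. *)
Definition inner_vertex (T : tangle R) v := exists a b,
  [/\ a \in arcs T, b \in arcs T, a.1 = b.1, a.2.2 = v & b.2.1 = v].

(** The exterior edges may reach the square at the ends of the strands of [T],
    and these must lie on [T'] as well; an inner vertex of [T] may disappear,
    since no exterior edge ends there. *)
Lemma replaces_local K K' S S' o (T T' : tangle R) :
  tangle_ok T -> tangle_ok T' -> S =i orient o T -> S' =i orient o T' ->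
  (forall a, a \in arcs T ->
     (drawing T' a.2.1 \/ inner_vertex T a.2.1) /\
     (drawing T' a.2.2 \/ inner_vertex T a.2.2)) ->
  replaces S S' K K' ->
  [/\ contains K o T, contains K' o T' & same_outside K K'].
Proof.
move=> ok ok' ST ST' ends [ext [KE KE' reach ksame]].
have inner v : inner_vertex T v -> v \in unzip1 S /\ v \in unzip2 S.
  move=> [a [b [aT bT ab av bv]]].
  have aS : orient_edge (o a.1) a.2 \in S by rewrite ST; exact: map_f.
  have bS : orient_edge (o b.1) b.2 \in S by rewrite ST; exact: map_f.
  rewrite ab in aS; move: aS bS; case: (o b.1) => /= aS bS; split; apply/mapP.
  - by exists b.2.
  - by exists a.2.
  - by exists (a.2.2, a.2.1).
  - by exists (b.2.2, b.2.1).
have verts x : x \in unzip1 S ++ unzip2 S ->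
    drawing T' x \/ (x \in unzip1 S /\ x \in unzip2 S).
  rewrite mem_cat => /orP[] /mapP[s]; rewrite ST => /mapP[a aT ->] ->;
    have [h1 h2] := ends a aT; case: (o a.1) => /=;
    by [case: h1 => [|/inner]; [left|right]|case: h2 => [|/inner]; [left|right]].
have in_T' e x : e \in ext -> segment e x -> square x -> drawing T' x.
  move=> ee ex sx; have [//|[x1 x2]] := verts _ (reach _ _ ee ex sx).
  by exfalso; exact: (ext_inner_vertex KE reach ee ex sx x1 x2).
have in_T e x : e \in ext -> segment e x -> square x -> drawing T x.
  move=> ee ex sx; have := reach e x ee ex sx; rewrite mem_cat => /orP[] /mapP[s];
    rewrite ST => /mapP[a aT ->] ->; exists a => //; apply/(segment_orient (o a.1)).
    exact: segment_src.
  exact: segment_tgt.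
(* Edges that reach outside the square are exterior, hence common to both
   diagrams. *)
have half K1 K2 S1 S2 (T1 : tangle R) : tangle_ok T1 -> S1 =i orient o T1 ->
    perm_eq (edges K1) (ext ++ S1) -> perm_eq (edges K2) (ext ++ S2) ->
    forall e x, segment e x -> ~ square x -> e \in edges K1 -> e \in edges K2.
  move=> ok1 ST1 E1 E2 e x ex nx; rewrite (perm_mem E1) (perm_mem E2) !mem_cat.
  move=> /orP[->//|]; rewrite ST1 => /mapP[a aT ea].
  move: ex; rewrite ea => /segment_orient ex.
  have [s1 s2] := ok_arcs ok1 aT.
  by exfalso; apply: nx; exact: square_segment ex.
have h1 := half _ _ _ _ _ ok ST KE KE'; have h2 := half _ _ _ _ _ ok' ST' KE' KE.
have ext_open := ext_crossing KE reach.
split.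
- exact: (contains_interior KE).
- exact: (contains_interior KE').
split=> [x nx|e f x nx|x nx dx]; last exact: ksame.
- split=> -[e eK ex]; exists e => //; [exact: h1 ex nx _|exact: h2 ex nx _].
- split=> -[eK fK ex fx d]; have gx := open_segmentW ex; have hx := open_segmentW fx.
    by split=> //; [exact: h1 gx nx _|exact: h1 hx nx _].
  by split=> //; [exact: h2 gx nx _|exact: h2 hx nx _].
Qed.

(** The region labels [i] of [T] and [j] of [T'] are linked when the two regions
    overlap outside the set [M] in which the move takes place. On the boundary of
    the square [M] may only contain points of both drawings, so that no
    region of the exterior meets [M] there. *)
Record overlay (T T' : tangle R) (M : set point) (link : seq (nat * nat)) : Prop :=
  Overlay {
  overlay_closed : closed M;
  overlay_square : M `<=` square (R := R);
  overlay_cover : forall x, M x -> open_square x \/ drawing T x /\ drawing T' x;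
  overlay_drawing : forall x, ~ M x -> (drawing T x <-> drawing T' x);
  overlay_link : forall x i j, ~ M x -> face T i x -> face T' j x ->
    (i, j) \in link;
  overlay_witness : forall i j, (i, j) \in link ->
    exists x, [/\ ~ M x, face T i x & face T' j x] }.

Definition converse (link : seq (nat * nat)) := [seq (p.2, p.1) | p <- link].

Lemma mem_converse link i j : ((j, i) \in converse link) = ((i, j) \in link).
Proof.
apply/mapP/idP => [[[a b] ab [-> ->]] //|ij].
by exists (i, j).
Qed.

Lemma overlay_sym T T' M link :
  overlay T T' M link -> overlay T' T M (converse link).
Proof.
case=> cM sM cov dr lk wit; split=> //.
- by move=> x /cov[|[? ?]]; [left|right].
- by move=> x /dr H; split=> /H.
- by move=> x i j nx f1 f2; rewrite mem_converse; exact: (lk x j i nx f2 f1).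
- by move=> i j; rewrite mem_converse => /wit[x [? ? ?]]; exists x.
Qed.

Section Recoloring.
Variables (X : Type) (B : psybracket X) (K K' : diagram R) (o : nat -> bool).
Variables (T T' : tangle R) (M : set point) (link : seq (nat * nat)).
Hypotheses (ok : tangle_ok T) (ok' : tangle_ok T').
Hypotheses (KT : contains K o T) (KT' : contains K' o T').
Hypotheses (out : same_outside K K') (ov : overlay T T' M link).

Definition matched (c c' : nat -> X) := forall i j, (i, j) \in link -> c i = c' j.

Definition agree_off (phi phi' : point -> option X) := forall x, ~ M x -> phi x = phi' x.

Lemma support_off x : ~ M x -> (support K x <-> support K' x).
Proof.
move=> nx; have [sx|] := pselect (square x); last exact: outside_support.
by rewrite (contains_drawing KT sx) (contains_drawing KT' sx); exact: (overlay_drawing ov nx).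
Qed.

Lemma face_transfer j x : ~ M x -> face T' j x -> exists2 i, face T i x & (i, j) \in link.
Proof.
move=> nx fx; have ndx := ok_off ok' fx.
have [/(overlay_drawing ov nx)//|[i fi]] := ok_cover ok (ok_inside ok' fx).
by exists i => //; exact: (overlay_link ov nx fi fx).
Qed.

(** The new coloring is the old one off [M] and is read from the new labels on
    [M]. Since matched labels agree, the two descriptions coincide on every
    face of [T'] that leaves [M], and the result is locally constant. *)
Lemma recolor phi : plane_coloring B K phi ->
  (forall c, tangle_rule B o (kind K) c T ->
     exists2 c', tangle_rule B o (kind K') c' T' & matched c c') ->
  exists2 phi', plane_coloring B K' phi' & agree_off phi phi'.
Proof.
move=> [fc pc] alg; have [c rd] := reads_exists ok KT fc.
have /alg [c' rule' mt] : tangle_rule B o (kind K) c T.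
  by apply/(tangle_ruleP B (kind K) ok KT rd) => e f x cr _; exact: pc.
pose phi' x := if pselect (M x) then
    (if pselect (exists i, face T' i x) is left h then Some (c' (projT1 (cid h)))
     else None)
  else phi x.
have off x : ~ M x -> phi' x = phi x by rewrite /phi'; case: (pselect (M x)).
have inside j x : face T' j x -> phi' x = Some (c' j).
  move=> fx; have [Mx|nx] := pselect (M x); last first.
    by rewrite off//; have [i fi /mt <-] := face_transfer nx fx; exact: rd.
  rewrite /phi'; case: (pselect (M x)) => [a|//] /=.
  case: pselect => [h|[]] /=; last by exists j.
  by case: cid => i /= fi; rewrite (ok_disjoint ok' fi fx).
have nM : open (~` M) by exact/closed_openC/(overlay_closed ov).
have in_faces x : M x -> support K' x \/ exists j, face T' j x.
  move=> Mx; have sx := overlay_square ov Mx; rewrite (contains_drawing KT' sx).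
  by case: (overlay_cover ov Mx) => [/(ok_cover ok')|[_ d']] //; left.
have fc' : face_coloring K' phi'.
  split=> x.
    have [Mx|nx] := pselect (M x); last by rewrite off// fc.1; exact: support_off.
    have sx := overlay_square ov Mx; rewrite (contains_drawing KT' sx).
    split=> [e|dx].
      have [/(contains_drawing KT' sx)//|[j fj]] := in_faces _ Mx.
      by move: e; rewrite (inside j).
    rewrite /phi'; case: (pselect (M x)) => [a|//] /=; case: pselect => // -[j fj].
    by have := ok_off ok' fj.
  move=> nx; have [Mx|nMx] := pselect (M x); last first.
    have n1 : \forall y \near x, ~ M y by exact: open_nbhs_nbhs.
    have nx' : ~ support K x by move=> /(support_off nMx).
    have n2 := fc.2 x nx'.
    by apply: filterS2 n1 n2 => y /off-> ->; rewrite off.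
  have [//|[j fj]] := in_faces _ Mx.
  have n1 : nbhs x (face T' j) by apply: open_nbhs_nbhs; split=> //; exact: ok_open.
  by apply: filterS n1 => y fy; rewrite (inside j)// (inside j).
exists phi'; last by move=> x nx; rewrite off.
split=> // e f x cr; have [sx|nx] := pselect (square x).
  exact: (iffRL (tangle_ruleP B (kind K') ok' KT' inside) rule').
have cr' : crossing K e f x by apply/(outside_crossing out e f nx).
have nMx : ~ M x by move=> /(overlay_square ov).
have nU : nbhs x (~` M) by exact: open_nbhs_nbhs.
have kk := outside_kind out nx (ex_intro _ e (ex_intro _ f cr')).
have [l [t [r [b [gl gt gr gb cR]]]]] := pc e f x cr'.
have tr w a : germ phi x w a -> germ phi' x w a.
  by apply: filterS2 (near_ray w nU) => s ns; rewrite off.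
by exists l, t, r, b; split; [exact: tr|exact: tr|exact: tr|exact: tr|rewrite kk].
Qed.

Lemma recolor_unique phi phi1 phi2 : plane_coloring B K phi ->
  plane_coloring B K' phi1 -> plane_coloring B K' phi2 ->
  agree_off phi phi1 -> agree_off phi phi2 ->
  (forall c c1 c2, tangle_rule B o (kind K) c T -> tangle_rule B o (kind K') c1 T' ->
     tangle_rule B o (kind K') c2 T' -> matched c c1 -> matched c c2 ->
     forall j, (j < size (faces T'))%N -> c1 j = c2 j) ->
  phi1 = phi2.
Proof.
move=> [fc pc] [fc1 pc1] [fc2 pc2] a1 a2 alg.
have [c rd] := reads_exists ok KT fc.
have [c1 rd1] := reads_exists ok' KT' fc1.
have [c2 rd2] := reads_exists ok' KT' fc2.
have rl : tangle_rule B o (kind K) c T.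
  by apply/(tangle_ruleP B (kind K) ok KT rd) => e f x cr _; exact: pc.
have rl1 : tangle_rule B o (kind K') c1 T'.
  by apply/(tangle_ruleP B (kind K') ok' KT' rd1) => e f x cr _; exact: pc1.
have rl2 : tangle_rule B o (kind K') c2 T'.
  by apply/(tangle_ruleP B (kind K') ok' KT' rd2) => e f x cr _; exact: pc2.
have mt c0 phi0 : reads phi0 T' c0 -> agree_off phi phi0 -> matched c c0.
  move=> rd0 a0 i j /(overlay_witness ov)[x [nx fi fj]].
  by have := a0 x nx; rewrite (rd _ _ fi) (rd0 _ _ fj) => -[].
have e12 := alg c c1 c2 rl rl1 rl2 (mt _ _ rd1 a1) (mt _ _ rd2 a2).
apply/funext => x; have [Mx|nx] := pselect (M x); last by rewrite -a1// -a2.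
have sx := overlay_square ov Mx.
have [dx|[j fj]] : support K' x \/ exists j, face T' j x.
- rewrite (contains_drawing KT' sx).
  by case: (overlay_cover ov Mx) => [/(ok_cover ok')|[_ d']] //; left.
- by rewrite (iffRL (fc1.1 x) dx) (iffRL (fc2.1 x) dx).
by rewrite (rd1 _ _ fj) (rd2 _ _ fj) e12//; exact: face_bound fj.
Qed.

End Recoloring.

(** Matching is a total function from the solutions of [P] to the solutions of
    [Q], on the first [n] labels. *)
Definition corresponds (X : Type) (link : seq (nat * nat)) n (P Q : (nat -> X) -> Prop) :=
  (forall c, P c -> exists2 c', Q c' & matched link c c') /\
  (forall c c1 c2, P c -> Q c1 -> Q c2 -> matched link c c1 -> matched link c c2 ->
     forall j, (j < n)%N -> c1 j = c2 j).

(** Agreement off [M] is a bijective relation between the colorings of [K] and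
    those of [K']. *)
Lemma local_move (X : finType) (B : psybracket X) K K' o T T' M link :
  tangle_ok T -> tangle_ok T' -> contains K o T -> contains K' o T' ->
  same_outside K K' -> overlay T T' M link ->
  corresponds link (size (faces T'))
    (fun c : nat -> X => tangle_rule B o (kind K) c T)
    (fun c => tangle_rule B o (kind K') c T') ->
  corresponds (converse link) (size (faces T))
    (fun c : nat -> X => tangle_rule B o (kind K') c T')
    (fun c => tangle_rule B o (kind K) c T) ->
  counting_invariant B K = counting_invariant B K'.
Proof.
move=> ok ok' KT KT' out ov [ex1 un1] [ex2 un2].
have ov' := overlay_sym ov; have out' := same_outside_sym out.
have agree_sym phi phi' : agree_off M phi phi' -> agree_off M phi' phi :> Prop.
  by move=> a x /a.
apply: counting_invariant_card.
apply: (functional_bijection_card (r := fun p q => agree_off M p q)) => [phi pc|phi' pc||].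
- exact: (recolor ok ok' KT KT' out ov pc ex1).
- have [phi pc' a] := recolor ok' ok KT' KT out' ov' pc ex2.
  by exists phi => //; exact: agree_sym.
- move=> phi p1 p2 pc c1 c2 a1 a2.
  exact: (recolor_unique ok ok' KT KT' ov pc c1 c2 a1 a2 un1).
- move=> p1 p2 phi pc1 pc2 pc /agree_sym a1 /agree_sym a2.
  exact: (recolor_unique ok' ok KT' KT ov' pc pc1 pc2 a1 a2 un2).
Qed.

End LocalMoves.

(** * Convex polygons *)

Section Polygons.
Variable R : realType.
Local Notation point := (R * R)%type.
Local Notation edge := (point * point)%type.
Implicit Types (x y z w : point) (h : R * R * R).

Definition affine_form h x : R := h.1.1 * x.1 + h.1.2 * x.2 + h.2.

Fixpoint satisfies (P : R -> Prop) (l : seq (R * R * R)) x : Prop :=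
  if l is h :: l' then P (affine_form h x) /\ satisfies P l' x else True.

(** The four sides of the square. *)
Definition frame : seq (R * R * R) :=
  [:: (1, 0, 2); (-1, 0, 2); (0, 1, 2); (0, -1, 2)].

Definition polygon l : set point := satisfies (fun a => 0 < a) (frame ++ l).
Definition closed_polygon l : set point := satisfies (fun a => 0 <= a) l.

Lemma affine_form_continuous h : continuous (affine_form h).
Proof.
move=> x; rewrite /affine_form.
apply: cvgD; last exact: cvg_cst.
by apply: cvgD; apply: cvgM; (try exact: cvg_cst); [exact: cvg_fst|exact: cvg_snd].
Qed.

Lemma satisfies_open (P : R -> Prop) l : open (P : set R) -> open (satisfies P l).
Proof.
move=> oP; elim: l => [|h l IH] /=; first exact: openT.
by apply: openI => //; apply: open_comp => // x _; exact: affine_form_continuous.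
Qed.

Lemma satisfies_closed (P : R -> Prop) l : closed (P : set R) -> closed (satisfies P l).
Proof.
move=> oP; elim: l => [|h l IH] /=; first exact: closedT.
by apply: closedI => //; apply: closed_comp => // x _; exact: affine_form_continuous.
Qed.

Lemma polygon_open l : open (polygon l).
Proof. by apply: satisfies_open; exact: open_gt. Qed.

Lemma closed_polygon_closed l : closed (closed_polygon l).
Proof. by apply: satisfies_closed; exact: closed_ge. Qed.

Lemma polygon_convex l x y : polygon l x -> polygon l y -> segment (x, y) `<=` polygon l.
Proof.
rewrite /polygon; elim: (_ ++ _) => [//|h k IH] /= [hx kx] [hy ky] z xyz.
split; last exact: IH xyz.
have [t /andP[t0 t1] ->] := xyz.
have -> : affine_form h (x + t *: dir (x, y)) =
    (1 - t) * affine_form h x + t * affine_form h y.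
  by rewrite /affine_form /dir !coordE /=; ring.
have [->|tp] := eqVneq t 0; first by rewrite subr0 mul1r mul0r addr0.
have t2 : 0 < t by rewrite lt_neqAle eq_sym tp.
by apply: ltr_wpDl; [apply: mulr_ge0; [lra|exact: ltW]|exact: mulr_gt0].
Qed.

(** A convex set is a union of segments with a common end. *)
Lemma polygon_connected l : connected (polygon l).
Proof.
have [[x px]|nx] := pselect (exists x, polygon l x); last first.
  rewrite (_ : polygon l = set0); first exact: connected0.
  by apply/seteqP; split=> // x px; apply: nx; exists x.
rewrite (_ : polygon l = \bigcup_(y in polygon l) segment (x, y)).
  apply: bigcup_connected => [|y _]; last exact: segment_connected.
  by exists x => y _; exact: (segment_src (x, y)).
apply/seteqP; split=> y; first by move=> py; exists y => //; exact: (segment_tgt (x, y)).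
by move=> [z pz]; exact: polygon_convex.
Qed.

(** A description of segments by linear conditions, on which linear arithmetic
    can work. *)
Lemma segment_abscissa p q x : p.1 < q.1 ->
  segment (p, q) x <-> (p.1 <= x.1 /\ x.1 <= q.1) /\
    (q.1 - p.1) * (x.2 - p.2) = (q.2 - p.2) * (x.1 - p.1).
Proof.
move=> pq; split=> [[t /andP[t0 t1] ->]|[[x1 x2] e]].
  have a : 0 <= t * (q.1 - p.1) by apply: mulr_ge0 => //; lra.
  have b : 0 <= (1 - t) * (q.1 - p.1) by apply: mulr_ge0 => //; lra.
  by rewrite /dir !coordE /=; split; [split; lra|ring].
have d : q.1 - p.1 != 0 by rewrite subr_eq0 gt_eqF.
exists ((x.1 - p.1) / (q.1 - p.1)).
  by apply/andP; split; [apply: divr_ge0; lra|rewrite ler_pdivrMr; lra].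
apply: point_eq; rewrite /dir !coordE /=; first by field.
apply: (mulfI d); rewrite -[LHS](subrK ((q.1 - p.1) * p.2)) -mulrBr e.
by field.
Qed.

Lemma segment_ordinate p q x : p.2 < q.2 ->
  segment (p, q) x <-> (p.2 <= x.2 /\ x.2 <= q.2) /\
    (q.2 - p.2) * (x.1 - p.1) = (q.1 - p.1) * (x.2 - p.2).
Proof.
move=> pq; split=> [[t /andP[t0 t1] ->]|[[x1 x2] e]].
  have a : 0 <= t * (q.2 - p.2) by apply: mulr_ge0 => //; lra.
  have b : 0 <= (1 - t) * (q.2 - p.2) by apply: mulr_ge0 => //; lra.
  by rewrite /dir !coordE /=; split; [split; lra|ring].
have d : q.2 - p.2 != 0 by rewrite subr_eq0 gt_eqF.
exists ((x.2 - p.2) / (q.2 - p.2)).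
  by apply/andP; split; [apply: divr_ge0; lra|rewrite ler_pdivrMr; lra].
apply: point_eq; rewrite /dir !coordE /=; last by field.
apply: (mulfI d); rewrite -[LHS](subrK ((q.2 - p.2) * p.1)) -mulrBr e.
by field.
Qed.

End Polygons.

(** * Explicit tangles *)

Section TangleTactics.
Variable R : realType.
Local Notation point := (R * R)%type.
Implicit Types (x y : point).

Lemma polygonE (l : seq (R * R * R)) x : polygon l x <->
  [/\ -2 < x.1, x.1 < 2, -2 < x.2 & x.2 < 2] /\ satisfies (fun a => 0 < a) l x.
Proof.
rewrite /polygon /= /affine_form /=.
by split=> [[? [? [? [? s]]]]|[[? ? ? ?] s]]; split=> //; (try split); repeat split=> //; lra.
Qed.

Lemma polygon_wedge (l : seq (R * R * R)) x :
  polygon l x -> satisfies (fun a => 0 < a) l x.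
Proof. by move=> /polygonE[]. Qed.

Lemma open_segmentE e x : open_segment e x -> exists t : R,
  [/\ 0 < t, t < 1, x.1 = e.1.1 + t * (e.2.1 - e.1.1)
    & x.2 = e.1.2 + t * (e.2.2 - e.1.2)].
Proof. by move=> [t /andP[t0 t1] ->]; exists t; rewrite /dir !coordE. Qed.

(** The bound 1 / 100 is smaller than every distance that matters in the
    pictures below. *)
Lemma near_small (P : R -> Prop) :
  (forall t : R, 0 < t -> t < 1 / 100 -> P t) -> \forall t \near 0^'+, P t.
Proof.
move=> H; have p : (0 : R) < 1 / 100 by lra.
by apply: filterS2 (nbhs_right_gt 0) (nbhs_right_lt p) => t; exact: H.
Qed.

Lemma polygon_inside (l : seq (R * R * R)) : polygon l `<=` open_square (R := R).
Proof. by move=> x /polygonE[]. Qed.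

Lemma drawing_cons (a : nat * (point * point)) s f n x :
  drawing (Tangle (a :: s) f n) x <-> segment a.2 x \/ drawing (Tangle s f n) x.
Proof.
split=> [[b]|[ax|[b bs bx]]].
- rewrite inE => /predU1P[->|bs]; [by left|].
  by move=> bx; right; exists b.
- by exists a => //; rewrite mem_head.
- by exists b => //; rewrite inE bs orbT.
Qed.

Lemma drawing_nil (f : seq (set point)) n x : ~ drawing (Tangle [::] f n) x.
Proof. by move=> []. Qed.

(** Together with [arc_none] this runs through the arcs of a tangle one by one,
    without deciding equalities of real numbers. *)
Lemma arc_cases (P : nat * (point * point) -> Prop) a s : P a ->
  (forall b, b \in s -> P b) -> forall b, b \in a :: s -> P b.
Proof. by move=> Pa Ps b; rewrite inE => /predU1P[->//|/Ps]. Qed.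

Lemma arc_none (P : nat * (point * point) -> Prop) b : b \in [::] -> P b.
Proof. by []. Qed.

Lemma face_nil i : nth set0 [::] i = set0 :> set point.
Proof. exact: nth_nil. Qed.

End TangleTactics.

Ltac conjs := repeat match goal with H : _ /\ _ |- _ => destruct H end.

Ltac in_polygon :=
  match goal with
  | |- _ \/ _ => first [left; in_polygon | right; in_polygon]
  | |- (_ `|` _) _ => first [left; in_polygon | right; in_polygon]
  | |- _ => apply/polygonE; rewrite /satisfies /affine_form ?coordE /=;
      split; [split; lra|repeat split; lra]
  end.

Ltac in_segment s :=
  exists s; [lra|by apply: point_eq; rewrite /dir !coordE /=; lra].

Ltac in_square := by split; rewrite /= ler_norml; apply/andP; split; lra.

Ltac near_polygon :=
  apply: near_small => t t0 t1; rewrite /face [nth _ _ _]/= /dir; in_polygon.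

Ltac in_closed_polygon :=
  rewrite /closed_polygon /satisfies /affine_form /=; repeat split; lra.

Ltac out_closed_polygon :=
  rewrite /closed_polygon /satisfies /affine_form /=; intro; conjs; lra.

Ltac on_drawing :=
  first [ by constructor 1; repeat split; rewrite /=; lra
        | by constructor 2; repeat split; rewrite /=; lra
        | by constructor 3; repeat split; rewrite /=; lra
        | by constructor 4; repeat split; rewrite /=; lra ].

Ltac split_hypotheses unfold_polygon :=
  repeat first
    [ progress intros
    | match goal with
      | H : _ /\ _ |- _ => destruct H
      | H : _ \/ _ |- _ => destruct H
      | H : or3 _ _ _ |- _ => destruct H
      | H : or4 _ _ _ _ |- _ => destruct H
      | H : and4 _ _ _ _ |- _ => destruct H
      | H : (_ `|` _) _ |- _ => destruct H
      | H : True |- _ => clear H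
      | H : polygon _ _ |- _ => unfold_polygon H
      end ].

Ltac unfold_framed H :=
  apply (iffLR (polygonE _ _)) in H; rewrite /satisfies /affine_form /= in H.

Ltac unfold_wedge H :=
  apply polygon_wedge in H; rewrite /satisfies /affine_form /= in H.

Ltac out_polygon := split_hypotheses unfold_framed; try done; try (exfalso; lra).

(** The sides of the square are forgotten, which spares linear arithmetic many
    inequalities in the comparison of two regions. *)
Ltac out_wedge := split_hypotheses unfold_wedge; try done; try (exfalso; lra).

(** * The kink *)

Section Kink.
Variable R : realType.
Local Notation point := (R * R)%type.
Implicit Types (x y : point).

Definition straight_tangle : tangle R := Tangle
  [:: (0%N, ((-2, 0), (2, 0)))]
  [:: polygon [:: (0, 1, 0)]; polygon [:: (0, -1, 0)]] [::].

(** Face 0 is the outer region above the kink, which is not convex; faces 1 and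
    2 are the region below and the inside of the loop. At the crossing (0, 1),
    face 0 lies on both sides. *)
Definition kink_tangle : tangle R :=
  let a1 := (0%N, ((-2, 0), (1, 3 / 2))) in
  let a2 := (0%N, ((1, 3 / 2), (-1, 3 / 2))) in
  let a3 := (0%N, ((-1, 3 / 2), (2, 0))) in
  Tangle [:: a1; a2; a3]
  [:: polygon [:: (0, 1, - (3 / 2))] `|`
      (polygon [:: (-1, 2, -2); (-1, -2, 2)] `|` polygon [:: (1, 2, -2); (1, -2, 2)]);
      polygon [:: (1, -2, 2); (-1, -2, 2)];
      polygon [:: (-1, 2, -2); (1, 2, -2); (0, -1, 3 / 2)]]
  [:: Node (0, 1) a3 a1 0%N 2%N 0%N 1%N].

Lemma straight_drawing x : drawing straight_tangle x <->
  (-2 <= x.1 /\ x.1 <= 2) /\ x.2 = 0.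
Proof.
rewrite /straight_tangle drawing_cons segment_abscissa /=; last by lra.
split=> [[[[? ?] ?]|/drawing_nil//]|[[? ?] ?]]; first by split=> //; lra.
by left; split=> //; lra.
Qed.

Lemma kink_drawing x : drawing kink_tangle x <->
  [\/ (-2 <= x.1 /\ x.1 <= 1) /\ x.1 - 2 * x.2 + 2 = 0,
      (-1 <= x.1 /\ x.1 <= 1) /\ x.2 = 3 / 2 |
      (-1 <= x.1 /\ x.1 <= 2) /\ x.1 + 2 * x.2 - 2 = 0].
Proof.
rewrite /kink_tangle !drawing_cons.
split=> [[|[|[|/drawing_nil//]]]|[|/=|]].
- by rewrite segment_abscissa /=; [|lra]; move=> [? ?]; constructor 1; split=> //; lra.
- by move/segment_sym; rewrite segment_abscissa /=; [|lra]; move=> [? ?];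
  constructor 2; split=> //; lra.
- by rewrite segment_abscissa /=; [|lra]; move=> [? ?]; constructor 3; split=> //; lra.
- by move=> [? ?]; left; rewrite segment_abscissa /=; [|lra]; split=> //; lra.
- move=> [[? ?] ?]; right; left; apply: segment_sym.
  by rewrite segment_abscissa /=; [|lra]; split; [split; lra|lra].
- by move=> [? ?]; right; right; left; rewrite segment_abscissa /=; [|lra]; split=> //; lra.
Qed.

Lemma kink_cover x : open_square x ->
  drawing kink_tangle x \/ exists i, face kink_tangle i x.
Proof.
move=> [? ? ? ?]; rewrite kink_drawing.
have [a|a|a] := ltgtP (x.1 - 2 * x.2 + 2) 0;
have [b|b|b] := ltgtP (x.1 + 2 * x.2 - 2) 0.
- by right; exists 0%N; right; left; in_polygon.
- have [c|c|c] := ltgtP x.2 (3 / 2).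
  + by right; exists 2%N; in_polygon.
  + by right; exists 0%N; left; in_polygon.
  + by left; constructor 2; repeat split; lra.
- have [c|c] := leP x.2 (3 / 2).
    by left; constructor 3; repeat split; lra.
  by right; exists 0%N; left; in_polygon.
- by right; exists 1%N; in_polygon.
- by right; exists 0%N; right; right; in_polygon.
- by left; constructor 3; repeat split; lra.
- by left; constructor 1; repeat split; lra.
- have [c|c] := leP x.2 (3 / 2).
    by left; constructor 1; repeat split; lra.
  by right; exists 0%N; left; in_polygon.
- by left; constructor 1; repeat split; lra.
Qed.

Lemma kink_nodes a b x : a \in arcs kink_tangle -> b \in arcs kink_tangle ->
  open_segment a.2 x -> open_segment b.2 x -> 0 < det (dir a.2) (dir b.2) ->
  exists p q r s, List.In (Node x a b p q r s) (nodes kink_tangle).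
Proof.
move=> aT bT; move: a aT b bT; do !apply: arc_cases; try exact: arc_none;
  move=> /open_segmentE/=[t [? ? ? ?]] /open_segmentE/=[s [? ? ? ?]];
  rewrite /det /dir !coordE /= => ?; try (exfalso; lra).
by exists 0%N, 2%N, 0%N, 1%N; left; congr Node; apply: point_eq => /=; lra.
Qed.

Lemma kink_disjoint i j x :
  face kink_tangle i x -> face kink_tangle j x -> i = j.
Proof.
wlog ij : i j / (i <= j)%N => [H fi fj|].
  by case/orP: (leq_total i j) => ij; [|apply/esym]; exact: H.
rewrite /face /=; move: ij.
case: i => [|[|[|i]]]; case: j => [|[|[|j]]] //= _;
  rewrite ?face_nil //; out_wedge.
Qed.

Lemma kink_tangle_ok : tangle_ok kink_tangle.
Proof.
split; last 2 first.
- exact: kink_nodes.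
- move=> x a b p q r s [] // [<- <- <- <- <- <- <-] u v; rewrite {}/u {}/v; split.
    split; rewrite ?inE ?eqxx ?orbT//; first by rewrite /det /dir !coordE /=; lra.
    by split; [in_segment (1 / 3 : R)|in_segment (2 / 3 : R)|in_square].
  by split; near_polygon.
- do !apply: arc_cases; try exact: arc_none; split; in_square.
- move=> i; rewrite /face /=; case: i => [|[|[|i]]] /=;
    rewrite ?face_nil; try exact: open0; do ?apply: openU; exact: polygon_open.
- move=> i; rewrite /face /=; case: i => [|[|[|i]]] /=;
    rewrite ?face_nil; try exact: connected0; try exact: polygon_connected.
  rewrite setUCA; apply: connectedU; [|exact: polygon_connected|].
    by exists (-3 / 2, 8 / 5); split; [|left]; in_polygon.
  by apply: connectedU; [exists (3 / 2, 8 / 5); split; in_polygon|exact: polygon_connected..].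
- case=> [|[|[|//]]] _; rewrite /face /=.
  + by exists (0, 8 / 5); left; in_polygon.
  + by exists (0, 0); in_polygon.
  + by exists (0, 5 / 4); in_polygon.
- by [].
- move=> i; rewrite /face /=; case: i => [|[|[|i]]] /=; rewrite ?face_nil //;
    do ?[apply: polygon_inside|rewrite subUset; split].
- move=> i x + /kink_drawing; rewrite /face /=.
  by case: i => [|[|[|i]]] /=; rewrite ?face_nil //; out_wedge.
- exact: kink_disjoint.
- exact: kink_cover.
Qed.

End Kink.

Section KinkMove.
Variable R : realType.
Local Notation point := (R * R)%type.
Implicit Types (x y : point).

Lemma straight_tangle_ok : tangle_ok (straight_tangle R).
Proof.
split=> //.
- do !apply: arc_cases; try exact: arc_none; split; in_square.
- move=> i; rewrite /face /=; case: i => [|[|i]] /=;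
    rewrite ?face_nil; try exact: open0; exact: polygon_open.
- move=> i; rewrite /face /=; case: i => [|[|i]] /=;
    rewrite ?face_nil; try exact: connected0; exact: polygon_connected.
- case=> [|[|//]] _; rewrite /face /=.
  + by exists (0, 1); in_polygon.
  + by exists (0, -1); in_polygon.
- move=> i; rewrite /face /=; case: i => [|[|i]] /=; rewrite ?face_nil //;
    apply: polygon_inside.
- move=> i x + /straight_drawing; rewrite /face /=.
  by case: i => [|[|i]] /=; rewrite ?face_nil //; out_polygon.
- move=> i j x; rewrite /face /=.
  case: i => [|[|i]] /=; case: j => [|[|j]] /=; rewrite ?face_nil //; out_polygon.
- move=> x [? ? ? ?]; rewrite straight_drawing.
  have [a|a|a] := ltgtP x.2 0.
  + by right; exists 1%N; in_polygon.
  + by right; exists 0%N; in_polygon.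
  + by left; repeat split; lra.
- move=> a b x aT bT; move: a aT b bT; do !apply: arc_cases; try exact: arc_none.
  by move=> _ _; rewrite /det /dir !coordE /= => ?; exfalso; lra.
Qed.

(** A quadrilateral around the kink and the straight arc, which meets the
    boundary of the square only at the common ends of the arcs. *)
Definition kink_hull : set point := closed_polygon
  [:: (0, 1, 0); (0, -1, 3 / 2); (3 / 2, -1, 3); (- (3 / 2), -1, 3)].

Lemma kink_overlay :
  overlay (straight_tangle R) (kink_tangle R) kink_hull [:: (0, 0); (1, 1)]%N.
Proof.
split.
- exact: closed_polygon_closed.
- rewrite /kink_hull /closed_polygon /satisfies /affine_form /= => x; conjs => /=.
  move=> [? [? [? [? _]]]]; split; rewrite ler_norml; apply/andP; split; lra.
- move=> x; rewrite straight_drawing kink_drawing.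
  rewrite /kink_hull /closed_polygon /satisfies /affine_form /= => -[? [? [? [? _]]]].
  have [a|a] := leP x.1 (-2); last have [b|b] := leP 2 x.1.
  + by right; split; [|constructor 1]; repeat split; lra.
  + by right; split; [|constructor 3]; repeat split; lra.
  + by left; split; lra.
- move=> x nM; rewrite straight_drawing kink_drawing; split=> d; exfalso; apply: nM;
    out_polygon; rewrite /kink_hull; in_closed_polygon.
- move=> x i j nM; rewrite /face /=.
  case: i => [|[|i]] /=; case: j => [|[|[|j]]] /=; rewrite ?face_nil //; out_polygon;
    by exfalso; apply: nM; rewrite /kink_hull; in_closed_polygon.
- move=> i j; rewrite !inE => /orP[] /eqP[-> ->].
  + by exists (0, 19 / 10); split; [rewrite /kink_hull; out_closed_polygon
      |rewrite /face [nth _ _ _]/=; in_polygon|rewrite /face [nth _ _ _]/=; in_polygon].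
  + by exists (0, -1); split; [rewrite /kink_hull; out_closed_polygon
      |rewrite /face [nth _ _ _]/=; in_polygon|rewrite /face [nth _ _ _]/=; in_polygon].
Qed.

Section KinkAlgebra.
Variables (X : Type) (B : psybracket X).

(** The top and the bottom region at the crossing of a kink coincide, and the
    loop lies on its left or on its right. So the color of the loop is an
    unknown first or third argument of a bracket. *)
Lemma kink_color s k a b :
  exists! r, oriented_rule B s s k a r a b.
Proof.
case: s; case: k => /=.
- by have [r [er ur]] := cbr_solve3 B b a a; exists r; split=> [|r' e]; rewrite ?er//; apply: ur.
- by have [r [er ur]] := cbr_solve3 B b a a; exists r; split=> [|r' e]; rewrite ?er//; apply: ur.
- by have [r [er ur]] := pbr_solve3 B b a; exists r; split=> [|r' e]; rewrite ?er//; apply: ur.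
- by have [r [er ur]] := cbr_solve1 B a b a; exists r; split=> [|r' e]; rewrite ?er//; apply: ur.
- by have [r [er ur]] := cbr_solve1 B a b a; exists r; split=> [|r' e]; rewrite ?er//; apply: ur.
- by have [r [er ur]] := pbr_solve1 B a b; exists r; split=> [|r' e]; rewrite ?er//; apply: ur.
Qed.

End KinkAlgebra.

Lemma add_kink_counting (X : finType) (B : psybracket X) P (K K' : diagram R) :
  add_kink P K K' -> counting_invariant B K = counting_invariant B K'.
Proof.
move=> [b [rep _]].
have [|||KT KT' out] := replaces_local (o := fun _ => b)
  straight_tangle_ok (kink_tangle_ok R) _ _ _ rep.
- by move=> e; case: (b); rewrite !inE.
- by move=> e; case: (b); rewrite /strand /= !inE; do 3 case: (e == _).
- do !apply: arc_cases; try exact: arc_none.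
  by split; left; apply/kink_drawing; on_drawing.
apply: (local_move straight_tangle_ok (kink_tangle_ok R) KT KT' out kink_overlay);
  split=> [c|c c1 c2].
- move=> _; have [r [er _]] := kink_color B b (kind K' (0, 1)) (c 0%N) (c 1%N).
  exists (fun i => if i == 2 then r else c i); first by move=> n [<-|[]].
  by move=> i j; rewrite !inE => /orP[] /eqP[-> ->].
- move=> _ r1 r2 m1 m2.
  (* Only the label 2 of the loop is not matched. *)
  have e0 := m1 0%N 0%N erefl; have e1 := m1 1%N 1%N erefl.
  have f0 := m2 0%N 0%N erefl; have f1 := m2 1%N 1%N erefl.
  case=> [|[|[|//]]] _; rewrite -?e0 -?e1 -?f0 -?f1//.
  have [r [_ ur]] := kink_color B b (kind K' (0, 1)) (c 0%N) (c 1%N).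
  have := r1 _ (or_introl erefl); have := r2 _ (or_introl erefl).
  by rewrite /node_rule /= -e0 -e1 -f0 -f1 => /ur <- /ur <-.
- move=> _; exists c => //; by move=> i j; rewrite !inE => /orP[] /eqP[-> ->].
- move=> _ _ _ m1 m2 [|[|//]] _.
  + by rewrite -(m1 0%N 0%N erefl) -(m2 0%N 0%N erefl).
  + by rewrite -(m1 1%N 1%N erefl) -(m2 1%N 1%N erefl).
Qed.

End KinkMove.

(** * Two strands forming a bigon *)

Section Bigon.
Variable R : realType.
Local Notation point := (R * R)%type.
Implicit Types (x y : point).

Definition parallel_tangle : tangle R := Tangle
  [:: (0%N, ((0, -2), (0, 2))); (1%N, ((1, -2), (1, 2)))]
  [:: polygon [:: (-1, 0, 0)]; polygon [:: (1, 0, 0); (-1, 0, 1)]; polygon [:: (1, 0, -1)]]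
  [::].

(** Face 4 is the bigon, faces 0 and 2 lie to the left and to the right of both
    strands, and faces 1 and 3 between the strands above and below. *)
Definition bigon_tangle : tangle R :=
  let s := (0%N, ((0, -2), (0, 2))) in
  let t1 := (1%N, ((1, -2), (-1, 0))) in
  let t2 := (1%N, ((-1, 0), (1, 2))) in
  Tangle [:: s; t1; t2]
  [:: polygon [:: (-1, 0, 0); (-1, 1, -1)] `|` polygon [:: (-1, 0, 0); (-1, -1, -1)];
      polygon [:: (1, 0, 0); (-1, 1, -1)];
      polygon [:: (1, 0, 0); (1, -1, 1); (1, 1, 1)];
      polygon [:: (1, 0, 0); (-1, -1, -1)];
      polygon [:: (-1, 0, 0); (1, -1, 1); (1, 1, 1)]]
  [:: Node (0, 1) t2 s 1%N 0%N 4%N 2%N; Node (0, -1) s t1 4%N 0%N 3%N 2%N].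

Lemma parallel_drawing x : drawing parallel_tangle x <->
  (-2 <= x.2 /\ x.2 <= 2) /\ (x.1 = 0 \/ x.1 = 1).
Proof.
rewrite /parallel_tangle !drawing_cons.
rewrite segment_ordinate /=; last by lra.
rewrite segment_ordinate /=; last by lra.
split=> [[[? ?]|[[? ?]|/drawing_nil//]]|[? [e|e]]].
- by split=> //; left; lra.
- by split=> //; right; lra.
- by left; split=> //; rewrite e; lra.
- by right; left; split=> //; rewrite e; lra.
Qed.

Lemma bigon_drawing x : drawing bigon_tangle x <->
  [\/ (-2 <= x.2 /\ x.2 <= 2) /\ x.1 = 0,
      (-2 <= x.2 /\ x.2 <= 0) /\ x.1 + x.2 + 1 = 0 |
      (0 <= x.2 /\ x.2 <= 2) /\ x.1 - x.2 + 1 = 0].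
Proof.
rewrite /bigon_tangle !drawing_cons.
do 3 (rewrite segment_ordinate /=; last by lra).
split=> [[[? ?]|[[? ?]|[[? ?]|/drawing_nil//]]]|[[? ?]|[? ?]|[? ?]]].
- by constructor 1; split=> //; lra.
- by constructor 2; split=> //; lra.
- by constructor 3; split=> //; lra.
- by left; split=> //; lra.
- by right; left; split=> //; lra.
- by right; right; left; split=> //; lra.
Qed.

Lemma parallel_disjoint i j x :
  face parallel_tangle i x -> face parallel_tangle j x -> i = j.
Proof.
wlog ij : i j / (i <= j)%N => [H fi fj|].
  by case/orP: (leq_total i j) => ij; [|apply/esym]; exact: H.
rewrite /face /=; move: ij.
case: i => [|[|[|i]]]; case: j => [|[|[|j]]] //= _;
  rewrite ?face_nil //; out_wedge.
Qed.

Lemma parallel_tangle_ok : tangle_ok parallel_tangle.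
Proof.
split=> //.
- do !apply: arc_cases; try exact: arc_none; split; in_square.
- move=> i; rewrite /face /=; case: i => [|[|[|i]]] /=;
    rewrite ?face_nil; try exact: open0; exact: polygon_open.
- move=> i; rewrite /face /=; case: i => [|[|[|i]]] /=;
    rewrite ?face_nil; try exact: connected0; exact: polygon_connected.
- case=> [|[|[|//]]] _; rewrite /face /=.
  + by exists (-1, 0); in_polygon.
  + by exists (1 / 2, 0); in_polygon.
  + by exists (3 / 2, 0); in_polygon.
- move=> i; rewrite /face /=; case: i => [|[|[|i]]] /=; rewrite ?face_nil //;
    apply: polygon_inside.
- move=> i x + /parallel_drawing; rewrite /face /=.
  by case: i => [|[|[|i]]] /=; rewrite ?face_nil //; out_wedge.
- exact: parallel_disjoint.
- move=> x [? ? ? ?]; rewrite parallel_drawing.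
  have [a|a|a] := ltgtP x.1 0.
  + by right; exists 0%N; in_polygon.
  + have [b|b|b] := ltgtP x.1 1.
    * by right; exists 1%N; in_polygon.
    * by right; exists 2%N; in_polygon.
    * by left; split; [split; lra|right].
  + by left; split; [split; lra|left].
- move=> a b x aT bT; move: a aT b bT; do !apply: arc_cases; try exact: arc_none;
  move=> /open_segmentE/=[t [? ? ? ?]] /open_segmentE/=[s [? ? ? ?]];
  by rewrite /det /dir !coordE /= => ?; exfalso; lra.
Qed.

Lemma bigon_cover x : open_square x ->
  drawing bigon_tangle x \/ exists i, face bigon_tangle i x.
Proof.
move=> [? ? ? ?]; rewrite bigon_drawing.
have [a|a|a] := ltgtP x.1 0; last by left; constructor 1; repeat split; lra.
- have [b|b|b] := ltgtP (x.1 + x.2 + 1) 0.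
  + by right; exists 0%N; right; in_polygon.
  + have [c|c|c] := ltgtP (x.1 - x.2 + 1) 0.
    * by right; exists 0%N; left; in_polygon.
    * by right; exists 4%N; in_polygon.
    * by left; constructor 3; repeat split; lra.
  + have [c|c] := leP x.2 0; first by left; constructor 2; repeat split; lra.
    by right; exists 0%N; left; in_polygon.
- have [b|b|b] := ltgtP (x.1 + x.2 + 1) 0.
  + by right; exists 3%N; in_polygon.
  + have [c|c|c] := ltgtP (x.1 - x.2 + 1) 0.
    * by right; exists 1%N; in_polygon.
    * by right; exists 2%N; in_polygon.
    * by left; constructor 3; repeat split; lra.
  + by left; constructor 2; repeat split; lra.
Qed.

Lemma bigon_nodes a b x : a \in arcs bigon_tangle -> b \in arcs bigon_tangle ->
  open_segment a.2 x -> open_segment b.2 x -> 0 < det (dir a.2) (dir b.2) ->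
  exists p q r s, List.In (Node x a b p q r s) (nodes bigon_tangle).
Proof.
move=> aT bT; move: a aT b bT; do !apply: arc_cases; try exact: arc_none;
  move=> /open_segmentE/=[t [? ? ? ?]] /open_segmentE/=[s [? ? ? ?]];
  rewrite /det /dir !coordE /= => ?; try (exfalso; lra).
- by exists 4%N, 0%N, 3%N, 2%N; right; left; congr Node; apply: point_eq => /=; lra.
- by exists 1%N, 0%N, 4%N, 2%N; left; congr Node; apply: point_eq => /=; lra.
Qed.

Lemma bigon_disjoint i j x :
  face bigon_tangle i x -> face bigon_tangle j x -> i = j.
Proof.
wlog ij : i j / (i <= j)%N => [H fi fj|].
  by case/orP: (leq_total i j) => ij; [|apply/esym]; exact: H.
rewrite /face /=; move: ij.
case: i => [|[|[|[|[|i]]]]]; case: j => [|[|[|[|[|j]]]]] //= _;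
  rewrite ?face_nil //; out_wedge.
Qed.

Lemma bigon_tangle_ok : tangle_ok bigon_tangle.
Proof.
split; last 2 first.
- exact: bigon_nodes.
- move=> x a b p q r s [|[|//]] [<- <- <- <- <- <- <-] u v; rewrite {}/u {}/v; split.
  + split; rewrite ?inE ?eqxx ?orbT//; first by rewrite /det /dir !coordE /=; lra.
    by split; [in_segment (1 / 2 : R)|in_segment (3 / 4 : R)|in_square].
  + by split; near_polygon.
  + split; rewrite ?inE ?eqxx ?orbT//; first by rewrite /det /dir !coordE /=; lra.
    by split; [in_segment (1 / 4 : R)|in_segment (1 / 2 : R)|in_square].
  + by split; near_polygon.
- do !apply: arc_cases; try exact: arc_none; split; in_square.
- move=> i; rewrite /face /=; case: i => [|[|[|[|[|i]]]]] /=;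
    rewrite ?face_nil; try exact: open0; do ?apply: openU; exact: polygon_open.
- move=> i; rewrite /face /=; case: i => [|[|[|[|[|i]]]]] /=;
    rewrite ?face_nil; try exact: connected0; try exact: polygon_connected.
  by apply: connectedU; [exists (-3 / 2, 0); split; in_polygon|exact: polygon_connected..].
- case=> [|[|[|[|[|//]]]]] _; rewrite /face /=.
  + by exists (-3 / 2, 0); left; in_polygon.
  + by exists (1 / 4, 3 / 2); in_polygon.
  + by exists (1, 0); in_polygon.
  + by exists (1 / 4, - (3 / 2)); in_polygon.
  + by exists (- (1 / 2), 0); in_polygon.
- by [].
- move=> i; rewrite /face /=; case: i => [|[|[|[|[|i]]]]] /=; rewrite ?face_nil //;
    do ?[apply: polygon_inside|rewrite subUset; split].
- move=> i x + /bigon_drawing; rewrite /face /=.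
  by case: i => [|[|[|[|[|i]]]]] /=; rewrite ?face_nil //; out_wedge.
- exact: bigon_disjoint.
- exact: bigon_cover.
Qed.

Definition finger : set point := closed_polygon [:: (-1, 0, 1); (1, -1, 1); (1, 1, 1)].

(** The middle region of the parallel strands overlaps with two regions after
    the move, the ones above and below the bigon. *)
Lemma finger_overlay : overlay parallel_tangle bigon_tangle finger
  [:: (0, 0); (1, 1); (1, 3); (2, 2)]%N.
Proof.
split.
- exact: closed_polygon_closed.
- rewrite /finger /closed_polygon /satisfies /affine_form /= => x [? [? [? _]]].
  by split; rewrite ler_norml; apply/andP; split; lra.
- move=> x; rewrite parallel_drawing bigon_drawing.
  rewrite /finger /closed_polygon /satisfies /affine_form /= => -[? [? [? _]]].
  have [a|a] := leP 2 x.2; last have [b|b] := leP x.2 (-2).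
  + by right; split; [split; [split; lra|right; lra]|constructor 3]; repeat split; lra.
  + by right; split; [split; [split; lra|right; lra]|constructor 2]; repeat split; lra.
  + by left; split; lra.
- move=> x nM; rewrite parallel_drawing bigon_drawing; split.
  + move=> [[? ?] [?|?]]; first by constructor 1.
    by exfalso; apply: nM; rewrite /finger; in_closed_polygon.
  + move=> [[? ?]|[? ?]|[? ?]]; first by split=> //; left.
      by exfalso; apply: nM; conjs; rewrite /finger; in_closed_polygon.
    by exfalso; apply: nM; conjs; rewrite /finger; in_closed_polygon.
- move=> x i j nM; rewrite /face /=.
  case: i => [|[|[|i]]] /=; case: j => [|[|[|[|[|j]]]]] /=; rewrite ?face_nil //;
    out_polygon; by exfalso; apply: nM; rewrite /finger; in_closed_polygon.
- move=> i j; rewrite !inE => /or4P[] /eqP[-> ->];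
    [exists (-3 / 2, 0)|exists (1 / 2, 7 / 4)|exists (1 / 2, - (7 / 4))|exists (3 / 2, 0)];
    (split; [rewrite /finger; out_closed_polygon|rewrite /face [nth _ _ _]/=; in_polygon
      |rewrite /face [nth _ _ _]/=; in_polygon]).
Qed.

Definition bigon : set point := closed_polygon [:: (-1, 0, 0); (1, -1, 1); (1, 1, 1)].

Lemma bigon_overlay : overlay bigon_tangle bigon_tangle bigon
  [:: (0, 0); (1, 1); (2, 2); (3, 3)]%N.
Proof.
split=> //.
- exact: closed_polygon_closed.
- rewrite /bigon /closed_polygon /satisfies /affine_form /= => x [? [? [? _]]].
  by split; rewrite ler_norml; apply/andP; split; lra.
- rewrite /bigon /closed_polygon /satisfies /affine_form /= => x [? [? [? _]]].
  by left; split; lra.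
- move=> x i j nM fi fj; have e := ok_disjoint bigon_tangle_ok fi fj; rewrite -e.
  have := face_bound fi; case: (i) fi => [|[|[|[|[|//]]]]] // fi _.
  exfalso; apply: nM; move: fi; clear e fj; rewrite /face /=; out_polygon.
  by rewrite /bigon; in_closed_polygon.
- move=> i j; rewrite !inE => /or4P[] /eqP[-> ->];
    [exists (-3 / 2, 0)|exists (1 / 2, 7 / 4)|exists (3 / 2, 0)|exists (1 / 2, - (7 / 4))];
    (split; [rewrite /bigon; out_closed_polygon|rewrite /face [nth _ _ _]/=; in_polygon
      |rewrite /face [nth _ _ _]/=; in_polygon]).
Qed.

End Bigon.

(** * The moves on a bigon *)

Section BigonAlgebra.
Variables (X : Type) (B : psybracket X).
Local Notation rule := (oriented_rule B).

Lemma oriented_rule_rotate s t k p q r m :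
  rule s t k p q r m = rule (~~ s) (~~ t) k r m p q.
Proof. by case: s; case: t. Qed.

Ltac solved H :=
  let d := fresh in let ed := fresh in let ud := fresh in
  have [d [ed ud]] := H; exists d; split=> [|d' ed']; rewrite ?ed//; apply: ud.

Lemma classical_rule_east s t k q r m : k <> Pre ->
  exists! p, rule s t k p q r m.
Proof.
case: k => // _; case: s; case: t => /=.
- by exists (cbr B m r q); split=> // p ->.
- by solved (cbr_solve3 B r q m).
- by solved (cbr_solve1 B m r q).
- by solved (cbr_solve2 B q m r).
- by solved (cbr_solve2 B m q r).
- by solved (cbr_solve3 B r m q).
- by solved (cbr_solve1 B q r m).
- by exists (cbr B q r m); split=> // p ->.
Qed.

Lemma classical_rule_west s t k p q m : k <> Pre ->
  exists! r, rule s t k p q r m.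
Proof.
move=> nk; have [r [er ur]] := classical_rule_east (~~ s) (~~ t) m p q nk.
exists r; split; first by rewrite oriented_rule_rotate.
by move=> r' er'; apply: ur; rewrite -oriented_rule_rotate.
Qed.

Definition opposite k := match k with Pos => Neg | Neg => Pos | Pre => Pre end.

(** The crossings at the two ends of a bigon are mirror images of each other:
    the strands come in the other order, the sign is opposite, and east and
    west are exchanged. Nevertheless the equation is the same, since the rule
    of a negative crossing is that of a positive one with top and bottom
    exchanged. *)
Lemma oriented_rule_mirror s t k p q r m : k <> Pre ->
  rule s t k p q r m -> rule t s (opposite k) r q p m.
Proof. by case: k => // _; case: s; case: t => /= ->. Qed.

(** The axiom [pbr_cbrC] settles the parallel orientations, up to the sign of
    the crossing and up to half a turn; the four antiparallel ones are
    instances of [antiparallel_twist]. *)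
Lemma slide_precrossing s t k a b b' c d : k <> Pre ->
  rule s t Pre b a d c -> rule t s k d a b' c ->
  exists2 d', rule s t k b a d' c & rule t s Pre d' a b' c.
Proof.
have tw : twistable B (graph (pbr B)) by exact: pbr_twistable.
have qO := over_quasigroup B.
have tw' : twistable B (flip4 (graph (pbr B))) by exact: twistable_flip.
have sU : slides (under_edge B) (graph (pbr B)) by exact: pbr_under_slides.
have sU' : slides (under_edge B) (flip4 (graph (pbr B))).
  by apply: slides_flip => //; exact: under_quasigroup.
have sO : slides (reverse (over_edge B)) (graph (pbr B)).
  by apply: slides_reverse => //; exact: pbr_over_slides.
have sO' : slides (reverse (over_edge B)) (flip4 (graph (pbr B))).
  by apply: slides_flip => //; exact: reverse_quasigroup.
case: k => // _; case: s; case: t => /= e1 e2.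
- exists (pbr B c b' a) => //.
  by rewrite e1 e2 pbr_cbrC.
- have [d' [ed' _]] := cbr_solve1 B a b c; exists d' => //.
  exact: (antiparallel_twist (W := flip4 (graph (pbr B))) tw' sU' sO'
    e1 (esym ed') e2).
- have [d' [ed' _]] := cbr_solve3 B b c a; exists d' => //.
  exact: (antiparallel_twist (W := graph (pbr B)) tw sU sO
    e1 e2 (esym ed')).
- by exists (cbr B a b c) => //; rewrite e2 e1 pbr_cbrC.
- by exists (cbr B c b a) => //; rewrite e2 e1 pbr_cbrC.
- have [d' [ed' _]] := cbr_solve1 B c b a; exists d' => //.
  exact: (antiparallel_twist (W := graph (pbr B)) tw sU sO
    e1 (esym ed') e2).
- have [d' [ed' _]] := cbr_solve3 B b a c; exists d' => //.
  exact: (antiparallel_twist (W := flip4 (graph (pbr B))) tw' sU' sO'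
    e1 e2 (esym ed')).
- have [d' [ed' _]] := cbr_solve2 B a c b; exists d' => //.
  by apply: (@cbr_inj2 X B a c); rewrite -e2 e1 -pbr_cbrC ed'.
Qed.

(** Turning the picture by half a turn exchanges the two crossings. *)
Lemma slide_precrossing_back s t k a b b' c d : k <> Pre ->
  rule s t k b a d c -> rule t s Pre d a b' c ->
  exists2 d', rule s t Pre b a d' c & rule t s k d' a b' c.
Proof.
move=> nk; rewrite oriented_rule_rotate => e1; rewrite oriented_rule_rotate => e2.
have [d' f1 f2] := slide_precrossing nk e2 e1.
by exists d'; rewrite oriented_rule_rotate.
Qed.

End BigonAlgebra.

Section BigonMoves.
Variable R : realType.
Variables (X : finType) (B : psybracket X).
Implicit Types (K : diagram R).

Definition two_strands (o1 o2 : bool) (i : nat) := if i is 0%N then o1 else o2.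

Lemma vertical_bent_orient o1 o2 :
  strand o1 (vertical_arc R) ++ strand o2 (bent_arc R)
  =i orient (two_strands o1 o2) (bigon_tangle R).
Proof.
move=> e; case: o1; case: o2; rewrite /strand /= !inE //;
  by do 3 case: (e == _).
Qed.

Lemma vertical_parallel_orient o1 o2 :
  strand o1 (vertical_arc R) ++ strand o2 (parallel_arc R)
  =i orient (two_strands o1 o2) (parallel_tangle R).
Proof. by move=> e; case: o1; case: o2; rewrite /strand /= !inE. Qed.

Lemma bigon_rules o1 o2 (k : R * R -> crossing_kind) (c : nat -> X) :
  tangle_rule B (two_strands o1 o2) k c (bigon_tangle R) <->
  oriented_rule B o2 o1 (k (0, 1)) (c 1%N) (c 0%N) (c 4%N) (c 2%N) /\
  oriented_rule B o1 o2 (k (0, -1)) (c 4%N) (c 0%N) (c 3%N) (c 2%N).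
Proof.
split=> [H|[H1 H2] n [<-|[<-|[]]]] //.
by split; [exact: H _ (or_introl erefl)|exact: H _ (or_intror (or_introl erefl))].
Qed.

Lemma passes_over_kind K S T e f x : passes_over K S T -> e \in S -> f \in T ->
  open_segment e x -> open_segment f x ->
  (0 < det (dir e) (dir f) -> kind K x = Pos) /\
  (det (dir e) (dir f) < 0 -> kind K x = Neg).
Proof.
move=> po eS fT ex fx; rewrite (po e f x eS fT ex fx).
by split=> [->//|d]; rewrite ltNge ltW.
Qed.

(** The crossings of the two strands at the two ends of the bigon have opposite
    signs, the same strand being over at both. *)
Lemma RII_kinds K o1 o2 :
  passes_over K (strand o1 (vertical_arc R)) (strand o2 (bent_arc R)) \/
  passes_over K (strand o2 (bent_arc R)) (strand o1 (vertical_arc R)) ->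
  kind K (0, 1) <> Pre /\ kind K (0, -1) = opposite (kind K (0, 1)).
Proof.
pose s : R * R * (R * R) := orient_edge o1 ((0, -2), (0, 2)).
pose t1 : R * R * (R * R) := orient_edge o2 ((1, -2), (-1, 0)).
pose t2 : R * R * (R * R) := orient_edge o2 ((-1, 0), (1, 2)).
have sS : s \in strand o1 (vertical_arc R).
  by rewrite /s; case: (o1); rewrite /strand /= !inE eqxx.
have t1T : t1 \in strand o2 (bent_arc R).
  by rewrite /t1; case: (o2); rewrite /strand /= !inE eqxx ?orbT.
have t2T : t2 \in strand o2 (bent_arc R).
  by rewrite /t2; case: (o2); rewrite /strand /= !inE eqxx ?orbT.
have s1 : open_segment s (0, 1) by apply/open_segment_orient; in_segment (3 / 4 : R).
have s2 : open_segment s (0, -1) by apply/open_segment_orient; in_segment (1 / 4 : R).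
have t21 : open_segment t2 (0, 1) by apply/open_segment_orient; in_segment (1 / 2 : R).
have t12 : open_segment t1 (0, -1) by apply/open_segment_orient; in_segment (1 / 2 : R).
move=> [po|po].
- have [p1 n1] := passes_over_kind po sS t2T s1 t21.
  have [p2 n2] := passes_over_kind po sS t1T s2 t12.
  move: p1 n1 p2 n2; rewrite /s /t1 /t2 !dir_orient /det /dir.
  case: (o1); case: (o2); rewrite !coordE /= => p1 n1 p2 n2;
  by (rewrite p1 1?n2; [|lra..]) || (rewrite n1 1?p2; [|lra..]).
- have [p1 n1] := passes_over_kind po t2T sS t21 s1.
  have [p2 n2] := passes_over_kind po t1T sS t12 s2.
  move: p1 n1 p2 n2; rewrite /s /t1 /t2 !dir_orient /det /dir.
  case: (o1); case: (o2); rewrite !coordE /= => p1 n1 p2 n2;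
  by (rewrite p1 1?n2; [|lra..]) || (rewrite n1 1?p2; [|lra..]).
Qed.

(** The two crossings impose the same relation between the bigon, the outer
    regions, and the region above, respectively below, the bigon: these two
    must have the same color, and any such color determines the bigon. *)
Lemma RII_counting K K' : move_RII K K' ->
  counting_invariant B K = counting_invariant B K'.
Proof.
move=> [s [t [rep po]]].
have [nk ek] := RII_kinds po; move: nk ek; set k := kind K' (0, 1) => nk ek.
have [|KT KT' out] := replaces_local (@parallel_tangle_ok R) (@bigon_tangle_ok R)
  (@vertical_parallel_orient s t) (@vertical_bent_orient s t) _ rep.
  do !apply: arc_cases; try exact: arc_none; split; left; apply/bigon_drawing; on_drawing.
have rules c : tangle_rule B (two_strands s t) (kind K') c (bigon_tangle R) <->
  oriented_rule B t s k (c 1%N) (c 0%N) (c 4%N) (c 2%N) /\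
  oriented_rule B t s k (c 3%N) (c 0%N) (c 4%N) (c 2%N).
  rewrite bigon_rules ek -/k.
  split=> -[r1 r2]; split=> //; last exact: oriented_rule_mirror.
  have := oriented_rule_mirror _ r2; rewrite (_ : opposite (opposite k) = k); last by case: (k).
  by apply; move: nk; case: (k).
apply: (local_move (@parallel_tangle_ok R) (@bigon_tangle_ok R) KT KT' out
  (@finger_overlay R)); split=> [c|c c1 c2].
- move=> _.
  have [d [ed _]] := classical_rule_west B t s (c 1%N) (c 0%N) (c 2%N) nk.
  (* The regions 1 and 3 above and below the bigon were one region. *)
  exists (fun i => match i with 3%N => c 1%N | 4%N => d | _ => c i end).
    exact/rules.
  by move=> i j; rewrite !inE => /or4P[] /eqP[-> ->].
- move=> _ /rules[r1 _] /rules[r2 _] m1 m2.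
  have [d [_ ud]] := classical_rule_west B t s (c 1%N) (c 0%N) (c 2%N) nk.
  case=> [|[|[|[|[|//]]]]] _.
  + by rewrite -(m1 0%N 0%N erefl) -(m2 0%N 0%N erefl).
  + by rewrite -(m1 1%N 1%N erefl) -(m2 1%N 1%N erefl).
  + by rewrite -(m1 2%N 2%N erefl) -(m2 2%N 2%N erefl).
  + by rewrite -(m1 1%N 3%N erefl) -(m2 1%N 3%N erefl).
  + rewrite -(ud (c1 4%N)); first rewrite -(ud (c2 4%N)) //.
      by rewrite (m2 1%N 1%N erefl) (m2 0%N 0%N erefl) (m2 2%N 2%N erefl).
    by rewrite (m1 1%N 1%N erefl) (m1 0%N 0%N erefl) (m1 2%N 2%N erefl).
- move=> /rules[r1 r2]; exists c => //.
  have [p [_ up]] := classical_rule_east B t s (c 0%N) (c 4%N) (c 2%N) nk.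
  by move=> i j; rewrite !inE => /or4P[] /eqP[-> ->] //; rewrite -(up _ r1) -(up _ r2).
- move=> _ _ _ m1 m2 [|[|[|//]]] _.
  + by rewrite -(m1 0%N 0%N erefl) -(m2 0%N 0%N erefl).
  + by rewrite -(m1 1%N 1%N erefl) -(m2 1%N 1%N erefl).
  + by rewrite -(m1 2%N 2%N erefl) -(m2 2%N 2%N erefl).
Qed.

(** The bigon is the only region whose color changes, and the classical
    crossing determines it both before and after the move. *)
Lemma PII_counting K K' : move_PII K K' ->
  counting_invariant B K = counting_invariant B K'.
Proof.
move=> [s [t [rep k2 k1 k2' k1']]].
move: k2 k1'; set k := kind K (0, -1) => nk k1'.
have [|KT KT' out] := replaces_local (@bigon_tangle_ok R) (@bigon_tangle_ok R)
  (@vertical_bent_orient s t) (@vertical_bent_orient s t) _ rep.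
  do !apply: arc_cases; try exact: arc_none; split; left; apply/bigon_drawing; on_drawing.
have rules c := bigon_rules s t (kind K) c.
have rules' c := bigon_rules s t (kind K') c.
apply: (local_move (@bigon_tangle_ok R) (@bigon_tangle_ok R) KT KT' out
  (@bigon_overlay R)); split=> [c|c c1 c2].
- move=> /rules[]; rewrite k1 -/k => r1 r2.
  have [d' r1' r2'] := slide_precrossing nk r1 r2.
  exists (fun i => if i == 4%N then d' else c i).
    by apply/rules'; rewrite k1' k2'.
  by move=> i j; rewrite !inE => /or4P[] /eqP[-> ->].
- move=> _ /rules'[+ _] /rules'[+ _]; rewrite k1' => r1 r2 m1 m2.
  have [d [_ ud]] := classical_rule_west B t s (c 1%N) (c 0%N) (c 2%N) nk.
  case=> [|[|[|[|[|//]]]]] _.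
  + by rewrite -(m1 0%N 0%N erefl) -(m2 0%N 0%N erefl).
  + by rewrite -(m1 1%N 1%N erefl) -(m2 1%N 1%N erefl).
  + by rewrite -(m1 2%N 2%N erefl) -(m2 2%N 2%N erefl).
  + by rewrite -(m1 3%N 3%N erefl) -(m2 3%N 3%N erefl).
  + rewrite -(ud (c1 4%N)); first rewrite -(ud (c2 4%N)) //.
      by rewrite (m2 1%N 1%N erefl) (m2 0%N 0%N erefl) (m2 2%N 2%N erefl).
    by rewrite (m1 1%N 1%N erefl) (m1 0%N 0%N erefl) (m1 2%N 2%N erefl).
- move=> /rules'[]; rewrite k1' k2' => r1 r2.
  have [d' r1' r2'] := slide_precrossing_back nk r1 r2.
  exists (fun i => if i == 4%N then d' else c i).
    by apply/rules; rewrite k1 -/k.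
  by move=> i j; rewrite !inE => /or4P[] /eqP[-> ->].
- move=> _ /rules[_ +] /rules[_ +]; rewrite -/k => r1 r2 m1 m2.
  have [d [_ ud]] := classical_rule_east B s t (c 0%N) (c 3%N) (c 2%N) nk.
  case=> [|[|[|[|[|//]]]]] _.
  + by rewrite -(m1 0%N 0%N erefl) -(m2 0%N 0%N erefl).
  + by rewrite -(m1 1%N 1%N erefl) -(m2 1%N 1%N erefl).
  + by rewrite -(m1 2%N 2%N erefl) -(m2 2%N 2%N erefl).
  + by rewrite -(m1 3%N 3%N erefl) -(m2 3%N 3%N erefl).
  + rewrite -(ud (c1 4%N)); first rewrite -(ud (c2 4%N)) //.
      by rewrite (m2 3%N 3%N erefl) (m2 0%N 0%N erefl) (m2 2%N 2%N erefl).
    by rewrite (m1 3%N 3%N erefl) (m1 0%N 0%N erefl) (m1 2%N 2%N erefl).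
Qed.

End BigonMoves.

(** * A strand below a double point *)

Section TriangleLow.
Variable R : realType.
Local Notation point := (R * R)%type.
Implicit Types (x y : point).

(** Faces 0 to 5 are the six outer regions and face 6 is the triangle; 0, 1 and
    2 are the top, left and right regions, 3, 4 and 5 the lower ones from left
    to right. *)
Definition low_tangle : tangle R :=
  let d := (0%N, ((-1, -2), (1, 2))) in
  let a := (1%N, ((1, -2), (-1, 2))) in
  let m1 := (2%N, ((-2, 0), (0, - (4 / 3)))) in
  let m2 := (2%N, ((0, - (4 / 3)), (2, 0))) in
  Tangle [:: d; a; m1; m2]
  [:: polygon [:: (-2, 1, 0); (2, 1, 0)];
      polygon [:: (-2, -1, 0); (-2, 1, 0); (2, 3, 4)];
      polygon [:: (2, -1, 0); (2, 1, 0); (-2, 3, 4)];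
      polygon [:: (-2, 1, 0); (-2, -3, -4)];
      polygon [:: (2, -1, 0); (-2, -1, 0); (-2, -3, -4)] `|`
      polygon [:: (2, -1, 0); (-2, -1, 0); (2, -3, -4)];
      polygon [:: (2, 1, 0); (2, -3, -4)];
      polygon [:: (2, -1, 0); (-2, -1, 0); (2, 3, 4); (-2, 3, 4)]]
  [:: Node (0, 0) d a 0%N 1%N 6%N 2%N;
      Node (- (1 / 2), -1) m1 d 6%N 1%N 3%N 4%N;
      Node (1 / 2, -1) m2 a 2%N 6%N 4%N 5%N].

Lemma low_drawing x : drawing low_tangle x <->
  [\/ (-2 <= x.2 /\ x.2 <= 2) /\ x.2 - 2 * x.1 = 0,
      (-2 <= x.2 /\ x.2 <= 2) /\ x.2 + 2 * x.1 = 0,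
      (-2 <= x.1 /\ x.1 <= 0) /\ 2 * x.1 + 3 * x.2 + 4 = 0 |
      (0 <= x.1 /\ x.1 <= 2) /\ - 2 * x.1 + 3 * x.2 + 4 = 0].
Proof.
rewrite /low_tangle !drawing_cons.
do 2 (rewrite segment_ordinate /=; last by lra).
do 2 (rewrite segment_abscissa /=; last by lra).
split=> [[[? ?]|[[? ?]|[[? ?]|[[? ?]|/drawing_nil//]]]]|[[? ?]|[? ?]|[? ?]|[? ?]]].
- by constructor 1; split=> //; lra.
- by constructor 2; split=> //; lra.
- by constructor 3; split=> //; lra.
- by constructor 4; split=> //; lra.
- by left; split=> //; lra.
- by right; left; split=> //; lra.
- by right; right; left; split=> //; lra.
- by right; right; right; left; split=> //; lra.
Qed.

Lemma low_cover x : open_square x ->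
  drawing low_tangle x \/ exists i, face low_tangle i x.
Proof.
move=> [? ? ? ?]; rewrite low_drawing.
have [a|a|a] := ltgtP (x.2 - 2 * x.1) 0; last by left; constructor 1; repeat split; lra.
all: have [b|b|b] := ltgtP (x.2 + 2 * x.1) 0; try by left; constructor 2; repeat split; lra.
- have [c|c] := leP x.1 0.
    have [e|e|e] := ltgtP (2 * x.1 + 3 * x.2 + 4) 0.
    + by right; exists 4%N; left; in_polygon.
    + by right; exists 6%N; in_polygon.
    + by left; constructor 3; repeat split; lra.
  have [e|e|e] := ltgtP (- 2 * x.1 + 3 * x.2 + 4) 0.
  + by right; exists 4%N; right; in_polygon.
  + by right; exists 6%N; in_polygon.
  + by left; constructor 4; repeat split; lra.
- have [e|e|e] := ltgtP (- 2 * x.1 + 3 * x.2 + 4) 0.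
  + by right; exists 5%N; in_polygon.
  + by right; exists 2%N; in_polygon.
  + by left; constructor 4; repeat split; lra.
- have [e|e|e] := ltgtP (2 * x.1 + 3 * x.2 + 4) 0.
  + by right; exists 3%N; in_polygon.
  + by right; exists 1%N; in_polygon.
  + by left; constructor 3; repeat split; lra.
- by right; exists 0%N; in_polygon.
Qed.

Lemma low_nodes a b x : a \in arcs low_tangle -> b \in arcs low_tangle ->
  open_segment a.2 x -> open_segment b.2 x -> 0 < det (dir a.2) (dir b.2) ->
  exists p q r s, List.In (Node x a b p q r s) (nodes low_tangle).
Proof.
move=> aT bT; move: a aT b bT; do !apply: arc_cases; try exact: arc_none;
  move=> /open_segmentE/=[t [? ? ? ?]] /open_segmentE/=[s [? ? ? ?]];
  rewrite /det /dir !coordE /= => ?; try (exfalso; lra); do 4 eexists;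
  first [ by left; congr Node; apply: point_eq => /=; lra
        | by right; left; congr Node; apply: point_eq => /=; lra
        | by right; right; left; congr Node; apply: point_eq => /=; lra ].
Qed.

Lemma low_disjoint i j x :
  face low_tangle i x -> face low_tangle j x -> i = j.
Proof.
wlog ij : i j / (i <= j)%N => [H fi fj|].
  by case/orP: (leq_total i j) => ij; [|apply/esym]; exact: H.
rewrite /face /=; move: ij.
case: i => [|[|[|[|[|[|[|i]]]]]]]; case: j => [|[|[|[|[|[|[|j]]]]]]] //= _;
    rewrite ?face_nil //; out_wedge.
Qed.

Lemma low_tangle_ok : tangle_ok low_tangle.
Proof.
split; last 2 first.
- exact: low_nodes.
- move=> x a b p q r s [|[|[|//]]] [<- <- <- <- <- <- <-] u v; rewrite {}/u {}/v; split.
  + split; rewrite ?inE ?eqxx ?orbT//; first by rewrite /det /dir !coordE /=; lra.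
    by split; [in_segment (1 / 2 : R)|in_segment (1 / 2 : R)|in_square].
  + by split; near_polygon.
  + split; rewrite ?inE ?eqxx ?orbT//; first by rewrite /det /dir !coordE /=; lra.
    by split; [in_segment (3 / 4 : R)|in_segment (1 / 4 : R)|in_square].
  + by split; near_polygon.
  + split; rewrite ?inE ?eqxx ?orbT//; first by rewrite /det /dir !coordE /=; lra.
    by split; [in_segment (1 / 4 : R)|in_segment (1 / 4 : R)|in_square].
  + by split; near_polygon.
- do !apply: arc_cases; try exact: arc_none; split; in_square.
- move=> i; rewrite /face /=; case: i => [|[|[|[|[|[|[|i]]]]]]] /=;
    rewrite ?face_nil; try exact: open0; do ?apply: openU; exact: polygon_open.
- move=> i; rewrite /face /=; case: i => [|[|[|[|[|[|[|i]]]]]]] /=;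
    rewrite ?face_nil; try exact: connected0; try exact: polygon_connected.
  by apply: connectedU; [exists (0, - (3 / 2)); split; in_polygon|exact: polygon_connected..].
- case=> [|[|[|[|[|[|[|//]]]]]]] _; rewrite /face /=;
    [exists (0, 1)|exists (-1, 0)|exists (1, 0)|exists (-3 / 2, -1)
    |exists (0, - (3 / 2))|exists (3 / 2, -1)|exists (0, -1)]; in_polygon.
- by [].
- move=> i; rewrite /face /=; case: i => [|[|[|[|[|[|[|i]]]]]]] /=; rewrite ?face_nil //;
    do ?[apply: polygon_inside|rewrite subUset; split].
- move=> i x + /low_drawing; rewrite /face /=.
  by case: i => [|[|[|[|[|[|[|i]]]]]]] /=; rewrite ?face_nil //; out_wedge.
- exact: low_disjoint.
- exact: low_cover.
Qed.

End TriangleLow.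

(** * A strand above a double point *)

Section TriangleHigh.
Variable R : realType.
Local Notation point := (R * R)%type.
Implicit Types (x y : point).

(** The outer regions are numbered as in [low_tangle]. *)
Definition high_tangle : tangle R :=
  let d := (0%N, ((-1, -2), (1, 2))) in
  let a := (1%N, ((1, -2), (-1, 2))) in
  let m1 := (2%N, ((-2, 0), (0, 4 / 3))) in
  let m2 := (2%N, ((0, 4 / 3), (2, 0))) in
  Tangle [:: d; a; m1; m2]
  [:: polygon [:: (-2, 1, 0); (2, 1, 0); (-2, 3, -4)] `|`
      polygon [:: (-2, 1, 0); (2, 1, 0); (2, 3, -4)];
      polygon [:: (-2, -1, 0); (-2, 3, -4)];
      polygon [:: (2, -1, 0); (2, 3, -4)];
      polygon [:: (-2, 1, 0); (-2, -1, 0); (2, -3, 4)];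
      polygon [:: (2, -1, 0); (-2, -1, 0)];
      polygon [:: (2, 1, 0); (2, -1, 0); (-2, -3, 4)];
      polygon [:: (2, 1, 0); (-2, 1, 0); (2, -3, 4); (-2, -3, 4)]]
  [:: Node (0, 0) d a 6%N 3%N 4%N 5%N;
      Node (- (1 / 2), 1) m1 a 0%N 1%N 3%N 6%N;
      Node (1 / 2, 1) m2 d 2%N 0%N 6%N 5%N].

Lemma high_drawing x : drawing high_tangle x <->
  [\/ (-2 <= x.2 /\ x.2 <= 2) /\ x.2 - 2 * x.1 = 0,
      (-2 <= x.2 /\ x.2 <= 2) /\ x.2 + 2 * x.1 = 0,
      (-2 <= x.1 /\ x.1 <= 0) /\ - 2 * x.1 + 3 * x.2 - 4 = 0 |
      (0 <= x.1 /\ x.1 <= 2) /\ 2 * x.1 + 3 * x.2 - 4 = 0].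
Proof.
rewrite /high_tangle !drawing_cons.
do 2 (rewrite segment_ordinate /=; last by lra).
do 2 (rewrite segment_abscissa /=; last by lra).
split=> [[[? ?]|[[? ?]|[[? ?]|[[? ?]|/drawing_nil//]]]]|[[? ?]|[? ?]|[? ?]|[? ?]]].
- by constructor 1; split=> //; lra.
- by constructor 2; split=> //; lra.
- by constructor 3; split=> //; lra.
- by constructor 4; split=> //; lra.
- by left; split=> //; lra.
- by right; left; split=> //; lra.
- by right; right; left; split=> //; lra.
- by right; right; right; left; split=> //; lra.
Qed.

Lemma high_cover x : open_square x ->
  drawing high_tangle x \/ exists i, face high_tangle i x.
Proof.
move=> [? ? ? ?]; rewrite high_drawing.
have [a|a|a] := ltgtP (x.2 - 2 * x.1) 0; last by left; constructor 1; repeat split; lra.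
all: have [b|b|b] := ltgtP (x.2 + 2 * x.1) 0; try by left; constructor 2; repeat split; lra.
- by right; exists 4%N; in_polygon.
- have [e|e|e] := ltgtP (2 * x.1 + 3 * x.2 - 4) 0.
  + by right; exists 5%N; in_polygon.
  + by right; exists 2%N; in_polygon.
  + by left; constructor 4; repeat split; lra.
- have [e|e|e] := ltgtP (- 2 * x.1 + 3 * x.2 - 4) 0.
  + by right; exists 3%N; in_polygon.
  + by right; exists 1%N; in_polygon.
  + by left; constructor 3; repeat split; lra.
- have [c|c] := leP x.1 0.
    have [e|e|e] := ltgtP (- 2 * x.1 + 3 * x.2 - 4) 0.
    + by right; exists 6%N; in_polygon.
    + by right; exists 0%N; left; in_polygon.
    + by left; constructor 3; repeat split; lra.
  have [e|e|e] := ltgtP (2 * x.1 + 3 * x.2 - 4) 0.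
  + by right; exists 6%N; in_polygon.
  + by right; exists 0%N; right; in_polygon.
  + by left; constructor 4; repeat split; lra.
Qed.

Lemma high_nodes a b x : a \in arcs high_tangle -> b \in arcs high_tangle ->
  open_segment a.2 x -> open_segment b.2 x -> 0 < det (dir a.2) (dir b.2) ->
  exists p q r s, List.In (Node x a b p q r s) (nodes high_tangle).
Proof.
move=> aT bT; move: a aT b bT; do !apply: arc_cases; try exact: arc_none;
  move=> /open_segmentE/=[t [? ? ? ?]] /open_segmentE/=[s [? ? ? ?]];
  rewrite /det /dir !coordE /= => ?; try (exfalso; lra); do 4 eexists;
  first [ by left; congr Node; apply: point_eq => /=; lra
        | by right; left; congr Node; apply: point_eq => /=; lra
        | by right; right; left; congr Node; apply: point_eq => /=; lra ].
Qed.

Lemma high_disjoint i j x :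
  face high_tangle i x -> face high_tangle j x -> i = j.
Proof.
wlog ij : i j / (i <= j)%N => [H fi fj|].
  by case/orP: (leq_total i j) => ij; [|apply/esym]; exact: H.
rewrite /face /=; move: ij.
case: i => [|[|[|[|[|[|[|i]]]]]]]; case: j => [|[|[|[|[|[|[|j]]]]]]] //= _;
    rewrite ?face_nil //; out_wedge.
Qed.

Lemma high_tangle_ok : tangle_ok high_tangle.
Proof.
split; last 2 first.
- exact: high_nodes.
- move=> x a b p q r s [|[|[|//]]] [<- <- <- <- <- <- <-] u v; rewrite {}/u {}/v; split.
  + split; rewrite ?inE ?eqxx ?orbT//; first by rewrite /det /dir !coordE /=; lra.
    by split; [in_segment (1 / 2 : R)|in_segment (1 / 2 : R)|in_square].
  + by split; near_polygon.
  + split; rewrite ?inE ?eqxx ?orbT//; first by rewrite /det /dir !coordE /=; lra.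
    by split; [in_segment (3 / 4 : R)|in_segment (3 / 4 : R)|in_square].
  + by split; near_polygon.
  + split; rewrite ?inE ?eqxx ?orbT//; first by rewrite /det /dir !coordE /=; lra.
    by split; [in_segment (1 / 4 : R)|in_segment (3 / 4 : R)|in_square].
  + by split; near_polygon.
- do !apply: arc_cases; try exact: arc_none; split; in_square.
- move=> i; rewrite /face /=; case: i => [|[|[|[|[|[|[|i]]]]]]] /=;
    rewrite ?face_nil; try exact: open0; do ?apply: openU; exact: polygon_open.
- move=> i; rewrite /face /=; case: i => [|[|[|[|[|[|[|i]]]]]]] /=;
    rewrite ?face_nil; try exact: connected0; try exact: polygon_connected.
  by apply: connectedU; [exists (0, 3 / 2); split; in_polygon|exact: polygon_connected..].
- case=> [|[|[|[|[|[|[|//]]]]]]] _; rewrite /face /=;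
    [exists (0, 3 / 2)|exists (-3 / 2, 1)|exists (3 / 2, 1)|exists (-1, 0)
    |exists (0, -1)|exists (1, 0)|exists (0, 1)]; in_polygon.
- by [].
- move=> i; rewrite /face /=; case: i => [|[|[|[|[|[|[|i]]]]]]] /=; rewrite ?face_nil //;
    do ?[apply: polygon_inside|rewrite subUset; split].
- move=> i x + /high_drawing; rewrite /face /=.
  by case: i => [|[|[|[|[|[|[|i]]]]]]] /=; rewrite ?face_nil //; out_wedge.
- exact: high_disjoint.
- exact: high_cover.
Qed.

End TriangleHigh.

(** * The moves on a triangle *)

Section TriangleAlgebra.
Variables (X : Type) (B : psybracket X).
Local Notation rule := (oriented_rule B).

Definition edge_rule (over : bool) : rel4 X :=
  if over then over_edge B else under_edge B.

Lemma edge_rule_quasigroup v : quasigroup (edge_rule v).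
Proof. by case: v; [exact: over_quasigroup|exact: under_quasigroup]. Qed.

(** The axioms give the forward passage across a positive crossing and across a
    precrossing. The backward passages follow by [slides_reverse], and those
    across a negative crossing by [slides_flip]. *)
Lemma crossing_rule_slides v (rev : bool) k :
  slides (if rev then reverse (edge_rule v) else edge_rule v) (crossing_rule B k).
Proof.
have cS w : slides (edge_rule v) (graph w) ->
    slides (if rev then reverse (edge_rule v) else edge_rule v) (graph w).
  by case: rev => //; apply: slides_reverse; exact: edge_rule_quasigroup.
have qE : quasigroup (if rev then reverse (edge_rule v) else edge_rule v).
  by case: rev {cS}; [apply: reverse_quasigroup|]; exact: edge_rule_quasigroup.
have sc : slides (edge_rule v) (graph (cbr B)).
  by case: v {cS qE}; [exact: cbr_over_slides|exact: cbr_under_slides].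
have sp : slides (edge_rule v) (graph (pbr B)).
  by case: v {cS qE sc}; [exact: pbr_over_slides|exact: pbr_under_slides].
case: k; [exact: cS|exact: (slides_flip qE (cS _ sc))|exact: cS].
Qed.

(** The sign of the crossing of a strand of orientation [m] over (or under, when
    [v] is false) a strand of orientation [s], for reference directions that
    form, in this order, a positive basis. *)
Definition strand_kind (v m s : bool) := if v (+) (m (+) s) then Pos else Neg.

Ltac found sliding :=
  let z := fresh in have [z [? ? ?]] := sliding; by exists z.
Ltac slide q s w e1 e2 :=
  first [ found (slides_left q s w e1 e2) | found (slides_right q s w e1 e2)
        | found (slides_top q s w e1 e2) | found (slides_bottom q s w e1 e2) ].
Ltac slide_from_any_side q0 s0 q1 s1 w e1 e2 :=
  first [ slide q0 s0 w e1 e2 | slide q0 s0 w e2 e1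
        | slide q1 s1 w e1 e2 | slide q1 s1 w e2 e1 ].

(** Which of the four lemmas on [slides] applies depends on the orientations of
    the strands: turning the double point so that its strands go downward puts
    the moving strand on one of its four sides. *)
Lemma slide_up v s t m k c0 c1 c2 c3 c4 c5 i :
  rule s t k c0 c1 i c2 -> rule m s (strand_kind v m s) i c1 c3 c4 ->
  rule m t (strand_kind v m t) c2 i c4 c5 ->
  exists j, [/\ rule s t k j c3 c4 c5, rule m t (strand_kind v m t) c0 c1 c3 j
    & rule m s (strand_kind v m s) c2 c0 j c5].
Proof.
have s0 := @crossing_rule_slides v false k; have s1 := @crossing_rule_slides v true k.
have q0 := edge_rule_quasigroup v; have q1 := reverse_quasigroup q0.
move: s0 s1 q0 q1.
case: v; case: m; case: s; case: t; rewrite /strand_kind /= => s0 s1 q0 q1 w e1 e2;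
slide_from_any_side q0 s0 q1 s1 w e1 e2.
Qed.

Lemma slide_down v s t m k c0 c1 c2 c3 c4 c5 j :
  rule s t k j c3 c4 c5 -> rule m t (strand_kind v m t) c0 c1 c3 j ->
  rule m s (strand_kind v m s) c2 c0 j c5 ->
  exists i, [/\ rule s t k c0 c1 i c2, rule m s (strand_kind v m s) i c1 c3 c4
    & rule m t (strand_kind v m t) c2 i c4 c5].
Proof.
have s0 := @crossing_rule_slides v false k; have s1 := @crossing_rule_slides v true k.
have q0 := edge_rule_quasigroup v; have q1 := reverse_quasigroup q0.
move: s0 s1 q0 q1.
case: v; case: m; case: s; case: t; rewrite /strand_kind /= => s0 s1 q0 q1 w e1 e2;
slide_from_any_side q0 s0 q1 s1 w e1 e2.
Qed.

Lemma strand_kind_classical v m s : strand_kind v m s <> Pre.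
Proof. by rewrite /strand_kind; case: ifP. Qed.

End TriangleAlgebra.

Section TriangleMove.
Variable R : realType.
Local Notation point := (R * R)%type.
Implicit Types (x y : point) (K : diagram R).

(** The area between the low and the high arc. All labels but that of the
    triangle, number 6, are matched with themselves. *)
Definition diamond : set point :=
  closed_polygon [:: (2, 3, 4); (2, -3, 4); (-2, 3, 4); (-2, -3, 4)].

Definition outer_labels : seq (nat * nat) := [seq (i, i) | i <- iota 0 6].

Lemma diamond_overlay :
  overlay (low_tangle R) (high_tangle R) diamond outer_labels.
Proof.
split.
- exact: closed_polygon_closed.
- rewrite /diamond /closed_polygon /satisfies /affine_form /= => x [? [? [? [? _]]]].
  by split; rewrite ler_norml; apply/andP; split; lra.
- move=> x; rewrite low_drawing high_drawing.
  rewrite /diamond /closed_polygon /satisfies /affine_form /= => -[? [? [? [? _]]]].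
  have [a|a] := leP 2 x.1; last have [b|b] := leP x.1 (-2).
  + by right; split; constructor 4; repeat split; lra.
  + by right; split; constructor 3; repeat split; lra.
  + by left; split; lra.
- move=> x nM; rewrite low_drawing high_drawing; split; move=> [?|?|[? ?]|[? ?]];
    try (by constructor 1); try (by constructor 2);
    by exfalso; apply: nM; conjs; rewrite /diamond; in_closed_polygon.
- move=> x i j nM fi fj; have sx := ok_inside (low_tangle_ok R) fi.
  move: fi fj; rewrite /face /=.
  case: i => [|[|[|[|[|[|[|i]]]]]]]; case: j => [|[|[|[|[|[|[|j]]]]]]] //=;
    rewrite ?face_nil //; out_wedge;
    first [ by exfalso; apply: nM; rewrite /diamond; in_closed_polygon
          | by case: sx => *; exfalso; lra ].
- move=> i j /mapP[n]; rewrite mem_iota => /andP[_ n6] [-> ->] {i j}.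
  case: n n6 => [|[|[|[|[|[|//]]]]]] _;
    [exists (0, 3 / 2)|exists (-3 / 2, 1)|exists (3 / 2, 1)
    |exists (-3 / 2, -1)|exists (0, - (3 / 2))|exists (3 / 2, -1)];
    (split; [rewrite /diamond; out_closed_polygon|rewrite /face [nth _ _ _]/=; in_polygon
      |rewrite /face [nth _ _ _]/=; in_polygon]).
Qed.

Variables (X : finType) (B : psybracket X).

Definition three_strands (s t m : bool) (i : nat) :=
  match i with 0%N => s | 1%N => t | _ => m end.

Lemma low_orient s t m :
  (strand s (diagonal_arc R) ++ strand t (antidiagonal_arc R)) ++ strand m (low_arc R)
  =i orient (three_strands s t m) (low_tangle R).
Proof.
move=> e; case: s; case: t; case: m; rewrite /strand /= !inE //;
  by do 4 case: (e == _).
Qed.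

Lemma high_orient s t m :
  (strand s (diagonal_arc R) ++ strand t (antidiagonal_arc R)) ++ strand m (high_arc R)
  =i orient (three_strands s t m) (high_tangle R).
Proof.
move=> e; case: s; case: t; case: m; rewrite /strand /= !inE //;
  by do 4 case: (e == _).
Qed.

Lemma low_rules s t m (k : point -> crossing_kind) (c : nat -> X) :
  tangle_rule B (three_strands s t m) k c (low_tangle R) <->
  [/\ oriented_rule B s t (k (0, 0)) (c 0%N) (c 1%N) (c 6%N) (c 2%N),
      oriented_rule B m s (k (- (1 / 2), -1)) (c 6%N) (c 1%N) (c 3%N) (c 4%N)
    & oriented_rule B m t (k (1 / 2, -1)) (c 2%N) (c 6%N) (c 4%N) (c 5%N)].
Proof.
split=> [H|[H1 H2 H3] n [<-|[<-|[<-|[]]]]] //.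
by split; [exact: H _ (or_introl erefl)|exact: H _ (or_intror (or_introl erefl))
  |exact: H _ (or_intror (or_intror (or_introl erefl)))].
Qed.

Lemma high_rules s t m (k : point -> crossing_kind) (c : nat -> X) :
  tangle_rule B (three_strands s t m) k c (high_tangle R) <->
  [/\ oriented_rule B s t (k (0, 0)) (c 6%N) (c 3%N) (c 4%N) (c 5%N),
      oriented_rule B m t (k (- (1 / 2), 1)) (c 0%N) (c 1%N) (c 3%N) (c 6%N)
    & oriented_rule B m s (k (1 / 2, 1)) (c 2%N) (c 0%N) (c 6%N) (c 5%N)].
Proof.
split=> [H|[H1 H2 H3] n [<-|[<-|[<-|[]]]]] //.
by split; [exact: H _ (or_introl erefl)|exact: H _ (or_intror (or_introl erefl))
  |exact: H _ (or_intror (or_intror (or_introl erefl)))].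
Qed.

Lemma strand_kindP K (v m s : bool) Sm Sd (e f : point * point) x :
  (if v then passes_over K Sm Sd else passes_over K Sd Sm) ->
  0 < det (dir e) (dir f) -> orient_edge m e \in Sm -> orient_edge s f \in Sd ->
  open_segment e x -> open_segment f x -> kind K x = strand_kind v m s.
Proof.
move=> po d eS fS /(open_segment_orient m) ex /(open_segment_orient s) fx.
move: po; rewrite /strand_kind; case: v => po.
  have [p n] := passes_over_kind po eS fS ex fx.
  move: p n; rewrite !dir_orient; move: d; rewrite /det.
  by case: m {eS ex}; case: s {fS fx} => /= d p n;
    (apply: p; rewrite ?coordE; lra) || (apply: n; rewrite ?coordE; lra).
have [p n] := passes_over_kind po fS eS fx ex.
move: p n; rewrite !dir_orient; move: d; rewrite /det.
by case: m {eS ex}; case: s {fS fx} => /= d p n;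
    (apply: p; rewrite ?coordE; lra) || (apply: n; rewrite ?coordE; lra).
Qed.

Lemma slide_strand_counting P K K' : slide_strand P K K' ->
  counting_invariant B K = counting_invariant B K'.
Proof.
move=> [s [t [m [rep _ k0 po]]]].
pose D := strand s (diagonal_arc R) ++ strand t (antidiagonal_arc R).
(* [v] tells whether the moving strand is over the other two. *)
have [v [pv pv']] : exists v : bool,
  (if v then passes_over K (strand m (low_arc R)) D
   else passes_over K D (strand m (low_arc R))) /\
  (if v then passes_over K' (strand m (high_arc R)) D
   else passes_over K' D (strand m (high_arc R))).
  by case: po => -[p p']; [exists true|exists false].
have dD : orient_edge s ((-1, -2), (1, 2)) \in D.
  by rewrite /D; case: (s); case: (t); rewrite /strand /= !inE eqxx.
have aD : orient_edge t ((1, -2), (-1, 2)) \in D.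
  by rewrite /D; case: (s); case: (t); rewrite /strand /= !inE eqxx orbT.
have l1 : orient_edge m ((-2, 0), (0, - (4 / 3))) \in strand m (low_arc R).
  by case: (m); rewrite /strand /= !inE eqxx ?orbT.
have l2 : orient_edge m ((0, - (4 / 3)), (2, 0)) \in strand m (low_arc R).
  by case: (m); rewrite /strand /= !inE eqxx ?orbT.
have h1 : orient_edge m ((-2, 0), (0, 4 / 3)) \in strand m (high_arc R).
  by case: (m); rewrite /strand /= !inE eqxx ?orbT.
have h2 : orient_edge m ((0, 4 / 3), (2, 0)) \in strand m (high_arc R).
  by case: (m); rewrite /strand /= !inE eqxx ?orbT.
have ka : kind K (- (1 / 2), -1) = strand_kind v m s.
  apply: (strand_kindP pv _ l1 dD); first by rewrite /det /dir !coordE /=; lra.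
    by in_segment (3 / 4 : R).
  by in_segment (1 / 4 : R).
have kb : kind K (1 / 2, -1) = strand_kind v m t.
  apply: (strand_kindP pv _ l2 aD); first by rewrite /det /dir !coordE /=; lra.
    by in_segment (1 / 4 : R).
  by in_segment (1 / 4 : R).
have kb' : kind K' (- (1 / 2), 1) = strand_kind v m t.
  apply: (strand_kindP pv' _ h1 aD); first by rewrite /det /dir !coordE /=; lra.
    by in_segment (3 / 4 : R).
  by in_segment (3 / 4 : R).
have ka' : kind K' (1 / 2, 1) = strand_kind v m s.
  apply: (strand_kindP pv' _ h2 dD); first by rewrite /det /dir !coordE /=; lra.
    by in_segment (1 / 4 : R).
  by in_segment (3 / 4 : R).
have [|KT KT' out] := replaces_local (low_tangle_ok R) (high_tangle_ok R)
  (@low_orient s t m) (@high_orient s t m) _ rep.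
  do !apply: arc_cases; try exact: arc_none; split;
    first [ left; apply/high_drawing; on_drawing
    | (* the middle vertex of the low arc *)
      by right; exists (2%N, ((-2, 0), (0, - (4 / 3)))), (2%N, ((0, - (4 / 3)), (2, 0)));
        split; rewrite ?inE ?eqxx ?orbT ].
have rules c := low_rules s t m (kind K) c.
have rules' c := high_rules s t m (kind K') c.
have nka := @strand_kind_classical v m s; have nkb := @strand_kind_classical v m t.
apply: (local_move (low_tangle_ok R) (high_tangle_ok R) KT KT' out diamond_overlay);
  split=> [c|c c1 c2].
- move=> /rules[]; rewrite ka kb => r1 r2 r3.
  have [j [q1 q2 q3]] := slide_up r1 r2 r3.
  exists (fun n => if n == 6%N then j else c n).
    by apply/rules'; rewrite k0 ka' kb'.
  by move=> i' j' /mapP[n]; rewrite mem_iota => /andP[_ n6] [-> ->]; rewrite (ltn_eqF n6).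
- move=> _ /rules'[_ _ +] /rules'[_ _ +]; rewrite ka' => r1 r2 m1 m2.
  have mm n : (n < 6)%N -> c1 n = c2 n.
    move=> n6; have nn : (n, n) \in outer_labels by apply: map_f; rewrite mem_iota.
    by rewrite -(m1 _ _ nn) -(m2 _ _ nn).
  move=> n; rewrite ltnS leq_eqVlt => /predU1P[->|]; last exact: mm.
  have [d [_ ud]] := classical_rule_west B m s (c1 2%N) (c1 0%N) (c1 5%N) nka.
  by rewrite -(ud _ r1); apply: ud; rewrite !mm.
- move=> /rules'[]; rewrite k0 ka' kb' => r1 r2 r3.
  have [i [q1 q2 q3]] := slide_down r1 r2 r3.
  exists (fun n => if n == 6%N then i else c n).
    by apply/rules; rewrite ka kb.
  move=> i' j'; rewrite mem_converse => /mapP[n]; rewrite mem_iota => /andP[_ n6] [-> ->].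
  by rewrite (ltn_eqF n6).
- move=> _ /rules[_ + _] /rules[_ + _]; rewrite ka => r1 r2 m1 m2.
  have mm n : (n < 6)%N -> c1 n = c2 n.
    move=> n6; have nn : (n, n) \in converse outer_labels.
      by rewrite mem_converse; apply: map_f; rewrite mem_iota.
    by rewrite -(m1 _ _ nn) -(m2 _ _ nn).
  move=> n; rewrite ltnS leq_eqVlt => /predU1P[->|]; last exact: mm.
  have [d [_ ud]] := classical_rule_east B m s (c1 1%N) (c1 3%N) (c1 4%N) nka.
  by rewrite -(ud _ r1); apply: ud; rewrite !mm.
Qed.

End TriangleMove.

(** * Piecewise linear maps near a point *)

Section TriangleGeometry.
Variable R : realType.
Local Notation point := (R * R)%type.
Implicit Types (x y z w : point) (h : point -> point) (p : point * point * point).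

(** The three determinants are the barycentric coordinates, scaled by the area. *)
Lemma triangleE a b c x : 0 < det (b - a) (c - a) ->
  triangle (a, b, c) x <->
  [/\ 0 <= det (x - a) (c - a), 0 <= det (b - a) (x - a) &
      det (x - a) (c - a) + det (b - a) (x - a) <= det (b - a) (c - a)].
Proof.
move=> d; split=> [[s [t [s0 t0 st ->]]]|[e1 e2 e3]].
  have -> : det (a + s *: (b - a) + t *: (c - a) - a) (c - a) = s * det (b - a) (c - a).
    by rewrite /det !coordE; ring.
  have -> : det (b - a) (a + s *: (b - a) + t *: (c - a) - a) = t * det (b - a) (c - a).
    by rewrite /det !coordE; ring.
  by split; [apply: mulr_ge0 => //; exact: ltW..|nra].
exists (det (x - a) (c - a) / det (b - a) (c - a)),
  (det (b - a) (x - a) / det (b - a) (c - a)).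
split; [by apply: divr_ge0 => //; exact: ltW..| |].
  by rewrite -mulrDl ler_pdivrMr// mul1r.
have d0 := lt0r_neq0 d; move: d0; rewrite /det !coordE => d0.
by apply: point_eq; rewrite !coordE; field.
Qed.

Lemma triangle_closed p h : affine_positive_on h p -> closed (triangle p).
Proof.
case: p => [[a b] c] [d _ _].
have -> : triangle (a, b, c) =
  [set x | 0 <= det (x - a) (c - a)] `&` ([set x | 0 <= det (b - a) (x - a)] `&`
  [set x | det (x - a) (c - a) + det (b - a) (x - a) <= det (b - a) (c - a)]).
  by apply/seteqP; split=> x; [move=> /(triangleE _ d)[]|move=> [? [? ?]]; apply/(triangleE _ d)].
have c1 : continuous (fun x : point => det (x - a) (c - a)).
  move=> x; have -> : (fun x : point => det (x - a) (c - a)) =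
      (fun x => - det (c - a) (x - a)).
    by apply/funext => y; rewrite /det; ring.
  by apply: cvgN; exact: det_continuous.
have c2 : continuous (fun x : point => det (b - a) (x - a)) by exact: det_continuous.
have nonneg (f : point -> R) : continuous f -> closed [set x | 0 <= f x].
  move=> cf; apply: (@preimage_closed _ _ f [set r | 0 <= r]); last exact: closed_ge.
  by move=> x _; exact: cf.
apply: closedI; first exact: nonneg.
apply: closedI; first exact: nonneg.
have -> : [set x : point | det (x - a) (c - a) + det (b - a) (x - a) <= det (b - a) (c - a)] =
    [set x | 0 <= det (b - a) (c - a) - (det (x - a) (c - a) + det (b - a) (x - a))].
  by apply/seteqP; split=> x /=; rewrite subr_ge0.
apply: nonneg => x; apply: cvgB; first exact: cvg_cst.
by apply: cvgD; [exact: c1|exact: c2].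
Qed.

Lemma near_triangles h (s : seq (point * point * point)) x :
  (forall p, p \in s -> affine_positive_on h p) ->
  \forall y \near x, forall p, p \in s -> triangle p y -> triangle p x.
Proof.
elim: s => [|p s IH] aff; first by apply: filterE.
have {}IH := IH (fun q qs => aff q (mem_behead (s := p :: s) qs)).
have [px|npx] := pselect (triangle p x).
  by apply: filterS IH => y IH q; rewrite inE => /predU1P[-> //|]; exact: IH.
have : nbhs x (~` triangle p).
  apply: open_nbhs_nbhs; split=> //; apply/closed_openC.
  by apply: (@triangle_closed _ h); apply: aff; rewrite mem_head.
apply: filterS2 IH => y IH py q; rewrite inE => /predU1P[->|]; last exact: IH.
by move=> /py.
Qed.

Lemma affine_on_triangle h p y z (l : R) : affine_positive_on h p ->
  triangle p y -> triangle p z -> 0 <= l <= 1 ->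
  h (y + l *: (z - y)) = h y + l *: (h z - h y).
Proof.
case: p => [[a b] c] [_ _ aff] [s [t [s0 t0 st ->]]] [s' [t' [s0' t0' st' ->]]] /andP[l0 l1].
have -> : a + s *: (b - a) + t *: (c - a) +
    l *: (a + s' *: (b - a) + t' *: (c - a) - (a + s *: (b - a) + t *: (c - a))) =
    a + ((1 - l) * s + l * s') *: (b - a) + ((1 - l) * t + l * t') *: (c - a).
  by apply: point_eq; rewrite !coordE; ring.
rewrite !aff//; [|nra..].
by apply: point_eq; rewrite !coordE; ring.
Qed.

Lemma det_on_triangle h p x y z : affine_positive_on h p ->
  triangle p x -> triangle p y -> triangle p z ->
  exists2 k : R, 0 < k & det (h y - h x) (h z - h x) = k * det (y - x) (z - x).
Proof.
case: p => [[a b] c] [d1 d2 aff] [s [t [s0 t0 st ->]]] [s' [t' [s0' t0' st' ->]]]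
  [s2 [t2 [s02 t02 st2 ->]]].
exists (det (h b - h a) (h c - h a) / det (b - a) (c - a)); first exact: divr_gt0.
rewrite !aff//.
have E (u v w : point) : det (u + s' *: v + t' *: w - (u + s *: v + t *: w))
    (u + s2 *: v + t2 *: w - (u + s *: v + t *: w)) =
    ((s' - s) * (t2 - t) - (t' - t) * (s2 - s)) * det v w.
  by rewrite /det !coordE; ring.
rewrite !E mulrCA; congr (_ * _); rewrite divfK//; exact: lt0r_neq0.
Qed.

(** Each of the finitely many triangles that contains a point close to [x]
    contains [x], so [h] is affine on the segment from [x] to [y], and the
    triangles at [y] contain [x] too, so [h] preserves the sign of the angle at
    [x] between [y] and the points near [y]. *)
Lemma pl_near h x : pl_positive h ->
  \forall y \near x, (forall l : R, 0 <= l <= 1 ->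
      h (x + l *: (y - x)) = h x + l *: (h y - h x)) /\
    (\forall z \near y, exists2 k : R, 0 < k &
      det (h y - h x) (h z - h x) = k * det (y - x) (z - x)).
Proof.
move=> /(_ x)[s aff cover].
have at_x := near_triangles x aff.
have cov2 := near_join cover; have at2 := near_join at_x.
apply: filterS2 cov2 at2 => y cy ay; split.
  move=> l l01; have [p ps py] := nbhs_singleton cy.
  have px := nbhs_singleton ay p ps py.
  exact: affine_on_triangle (aff p ps) px py l01.
have ny := near_triangles y aff.
apply: filterS3 cy ay ny => z [p ps pz] az nz.
exact: det_on_triangle (aff p ps) (az p ps pz) (nz p ps pz) pz.
Qed.

End TriangleGeometry.

(** * Images of sectors *)

Section SectorImages.
Variable R : realType.
Local Notation point := (R * R)%type.
Local Notation edge := (point * point)%type.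
Implicit Types (x y z w u v m p q : point) (h : point -> point).

Lemma pmulr_trans (a b c : R) : 0 < a * b -> 0 < b * c -> 0 < a * c.
Proof.
move=> ab bc; have b2 : 0 < b ^+ 2.
  by rewrite exprn_even_gt0 //=; apply/eqP => b0; rewrite b0 mulr0 ltxx in ab.
have e : b ^+ 2 * (a * c) = (a * b) * (b * c) by ring.
by rewrite -(pmulr_rgt0 _ b2) e mulr_gt0.
Qed.

(** Follow the segment from [x + p] to [x + q]. If its image avoids the line
    through [h x] in the direction [m], then the side of this line is constant
    along the image; when the image starts on the line, the preserved
    orientation tells to which side it leaves. The midpoint serves as the
    reference. *)
Lemma sector_sign h x p q m : continuous h ->
  (forall s : R, 0 < s < 1 -> det m (h (x + p + s *: (q - p)) - h x) != 0) ->
  let F (s : R) := det m (h (x + p + s *: (q - p)) - h x) in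
  [/\ det m (h (x + p) - h x) != 0 -> 0 < det m (h (x + p) - h x) * F (1 / 2),
      det m (h (x + q) - h x) != 0 -> 0 < det m (h (x + q) - h x) * F (1 / 2) &
      forall l : R, 0 < det p q -> h (x + p) - h x = l *: m ->
        (\forall z \near x + p, exists2 k : R, 0 < k &
           det (h (x + p) - h x) (h z - h x) = k * det (x + p - x) (z - x)) ->
        0 < l * F (1 / 2)].
Proof.
move=> ch avoid F.
have cF : continuous F.
  move=> s; apply: (@continuous_comp _ _ _ (fun s : R => x + p + s *: (q - p))
    (fun z => det m (h z - h x))); first exact: line_continuous.
  apply: (@continuous_comp _ _ _ h (fun z => det m (z - h x))); first exact: ch.
  exact: det_continuous.
have F0 : F 0 = det m (h (x + p) - h x) by rewrite /F scale0r addr0.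
have F1 : F 1 = det m (h (x + q) - h x).
  by rewrite /F scale1r -addrA (addrC p) subrK.
have half : 0 < (1 / 2 : R) < 1 by apply/andP; split; lra.
have const (s : R) : 0 < s < 1 -> 0 < F s * F (1 / 2).
  move=> s01.
  have lc : forall t : R, (`]0, 1[%classic : set R) t ->
      \forall r \near t, (0 < F r) = (0 < F t).
    move=> t; rewrite /= in_itv /= => /avoid; rewrite -/(F t) neq_lt => /orP[] Ft.
      apply: filterS (cvgr_lt _ (cF t) _ Ft) => u Fu.
      by rewrite !ltNge !ltW.
    by apply: filterS (cvgr_gt _ (cF t) _ Ft) => u ->; rewrite Ft.
  have cc : connected (`]0, 1[%classic : set R).
    by apply/connected_intervalP; exact: interval_is_interval.
  have := locally_constant_connected cc lc (x := s) (y := 1 / 2); rewrite /= !in_itv /=.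
  move=> /(_ s01 half) e.
  have := avoid _ s01; have := avoid _ half; rewrite -/(F s) -/(F (1 / 2)).
  rewrite !neq_lt => /orP[] a /orP[] b; rewrite ?a ?b in e *.
  - by rewrite nmulr_rgt0.
  - by move: e; rewrite (lt_gtF a).
  - by move: e; rewrite (lt_gtF b).
  - exact: mulr_gt0.
(* An end of the segment which is off the line lies on the same side as the
   points of the segment near it. *)
have limit (t : R) : 0 <= t <= 1 -> F t != 0 -> 0 < F t * F (1 / 2).
  move=> /andP[t0 t1] Ft.
  have n1 : \forall r \near t, 0 < F t * F r.
    have c : (fun r => F t * F r) @ t --> F t * F t by apply: cvgM; [exact: cvg_cst|exact: cF].
    by apply: (cvgr_gt _ c); rewrite -expr2 exprn_even_gt0.
  have cl : (fun u : R => t + u *: (1 / 2 - t)) @ 0^'+ --> t.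
    apply: cvg_at_right_filter; have := @line_continuous R.
    have c0 : (fun u : R => t + u *: (1 / 2 - t)) @ 0 --> t + 0 *: (1 / 2 - t).
      by apply: cvgD; [exact: cvg_cst|apply: cvgZr_tmp; exact: cvg_id].
    by move: c0; rewrite scale0r addr0.
  have n2 : \forall r \near (0 : R)^'+, 0 < F t * F (t + r *: (1 / 2 - t)) by exact: cl n1.
  have n3 : \forall r \near (0 : R)^'+, 0 < r by exact: nbhs_right_gt.
  have n4 : \forall r \near (0 : R)^'+, r < 1 by exact: nbhs_right_lt.
  have [r [[/= u1 u2] u3]] := @filter_ex _ _ _ _ (filterI (filterI n2 n3) n4).
  apply: (pmulr_trans u1); apply: const.
  by rewrite /GRing.scale /=; apply/andP; split; nra.
split=> [n|n|l d el nz].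
- by rewrite -F0; apply: limit; rewrite ?F0// lexx ler01.
- by rewrite -F1; apply: limit; rewrite ?F1// lexx ler01.
have n1 := near_ray (q - p) nz.
have n3 : \forall r \near (0 : R)^'+, 0 < r by exact: nbhs_right_gt.
have n4 : \forall r \near (0 : R)^'+, r < 1 by exact: nbhs_right_lt.
have [u [[[k k0 ek] u2] u3]] := @filter_ex _ _ _ _ (filterI (filterI n1 n3) n4).
have u01 : 0 < u < 1 by rewrite u2.
apply: (pmulr_trans _ (const _ u01)).
have -> : l * F u = det (l *: m) (h (x + p + u *: (q - p)) - h x).
  by rewrite /F /det !coordE; ring.
rewrite -el ek.
have -> : det (x + p - x) (x + p + u *: (q - p) - x) = u * det p q.
  by rewrite /det !coordE; ring.
by rewrite mulr_gt0 ?mulr_gt0.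
Qed.

(** Near an interior point of an edge, the edge fills the line on which it
    lies. *)
Lemma near_line (e : edge) x : dir e != 0 -> open_segment e x ->
  \forall y \near x, det (dir e) (y - x) = 0 -> segment e y.
Proof.
move=> nz [s /andP[s0 s1] xe].
pose d := dir e; pose n := d.1 ^+ 2 + d.2 ^+ 2.
pose l (y : point) := (d.1 * (y - x).1 + d.2 * (y - x).2) / n.
have n0 : n != 0.
  rewrite paddr_eq0 ?sqr_ge0// !sqrf_eq0; apply: contra nz => /andP[/eqP a /eqP b].
  by apply/eqP; exact: point_eq.
have cl : l @ x --> 0.
  have -> : 0 = (d.1 * (x - x).1 + d.2 * (x - x).2) / n.
    by rewrite !coordE; rewrite !subrr !mulr0 addr0 mul0r.
  have c1 : (fun y : point => (y - x).1) @ x --> (x - x).1.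
    by apply: cvgB; [exact: cvg_fst|exact: cvg_cst].
  have c2 : (fun y : point => (y - x).2) @ x --> (x - x).2.
    by apply: cvgB; [exact: cvg_snd|exact: cvg_cst].
  apply: cvgM; last exact: cvg_cst.
  by apply: cvgD; apply: cvgM => //; exact: cvg_cst.
have l1 : \forall y \near x, - s < l y by apply: (cvgr_gt _ cl); lra.
have l2 : \forall y \near x, l y < 1 - s by apply: (cvgr_lt _ cl); lra.
apply: filterS2 l1 l2 => y y1 y2 dy.
exists (s + l y); first by apply/andP; split; lra.
have yx : y - x = l y *: d.
  move: dy; rewrite -/d /l; set u := y - x; rewrite /det => dy.
  have e1 : u.1 * n - (d.1 * u.1 + d.2 * u.2) * d.1 = - d.2 * (d.1 * u.2 - d.2 * u.1).
    by rewrite /n; ring.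
  have e2 : u.2 * n - (d.1 * u.1 + d.2 * u.2) * d.2 = d.1 * (d.1 * u.2 - d.2 * u.1).
    by rewrite /n; ring.
  by apply: point_eq; rewrite coordE; apply: (mulIf n0); rewrite mulrAC divfK//;
    apply/eqP; rewrite -subr_eq0 ?e1 ?e2 dy mulr0.
by rewrite scalerDl -yx -/d addrA -xe addrC subrK.
Qed.

End SectorImages.

(** * Crossings under an isotopy *)

Section Isotopy.
Variable R : realType.
Local Notation point := (R * R)%type.
Local Notation edge := (point * point)%type.
Implicit Types (x y z w u v : point).
Variables (K K' : diagram R) (h g : point -> point).
Hypotheses (hK : cancel h g) (gK : cancel g h).
Hypotheses (ch : continuous h) (cg : continuous g).
Hypotheses (pl : pl_positive h) (car : carries h K K').

Lemma support_image x : support K x <-> support K' (h x).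
Proof.
have [e _ _ _] := car; rewrite -e; split=> [sx|[y sy /(can_inj hK) <-]] //.
Qed.

(** The ray from [x] in the direction [w] is mapped into the quadrant between
    [m] and [n] that contains the direction [w']. *)
Definition same_quadrant (m n : edge) x w w' := \forall t \near (0 : R)^'+,
  0 < det (dir m) (h (x + t *: w) - h x) * det (dir m) w' /\
  0 < det (dir n) (h (x + t *: w) - h x) * det (dir n) w'.

Section AtCrossing.
Variables (e f : edge) (x : point).
Hypothesis cr : crossing K e f x.
Variables (e0 f0 : edge).
Hypothesis cr0 : crossing K' e0 f0 (h x).

(** All that holds for the points [y] near a double point: [h] is affine on the
    segment from [x] and keeps the orientation, and the only strands near [x]
    and near [h x] are the two that cross there. *)
Definition controlled y : Prop :=
  [/\ forall l : R, 0 <= l <= 1 -> h (x + l *: (y - x)) = h x + l *: (h y - h x),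
      \forall z \near y, exists2 k : R, 0 < k &
        det (h y - h x) (h z - h x) = k * det (y - x) (z - x),
      forall a, a \in edges K' -> segment a (h y) -> a = e0 \/ a = f0,
      forall m, m = e0 \/ m = f0 -> det (dir m) (h y - h x) = 0 -> segment m (h y)
    & forall a, a \in edges K -> segment a y -> a = e \/ a = f].

Lemma near_controlled : \forall y \near x, controlled y.
Proof.
have [e0K f0K e0x f0x d0] := cr0.
have n1 := pl_near x pl.
have n2 := @ch x _ (near_crossing cr0).
have n3 := @ch x _ (near_line (edge_dir_neq0 e0K) e0x).
have n4 := @ch x _ (near_line (edge_dir_neq0 f0K) f0x).
have n5 := near_crossing cr.
apply: filterS3 (filterI n1 n2) (filterI n3 n4) n5 => y [[y1 y2] y3] [y4 y5] y6.
by split=> // m [->|->].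
Qed.

Variable r : R.
Hypothesis ctl : forall y, ball x r y -> controlled y.

(** A strand that contains [h y] contains the image of the whole segment from
    [x] to [y], which is straight. *)
Lemma strand_image m y z : m = e0 \/ m = f0 -> ball x r y -> segment m (h y) ->
  segment (x, y) z -> segment m (h z).
Proof.
move=> em xy my [t t01 ->].
have [_ _ e0x f0x _] := cr0.
have mx : segment m (h x) by case: em => ->; exact: open_segmentW.
have [rad _ _ _ _] := ctl xy; rewrite [dir _]/(y - x) rad//.
by apply: (segment_sub mx my); exists t.
Qed.

Lemma support_strand y : ball x r y -> support K y ->
  exists2 m, m = e0 \/ m = f0 & segment m (h y).
Proof.
move=> xy /support_image[a aK ay]; have [_ _ st _ _] := ctl xy.
by exists a => //; exact: st.
Qed.

Lemma before_scale (a : edge) y z : before a y z ->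
  exists2 l : R, 0 < l & z - y = l *: dir a.
Proof.
move=> [s [t [_ st _ -> ->]]]; exists (t - s); first by rewrite subr_gt0.
by apply: point_eq; rewrite !coordE; ring.
Qed.

(** The image of a short piece of a strand lies on the diagram, hence on one of
    the two strands at [h x], and [carries] makes the direction of travel the
    same. A priori the two halves of a strand may land on different strands;
    [crossing_image] excludes this. *)
Lemma half_edges a (s d : R) : a = e \/ a = f -> x = a.1 + s *: dir a ->
  0 < d -> d < s -> d < 1 - s -> ball x r (x + d *: dir a) ->
  ball x r (x - d *: dir a) ->
  (exists (m : edge) (l : R),
     [/\ m = e0 \/ m = f0, 0 < l & h (x + d *: dir a) - h x = l *: dir m]) /\
  (exists (m : edge) (l : R),
     [/\ m = e0 \/ m = f0, 0 < l & h (x - d *: dir a) - h x = (- l) *: dir m]).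
Proof.
move=> ea xs d0 ds d1 bp bm.
have [eK fK _ _ _] := cr; have [e0K f0K _ _ _] := cr0.
have aK : a \in edges K by case: ea => ->.
have mK m : m = e0 \/ m = f0 -> m \in edges K' by case=> ->.
have [_ bef _ _] := car.
have xp : x + d *: dir a = a.1 + (s + d) *: dir a.
  by rewrite {1}xs -addrA -scalerDl.
have xm : x - d *: dir a = a.1 + (s - d) *: dir a.
  by rewrite {1}xs -addrA -scalerBl.
have sp : support K (x + d *: dir a).
  by exists a => //; exists (s + d) => //; apply/andP; split; lra.
have sm : support K (x - d *: dir a).
  by exists a => //; exists (s - d) => //; apply/andP; split; lra.
have [m em mp] := support_strand bp sp; have [n en nm] := support_strand bm sm.
split.
  have b : before a x (x + d *: dir a).
    by exists s, (s + d); split=> //; lra.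
  have /before_scale[l l0 el] : before m (h x) (h (x + d *: dir a)).
    apply: (bef a m) => //; first exact: mK.
    by move=> _ [z xz <-]; exact: (strand_image em bp mp xz).
  by exists m, l.
have b : before a (x - d *: dir a) x.
  by exists (s - d), s; split=> //; lra.
have /before_scale[l l0 el] : before n (h (x - d *: dir a)) (h x).
  apply: (bef a n) => //; first exact: mK.
  by move=> _ [z /segment_sym xz <-]; exact: (strand_image en bm nm xz).
by exists n, l; split=> //; rewrite scaleNr -el opprB.
Qed.

(** Two rays from [x] in different directions cannot be mapped into the same
    ray, because [h] is injective. *)
Lemma distinct_rays u v d (k l : R) : ball x r (x + u) -> ball x r (x + v) ->
  det u v != 0 -> h (x + u) - h x = k *: d -> h (x + v) - h x = l *: d -> 0 < k * l -> False.
Proof.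
move=> bu bv uv hu hv kl.
have [ru _ _ _ _] := ctl bu; have [rv _ _ _ _] := ctl bv.
have kl0 : k + l != 0.
  apply/eqP => e1; move: kl; rewrite (_ : k = - l); last by lra.
  by rewrite mulNr oppr_gt0 ltNge -expr2 sqr_ge0.
have k0 : k != 0 by apply/eqP => e1; rewrite e1 mul0r ltxx in kl.
have l0 : l != 0 by apply/eqP => e1; rewrite e1 mulr0 ltxx in kl.
have bound (a b : R) : 0 < a * b -> 0 <= b / (a + b) <= 1.
  move=> ab; have [b0|b0|b0] := ltgtP b 0; last by rewrite b0 mulr0 ltxx in ab.
    have a0 : a < 0 by rewrite -(nmulr_lgt0 _ b0).
    have s0 : a + b < 0 by lra.
    apply/andP; split; first by rewrite ltW// nmulr_rgt0// invr_lt0.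
    by rewrite ler_ndivrMr//; lra.
  have a0 : 0 < a by rewrite -(pmulr_lgt0 _ b0).
  have s0 : 0 < a + b by lra.
  apply/andP; split; first by rewrite divr_ge0// ltW.
  by rewrite ler_pdivrMr//; lra.
have exy : x + (l / (k + l)) *: u = x + (k / (l + k)) *: v.
  apply: (can_inj hK).
  have := ru _ (bound _ _ kl); rewrite (addrAC x u) subrr add0r => ->.
  have := rv (k / (l + k)); rewrite (addrAC x v) subrr add0r => ->; last first.
    by apply: bound; rewrite mulrC.
  by rewrite hu hv !scalerA (addrC l) mulrAC [in RHS]mulrAC (mulrC l).
have : det u (x + (l / (k + l)) *: u - x) = det u (x + (k / (l + k)) *: v - x) by rewrite exy.
rewrite !det_ray; have -> : det u u = 0 by rewrite /det; ring.
rewrite mulr0 => /esym/eqP; rewrite !mulf_eq0 invr_eq0 (negbTE k0) (negbTE uv) addrC (negbTE kl0).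
by [].
Qed.

(** Near [h x] the line through a strand is part of the diagram, so the image
    of an open sector avoids both lines, as the sector avoids the strands;
    hence [sector_sign] applies. *)
Lemma sector_signs p q m : m = e0 \/ m = f0 -> ball x r (x + p) -> ball x r (x + q) ->
  0 < det p q ->
  (forall a (s : R), a = e \/ a = f -> 0 < s < 1 -> det (dir a) (p + s *: (q - p)) != 0) ->
  let V := h (x + (1 / 2) *: (p + q)) - h x in
  [/\ det (dir m) (h (x + p) - h x) != 0 ->
        0 < det (dir m) (h (x + p) - h x) * det (dir m) V,
      det (dir m) (h (x + q) - h x) != 0 ->
        0 < det (dir m) (h (x + q) - h x) * det (dir m) V &
      forall l : R, h (x + p) - h x = l *: dir m -> 0 < l * det (dir m) V].
Proof.
move=> em bp bq pq off V.
have [e0K f0K _ _ _] := cr0.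
have avoid (s : R) : 0 < s < 1 -> det (dir m) (h (x + p + s *: (q - p)) - h x) != 0.
  move=> s01; apply/eqP => d0.
  have bs : ball x r (x + p + s *: (q - p)).
    apply: (ball_segment bp bq); exists s; first by case/andP: s01 => ? ?; rewrite !ltW.
    by apply: point_eq; rewrite /dir !coordE /=; ring.
  have [_ _ _ ln st] := ctl bs.
  have ms := ln m em d0.
  have : support K (x + p + s *: (q - p)).
    by apply/support_image; exists m => //; case: em => ->.
  move=> [a aK ay]; have ea := st a aK ay.
  have [_ _ ex fx _] := cr.
  have ax : segment a x by case: ea => ->; exact: open_segmentW.
  have eo : x + p + s *: (q - p) - x = p + s *: (q - p).
    by apply: point_eq; rewrite !coordE; ring.
  have := det_on_segment ax ay; rewrite eo => /eqP.
  by rewrite (negbTE (off a s ea s01)).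
have [c1 c2 c3] := sector_sign ch avoid.
have eV : x + p + (1 / 2) *: (q - p) = x + (1 / 2) *: (p + q).
  by apply: point_eq; rewrite !coordE; field.
rewrite eV in c1 c2 c3; split=> // l el.
by apply: c3 => //; have [] := ctl bp.
Qed.

Lemma same_quadrantP m n w w' (d : R) : 0 < d -> ball x r (x + d *: w) ->
  0 < det (dir m) (h (x + d *: w) - h x) * det (dir m) w' ->
  0 < det (dir n) (h (x + d *: w) - h x) * det (dir n) w' ->
  same_quadrant m n x w w'.
Proof.
move=> d0 bw sm sn; have [rad _ _ _ _] := ctl bw.
apply: filterS2 (nbhs_right_gt 0) (nbhs_right_lt d0) => t t0 td.
have -> : x + t *: w = x + (t / d) *: (x + d *: w - x).
  by rewrite (addrAC x) subrr add0r scalerA divfK// gt_eqF.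
rewrite rad; last first.
  by apply/andP; split; [apply: divr_ge0; exact: ltW|rewrite ler_pdivrMr// mul1r ltW].
have td0 : 0 < t / d by exact: divr_gt0.
by split; rewrite det_ray -(mulrA (t / d)) pmulr_rgt0.
Qed.

End AtCrossing.

Lemma pmul_cancel (l a b : R) : 0 < l -> 0 < l * a * b -> 0 < a * b.
Proof. by move=> l0; rewrite -mulrA pmulr_rgt0. Qed.

Lemma detZ (d : R) u v : det u (d *: v) = d * det u v.
Proof. by rewrite /det !coordE; ring. Qed.

(** The four half-strands E, F, - E and - F at [x] go to half-strands at [h x]
    with the same direction of travel. By injectivity E and F land on different
    strands [m] and [n]. If - E went to [n], then the images of F and - E would
    lie on different sides of [m], while the image of the sector between them
    avoids the line of [m]; so - E goes to [m], and - F to [n], again by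
    injectivity. The preserved orientation at E makes the pair positive. In
    each sector the signs with respect to [m] and [n] are then known from its
    two sides. *)
Lemma crossing_image e f x : crossing K e f x ->
  exists m n, crossing K' m n (h x) /\
   [/\ same_quadrant m n x (dir e + dir f) (dir m + dir n),
       same_quadrant m n x (dir f - dir e) (dir n - dir m),
       same_quadrant m n x (- (dir e + dir f)) (- (dir m + dir n)) &
       same_quadrant m n x (dir e - dir f) (dir m - dir n)].
Proof.
move=> cr; have [eK fK ex fx dpos] := cr.
have [e0 [f0 cr0]] : double_point K' (h x).
  by have [_ _ dp _] := car; apply/dp; exists e, f.
have [r /= r0 rN] := (iffLR (nbhs_ballP _ _)) (near_controlled cr cr0).
have [se /andP[se0 se1] xe] := ex; have [sf /andP[sf0 sf1] xf] := fx.
have bx : nbhs x (ball x r) by exact: nbhsx_ballx.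
have small (c : R) : 0 < c -> \forall t \near (0 : R)^'+, t < c by exact: nbhs_right_lt.
have se2 : 0 < 1 - se by lra.
have sf2 : 0 < 1 - sf by lra.
have pos : \forall t \near (0 : R)^'+, 0 < t by exact: nbhs_right_gt.
(* The points [x] displaced by [d] times the directions of the strands are
   close enough to [x], and lie on the edges. *)
have [d [[[n1 n2] [n3 n4]] [[d0 [d1 d2]] [d3 d4]]]] := @filter_ex _ _ _ _ (filterI
  (filterI (filterI (near_ray (dir e) bx) (near_ray (- dir e) bx))
           (filterI (near_ray (dir f) bx) (near_ray (- dir f) bx)))
  (filterI (filterI pos (filterI (small _ se0) (small _ se2)))
           (filterI (small _ sf0) (small _ sf2)))).
rewrite !scalerN in n2 n4.
have [[m [l1 [em l10 h1]]] [a [l3 [ea l30 h3]]]] :=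
  half_edges cr cr0 rN (or_introl erefl) xe d0 d1 d2 n1 n2.
have [[n [l2 [en l20 h2]]] [b [l4 [eb l40 h4]]]] :=
  half_edges cr cr0 rN (or_intror erefl) xf d0 d3 d4 n3 n4.
set E := d *: dir e in n1 n2 h1 h3; set F := d *: dir f in n3 n4 h2 h4.
have dEF : 0 < det E F.
  rewrite (_ : det E F = d * d * det (dir e) (dir f)); last by rewrite /E /F /det !coordE; ring.
  by rewrite mulr_gt0 ?mulr_gt0.
have scaled (s : R) : 0 < s -> s * d * det (dir e) (dir f) != 0.
  by move=> s0; rewrite gt_eqF// mulr_gt0 ?mulr_gt0.
(* No open sector meets a strand. *)
have off1 c (s : R) : c = e \/ c = f -> 0 < s < 1 -> det (dir c) (E + s *: (F - E)) != 0.
  move=> [->|->] /andP[s0 s1].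
    rewrite (_ : det _ _ = s * d * det (dir e) (dir f)); first exact: scaled.
    by rewrite /E /F /det !coordE; ring.
  rewrite (_ : det _ _ = - ((1 - s) * d * det (dir e) (dir f))).
    by rewrite oppr_eq0; apply: scaled; rewrite subr_gt0.
  by rewrite /E /F /det !coordE; ring.
have off2 c (s : R) : c = e \/ c = f -> 0 < s < 1 -> det (dir c) (F + s *: (- E - F)) != 0.
  move=> [->|->] /andP[s0 s1].
    rewrite (_ : det _ _ = (1 - s) * d * det (dir e) (dir f)).
      by apply: scaled; rewrite subr_gt0.
    by rewrite /E /F /det !coordE; ring.
  rewrite (_ : det _ _ = s * d * det (dir e) (dir f)); first exact: scaled.
  by rewrite /E /F /det !coordE; ring.
have off3 c (s : R) : c = e \/ c = f -> 0 < s < 1 -> det (dir c) (- E + s *: (- F - - E)) != 0.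
  move=> ec s01; have := off1 c s ec s01; rewrite (_ : - E + _ = - (E + s *: (F - E))).
    by rewrite detN oppr_eq0.
  by apply: point_eq; rewrite !coordE; ring.
have off4 c (s : R) : c = e \/ c = f -> 0 < s < 1 -> det (dir c) (- F + s *: (E - - F)) != 0.
  move=> ec s01; have := off2 c s ec s01; rewrite (_ : - F + _ = - (F + s *: (- E - F))).
    by rewrite detN oppr_eq0.
  by apply: point_eq; rewrite !coordE; ring.
have dFE : 0 < det F (- E) by move: dEF; rewrite /det !coordE; lra.
have dEF' : 0 < det (- E) (- F) by move: dEF; rewrite /det !coordE; lra.
have dFE' : 0 < det (- F) E by move: dEF; rewrite /det !coordE; lra.
have [_ _ _ _ d00] := cr0.
set D := det (dir m) (dir n).
have nD : D != 0.
  have mn : m <> n.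
    move=> mn; rewrite -mn in h2; apply: (distinct_rays rN n1 n3 _ h1 h2).
      by rewrite gt_eqF.
    exact: mulr_gt0.
  move: mn; rewrite /D; case: em => ->; case: en => -> // _; first by rewrite gt_eqF.
  by rewrite (_ : det _ _ = - det (dir e0) (dir f0)) ?oppr_eq0 ?gt_eqF// /det; ring.
have nm : det (dir n) (dir m) = - D by rewrite /D /det; ring.
have mm0 c : det (dir c) (dir c) = 0 by rewrite /det; ring.
(* There are only two strands at [h x]. *)
have oD : a = m \/ a = n.
  have : det (dir m) (dir n) != 0 := nD.
  case: ea em en => -> [] -> [] ->; (try by left); (try by right);
    by rewrite mm0 eqxx.
have am : a = m.
  case: oD => // an; exfalso; rewrite an in h3.
  have [c1 c2 _] := sector_signs cr cr0 rN em n3 n2 dFE off2.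
  move: c1 c2; rewrite h2 h3 !detZ -/D => c1 c2.
  have {}c1 := pmul_cancel l20 (c1 (mulf_neq0 (lt0r_neq0 l20) nD)).
  have l3n : - l3 != 0 by rewrite oppr_eq0 lt0r_neq0.
  have {}c2 := c2 (mulf_neq0 l3n nD).
  by move: c2; rewrite !mulNr -mulrA oppr_gt0 pmulr_rlt0// ltNge ltW.
have bn : b = n.
  have ob : b = m \/ b = n.
    have : det (dir m) (dir n) != 0 := nD.
    case: eb em en => -> [] -> [] ->; (try by left); (try by right);
      by rewrite mm0 eqxx.
  case: ob => // bm; exfalso; rewrite am in h3; rewrite bm in h4.
  apply: (distinct_rays rN n2 n4 _ h3 h4); first by rewrite gt_eqF.
  by rewrite mulrNN mulr_gt0.
rewrite {}am in h3; rewrite {}bn in h4.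
have npos c : c != 0 -> l1 * c != 0 by move=> c0; rewrite mulf_neq0// gt_eqF.
have Dpos : 0 < D.
  have [_ c2 c3] := sector_signs cr cr0 rN em n1 n3 dEF off1.
  move: (c3 _ h1) c2; rewrite pmulr_rgt0// h2 detZ -/D => v0.
  move=> /(_ (mulf_neq0 (lt0r_neq0 l20) nD))/(pmul_cancel l20).
  by rewrite pmulr_lgt0.
have detD u v w : det u (v + w) = det u v + det u w by rewrite /det !coordE; ring.
have quad p q w w' : ball x r (x + p) -> ball x r (x + q) ->
    p + q = d *: w ->
    0 < det (dir m) (h (x + (1 / 2) *: (p + q)) - h x) * det (dir m) w' ->
    0 < det (dir n) (h (x + (1 / 2) *: (p + q)) - h x) * det (dir n) w' ->
    same_quadrant m n x w w'.
  move=> bp bq epq; have ew : (1 / 2) *: (p + q) = (d / 2) *: w.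
    by rewrite epq scalerA mulrC mulrA mulr1.
  rewrite ew; apply: (same_quadrantP rN); first by rewrite divr_gt0.
  rewrite -ew; apply: (ball_segment bp bq); exists (1 / 2); first by apply/andP; split; lra.
  by apply: point_eq; rewrite /dir !coordE /=; field.
exists m, n; split.
  have [e0K f0K e0x f0x _] := cr0.
  by split=> //; [case: em|case: en|case: em|case: en] => ->.
have w1 : det (dir m) (dir m + dir n) = D by rewrite detD mm0 add0r.
have w2 : det (dir n) (dir m + dir n) = - D by rewrite detD mm0 addr0.
have w3 : det (dir m) (dir n - dir m) = D by rewrite detD detN mm0 oppr0 addr0.
have w4 : det (dir n) (dir n - dir m) = D by rewrite detD detN mm0 add0r nm opprK.
have w5 : det (dir m) (dir m - dir n) = - D by rewrite detD detN mm0 add0r.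
have w6 : det (dir n) (dir m - dir n) = - D by rewrite detD detN mm0 oppr0 addr0.
split.
- have [_ _ c3] := sector_signs cr cr0 rN em n1 n3 dEF off1.
  have [c1 _ _] := sector_signs cr cr0 rN en n1 n3 dEF off1.
  apply: (quad E F) => //; first by rewrite /E /F; apply: point_eq; rewrite !coordE; ring.
    by rewrite w1 pmulr_lgt0//; have := c3 _ h1; rewrite pmulr_rgt0.
  rewrite w2 mulrC; move: c1; rewrite h1 detZ nm => c1.
  apply: (pmul_cancel l10); apply: c1; apply: npos; rewrite oppr_eq0.
  exact: nD.
- have [c1 _ _] := sector_signs cr cr0 rN em n3 n2 dFE off2.
  have [_ _ c3] := sector_signs cr cr0 rN en n3 n2 dFE off2.
  apply: (quad F (- E)) => //; first by rewrite /E /F; apply: point_eq; rewrite !coordE; ring.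
    rewrite w3 mulrC; move: c1; rewrite h2 detZ -/D => c1.
    by apply: (pmul_cancel l20); apply: c1; rewrite mulf_neq0// gt_eqF.
  rewrite w4 pmulr_lgt0//.
  by have := c3 _ h2; rewrite pmulr_rgt0.
- have [_ _ c3] := sector_signs cr cr0 rN em n2 n4 dEF' off3.
  have [c1 _ _] := sector_signs cr cr0 rN en n2 n4 dEF' off3.
  apply: (quad (- E) (- F)) => //; first by rewrite /E /F; apply: point_eq; rewrite !coordE; ring.
    rewrite detN w1 mulrN -mulNr pmulr_lgt0//.
    by have := c3 _ h3; rewrite mulNr -mulrN pmulr_rgt0.
  rewrite detN w2 opprK mulrC; move: c1.
  rewrite h3 detZ nm mulrNN => c1; apply: (pmul_cancel l30); apply: c1.
  by rewrite mulf_neq0// gt_eqF.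
- have [c1 _ _] := sector_signs cr cr0 rN em n4 n1 dFE' off4.
  have [_ _ c3] := sector_signs cr cr0 rN en n4 n1 dFE' off4.
  apply: (quad (- F) E) => //; first by rewrite /E /F; apply: point_eq; rewrite !coordE; ring.
    rewrite w5 mulrC; move: c1; rewrite h4 detZ -/D => c1.
    apply: (pmul_cancel l40); rewrite mulrN -mulNr; apply: c1.
    by rewrite mulf_neq0 ?oppr_eq0 ?gt_eqF.
  rewrite w6 mulrN -mulNr pmulr_lgt0//.
  by have := c3 _ h4; rewrite mulNr -mulrN pmulr_rgt0.
Qed.

End Isotopy.

(** * Isotopic diagrams *)

Section IsotopyCounting.
Variable R : realType.
Local Notation point := (R * R)%type.
Local Notation edge := (point * point)%type.
Implicit Types (x y z w : point) (K : diagram R).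

Lemma crossing_unique K (m n m' n' : edge) x :
  crossing K m n x -> crossing K m' n' x -> m = m' /\ n = n'.
Proof.
move=> cr [mK nK mx nx d'].
have H := nbhs_singleton (near_crossing cr).
have [_ _ _ _ d] := cr.
have dd (u : point) : det u u = 0 by rewrite /det; ring.
have anti (u v : point) : det u v = - det v u by rewrite /det; ring.
move: d'; case: (H m' mK (open_segmentW mx)) => ->;
  case: (H n' nK (open_segmentW nx)) => -> //; rewrite ?dd ?ltxx//.
by rewrite anti oppr_gt0 ltNge ltW.
Qed.

Section Transport.
Variables (K K' : diagram R) (h g : point -> point).
Hypotheses (hK : cancel h g) (gK : cancel g h).
Hypotheses (ch : continuous h) (cg : continuous g).
Hypotheses (pl : pl_positive h) (car : carries h K K').
Variables (X : Type) (B : psybracket X).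

Lemma same_quadrant_germ (m n : edge) x w w' (phi : point -> option X) a :
  face_coloring K' phi -> crossing K' m n (h x) -> same_quadrant h m n x w w' ->
  germ phi (h x) w' a -> germ (phi \o h) x w a.
Proof.
move=> fc cr sq ga; have [U xU HU] := quadrants fc cr.
have n1 := near_ray w (@ch x _ xU).
have n2 := near_ray w' xU.
have pos : \forall t \near (0 : R)^'+, 0 < t by exact: nbhs_right_gt.
have [t0 [[t1 t2] t3]] := @filter_ex _ _ _ _ (filterI (filterI n2 ga) pos).
apply: filterS2 sq n1 => t [s1 s2] ut; rewrite /= -t2.
have scale u v : 0 < det u v * det u w' -> 0 < det u v * det u (h x + t0 *: w' - h x).
  by rewrite det_ray mulrCA => ?; apply: mulr_gt0.
by have [] := HU _ _ ut t1 (scale _ _ s1) (scale _ _ s2).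
Qed.

Lemma same_quadrant_neq0 (m n : edge) x w w' : same_quadrant h m n x w w' ->
  det (dir m) w' != 0 /\ det (dir n) w' != 0.
Proof.
move=> sq; have [t [s1 s2]] := @filter_ex _ _ _ _ sq.
by split; apply/eqP => e; [move: s1|move: s2]; rewrite e mulr0 ltxx.
Qed.

Lemma image_germs k e f x m n (phi : point -> option X) : crossing K e f x ->
  crossing K' m n (h x) -> face_coloring K' phi ->
  crossing_germs B k (phi \o h) x (dir e) (dir f) <->
  crossing_germs B k phi (h x) (dir m) (dir n).
Proof.
move=> cr cr' fc; have [m' [n' [cr2 [s1 s2 s3 s4]]]] := crossing_image hK ch pl car cr.
have [em en] := crossing_unique cr2 cr'; rewrite {}em {}en in cr2 s1 s2 s3 s4.
have gex w w' : same_quadrant h m n x w w' -> exists a, germ phi (h x) w' a.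
  by move=> /same_quadrant_neq0[a b]; exact: (germ_exists fc cr').
have [[p gp] [q gq]] := (gex _ _ s1, gex _ _ s2).
have [[r gr] [s gs]] := (gex _ _ s3, gex _ _ s4).
have g1 : germs4 phi (h x) (dir m) (dir n) p q r s by split.
have g2 : germs4 (phi \o h) x (dir e) (dir f) p q r s.
  split; [exact: (same_quadrant_germ fc cr' s1)|exact: (same_quadrant_germ fc cr' s2)
    |exact: (same_quadrant_germ fc cr' s3)|exact: (same_quadrant_germ fc cr' s4)].
by rewrite (germs4_crossing B k g1) (germs4_crossing B k g2).
Qed.

(** Continuity of [h] and of its inverse preserves local constancy, and
    [crossing_image] matches the four germs at every double point. *)
Lemma pull_coloring (phi : point -> option X) :
  plane_coloring B K' phi <-> plane_coloring B K (phi \o h).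
Proof.
have sup x := support_image hK car x; have [_ _ dp kd] := car.
have fc : face_coloring K' phi <-> face_coloring K (phi \o h).
  split=> -[c1 c2]; split=> x.
  - by rewrite sup; exact: c1.
  - by move=> /sup/c2; exact: (@ch x).
  - by rewrite -(gK x) -sup; exact: c1.
  - rewrite -(gK x) -sup => /c2 nx.
    have := @cg (h (g x)); rewrite /continuous_at hK => cgx.
    have n2 : \forall y \near h (g x), (phi \o h) (g y) = (phi \o h) (g x) by exact: cgx nx.
    by apply: filterS n2 => y; rewrite /= gK.
split=> [[f1 pc]|[/fc f1 pc]]; (split; first by [|apply/fc]) => e f x cr.
  have [m [n [cr' _]]] := crossing_image hK ch pl car cr.
  apply: (iffRL (image_germs (kind K x) cr cr' f1)).
  by rewrite -kd; [exact: pc|exists e, f].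
have /dp[e1 [f1' cr1]] : double_point K' (h (g x)) by rewrite gK; exists e, f.
rewrite -(gK x) in cr *.
apply: (iffLR (image_germs (kind K' (h (g x))) cr1 cr f1)).
by rewrite kd; [exact: pc|exists e1, f1'].
Qed.

End Transport.

Lemma planar_isotopic_counting (X : finType) (B : psybracket X) K K' :
  planar_isotopic K K' -> counting_invariant B K = counting_invariant B K'.
Proof.
move=> [H [_ Hh _ car]]; have i1 : 0 <= (1 : R) <= 1 by rewrite ler01 lexx.
have [[g [hK gK ch cg]] pl] := Hh 1 i1.
apply: counting_invariant_card.
apply: (functional_bijection_card (r := fun p q : point -> option X => p = q \o H 1)).
- move=> phi pc; exists (phi \o g); last by apply/funext => x /=; rewrite hK.
  apply/(pull_coloring hK gK ch cg pl car).
  by rewrite (_ : _ \o _ = phi)//; apply/funext => x /=; rewrite hK.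
- by move=> phi /(pull_coloring hK gK ch cg pl car) pc; exists (phi \o H 1).
- move=> p q1 q2 _ _ _ -> e; apply/funext => x.
  by have := congr1 (fun F => F (g x)) e; rewrite /= gK.
- by move=> p1 p2 q _ _ _ -> ->.
Qed.

End IsotopyCounting.

(** * Invariance *)

Section Invariance.
Variables (R : realType) (X : finType) (B : psybracket X).

Lemma singular_move_counting (K K' : diagram R) :
  singular_move K K' -> counting_invariant B K = counting_invariant B K'.
Proof.
case=> [[]|[]].
- exact: add_kink_counting.
- exact: RII_counting.
- exact: slide_strand_counting.
- exact: PII_counting.
- exact: slide_strand_counting.
Qed.

Lemma pseudoknot_move_counting (K K' : diagram R) :
  pseudoknot_move K K' -> counting_invariant B K = counting_invariant B K'.
Proof. by case; [exact: singular_move_counting | exact: add_kink_counting]. Qed.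

Lemma generated_invariant (rel : diagram R -> diagram R -> Prop) :
  (forall K K', rel K K' -> counting_invariant B K = counting_invariant B K') ->
  forall K K', clos_refl_sym_trans _ rel K K' ->
    counting_invariant B K = counting_invariant B K'.
Proof. by move=> inv K K'; elim=> // ? L M _ -> _ ->. Qed.

End Invariance.

Theorem theorem2 (R : realType) (X : finType) (B : psybracket X) :
  (forall K : diagram R, finite_set (colorings B K)) /\
  (forall K K' : diagram R, pseudoknot_equivalent K K' ->
     counting_invariant B K = counting_invariant B K') /\
  (forall K K' : diagram R, singular_equivalent K K' ->
     counting_invariant B K = counting_invariant B K').
Proof.
split; first exact: finite_colorings.
split; apply: generated_invariant => K K' [/planar_isotopic_counting //|].
- exact: pseudoknot_move_counting.
- exact: singular_move_counting.
Qed.
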